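(* Let $s>2$. For every sufficiently small $\delta>0$ and every sufficiently large $\mathcal{C}>0$ there exists $p_0=p_0(s,\delta,\mathcal{C})$ such that for every even integer $p\geq p_0$ the equation \[ u_{tt}-\Delta u+V_p*u+u^p=0,\qquad u=u(t,x),\ t\in\mathbb{R},\ x\in\mathbb{T}:=\mathbb{R}/2\pi\mathbb{Z}, \] with $V_p(x):=1+\cos(x)+p^2\cos(px)$, possesses a solution $u(t,x)$ such that $\|u(0)\|_{E^s}\le\delta$ and \[ \frac{\|u(T)\|_{E^s}}{\|u(0)\|_{E^s}}\geq\mathcal{C} \] at a time $T=\mathcal{O}\big(2^p\,p^{-1}\,\|u(0)\|_{E^s}^{1-p}\big)$.
   Context: For $s\in\mathbb{R}$ and $u=\sum_{j\in\mathbb{Z}}u_je^{\mathrm{i}jx}$, $\|u\|_s^2:=\sum_{j\in\mathbb{Z}}|u_j|^2\langle j\rangle^{2s}$ with $\langle j\rangle:=\max\{1,|j|\}$, and $H^s$ is the corresponding Sobolev space on $\mathbb{T}$. The norm $\|u\|_{E^s}:=\|u\|_{s+1/2}+\|u_t\|_{s-1/2}$. The convolution term $V_p*u$ is the Fourier multiplier $e^{\mathrm{i}jx}\mapsto V_j e^{\mathrm{i}jx}$ with $V_0=1$, $V_{\pm1}=1$, $V_{\pm p}=p^2$ and $V_j=0$ otherwise, so that the linear frequencies $\omega(j)=\sqrt{j^2+V_j}$ equal $1$ for $j=0$, $\sqrt2|j|$ for $j\in\{\pm1,\pm p\}$, and $|j|$ otherwise. ''Sufficiently small/large'' means below/above some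 universal constant. The notation $A=\mathcal{O}(B)$ means there exist pure constants $0<C_1<C_2$ with $C_1B\le A\le C_2B$. *)

(* Defs.v *)
From Stdlib Require Import Reals Lra.
From Coquelicot Require Import Coquelicot.
Open Scope R_scope.

(* Real Fourier data of a 2*PI-periodic real function f:
   f_j = (1/2pi) int_0^{2pi} f(y) e^{-ijy} dy = fc_cos f j - i * fc_sin f j. *)
Definition fc_cos (f : R -> R) (j : nat) : R :=
  / (2 * PI) * RInt (fun y => f y * cos (INR j * y)) 0 (2 * PI).
Definition fc_sin (f : R -> R) (j : nat) : R :=
  / (2 * PI) * RInt (fun y => f y * sin (INR j * y)) 0 (2 * PI).

(* |f_j|^2 = |f_{-j}|^2 for real f *)
Definition fc_sq (f : R -> R) (j : nat) : R := fc_cos f j ^ 2 + fc_sin f j ^ 2.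

Definition Hs_terms (r : R) (f : R -> R) (k : nat) : R :=
  Rpower (INR (S k)) (2 * r) * fc_sq f (S k).

Definition Hs_fin (r : R) (f : R -> R) : Prop := ex_series (Hs_terms r f).

(* ||f||_r^2 = |f_0|^2 + sum_{j <> 0} |j|^{2r} |f_j|^2  (<0> = 1) *)
Definition Hs_norm (r : R) (f : R -> R) : R :=
  sqrt (fc_sq f 0 + 2 * Series (Hs_terms r f)).

Definition dt (u : R -> R -> R) (t : R) : R -> R :=
  fun x => Derive (fun tau => u tau x) t.

Definition Es_norm (s : R) (u : R -> R -> R) (t : R) : R :=
  Hs_norm (s + /2) (u t) + Hs_norm (s - /2) (dt u t).

(* V_p * f : Fourier multiplier with V_0 = 1, V_{+-1} = 1, V_{+-p} = p^2, V_j = 0 else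
   (convolution (1/2pi) int K(x-y) f(y) dy with K(x) = 1 + 2 cos x + 2 p^2 cos(px)). *)
Definition Vconv (p : nat) (f : R -> R) (x : R) : R :=
  / (2 * PI) * RInt f 0 (2 * PI)
  + / PI * RInt (fun y => f y * cos (x - y)) 0 (2 * PI)
  + (INR p) ^ 2 / PI * RInt (fun y => f y * cos (INR p * (x - y))) 0 (2 * PI).

Definition is_solution (s : R) (p : nat) (u : R -> R -> R) (T : R) : Prop :=
  (forall t x, u t (x + 2 * PI) = u t x) /\
  (exists eps, 0 < eps /\
     forall t, - eps < t < T + eps ->
       forall x,
         ex_derive (fun tau => u tau x) t /\
         ex_derive (fun tau => Derive (fun sig => u sig x) tau) t /\
         ex_derive (fun y => u t y) x /\
         ex_derive (fun y => Derive (fun z => u t z) y) x /\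
         Derive (fun tau => Derive (fun sig => u sig x) tau) t
         - Derive (fun y => Derive (fun z => u t z) y) x
         + Vconv p (u t) x + (u t x) ^ p = 0) /\
  (forall t, 0 <= t <= T -> Hs_fin (s + /2) (u t) /\ Hs_fin (s - /2) (dt u t)).

(* Main.v *)
Require Import Defs.
From Stdlib Require Import Reals Arith Lra Lia List.
From Coquelicot Require Import Coquelicot.
Open Scope R_scope.

(** Write [u = A y] with [eps = A^(p-1)] and [c + d = 1]. The linear solution
    [Y = c cos t + d cos 2t cos 2x] has integer frequencies, as do all wave modes [j <> 0, 1, p].
    Since [p] is even, [Y^p >= 0] is a sum of peaks of width [p^(-1/2)] in [t] and [x], and it forces
    all modes [j] in [4 Z] with [j <= const p^(1/2)] resonantly, with the same strength of order [1/p].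

    A contraction in the Wiener algebra with weights [(1 + 1/p)^j] shows that [y] stays within [1/p]
    of [Y] as long as [eps T <= const / log p]: the Duhamel integral of a mode [j <= p] gains a factor
    [1/p] from the concentration of the peaks, and a mode [j > p] gains it from its frequency.
    At such a time [T] the resonant modes satisfy [j |y_j| + |y_j'| >= const / (p log p)], and summing
    about [p^(1/2)] of them gives an [E^s] norm of at least [const p^(s/2-1) / log p], which is
    unbounded for [s > 2].

    The time scale [2^p p^(-1) N^(1-p)] is reached by varying [d]: this changes the norm [N] of the data
    between [A] and [2^s A], while the dynamics only depends on the supremum [A (c + d)]. *)

(** The obstacle is the factor p produced by differentiating [y^p]: a contraction up to [eps T] of
    order 1/log p must find a full factor 1/p in the Duhamel integral. The peaks supply it because
    they are narrow in both variables, p^(-1/2) each. The radius 1/p is the scale on which p-th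
    powers stay comparable, since (1 + C/p)^p is bounded; one profile dominating |Y| + 1/p therefore
    serves all iterates. The weight 1 + 1/p is tied to p for the same reason: it costs a bounded
    factor over p products and on modes up to p, yet it still forces geometric decay of the
    coefficients, so that regularity can be checked termwise. The logarithm is the sum of the
    inverse frequencies up to p. Keeping c and d above 2^(-s) makes the peak widths uniform. If the
    data have norm [N = A nu], the prescribed time scale makes [eps T] comparable to 2^p / (p
    nu^(p-1)); so nu^(p-1) has to hit one prescribed value, which lies between (3/2)^(p-1) and
    2^(p-1), and the intermediate value theorem in d reaches it. *)

(** * Continuous functions on the line and their integrals *)

Definition cont (f : R -> R) : Prop := forall x : R, continuous f x.

Lemma cont_ext (f g : R -> R) : (forall x, f x = g x) -> cont f -> cont g.
Proof. intros E H x. apply (continuous_ext f g x E (H x)). Qed.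

Lemma cont_const (a : R) : cont (fun _ => a).
Proof. intros x. apply continuous_const. Qed.

Lemma cont_plus (f g : R -> R) : cont f -> cont g -> cont (fun x => f x + g x).
Proof. intros Hf Hg x. apply (continuous_plus f g x (Hf x) (Hg x)). Qed.

Lemma cont_mult (f g : R -> R) : cont f -> cont g -> cont (fun x => f x * g x).
Proof. intros Hf Hg x. apply (continuous_mult f g x (Hf x) (Hg x)). Qed.

Lemma cont_scal (a : R) (f : R -> R) : cont f -> cont (fun x => a * f x).
Proof. intros Hf. apply cont_mult; [apply cont_const | exact Hf]. Qed.

Lemma cont_minus (f g : R -> R) : cont f -> cont g -> cont (fun x => f x - g x).
Proof. intros Hf Hg x. apply (continuous_minus f g x (Hf x) (Hg x)). Qed.

Lemma cont_Rabs (f : R -> R) : cont f -> cont (fun x => Rabs (f x)).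
Proof. intros Hf x. apply continuous_comp; [apply Hf | apply continuous_Rabs]. Qed.

Lemma cont_pow (f : R -> R) (n : nat) : cont f -> cont (fun x => f x ^ n).
Proof.
  intros Hf. induction n as [|n IH]; simpl; [apply cont_const|].
  now apply cont_mult.
Qed.

Lemma cont_derive (f f' : R -> R) : (forall x, is_derive f x (f' x)) -> cont f.
Proof. intros H x. apply (@ex_derive_continuous R_AbsRing R_NormedModule). now exists (f' x). Qed.

Lemma cont_eps (f : R -> R) :
  (forall x e, 0 < e -> exists d, 0 < d /\ forall y, Rabs (y - x) < d -> Rabs (f y - f x) <= e) ->
  cont f.
Proof.
  intros H x. apply filterlim_locally. intros [e He].
  destruct (H x (e / 2)) as (d & Hd & Hy); [lra|].
  exists (mkposreal d Hd). intros y Hb.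
  specialize (Hy y Hb). simpl. unfold ball; simpl; unfold AbsRing_ball, abs, minus, plus, opp; simpl.
  unfold Rminus in Hy. lra.
Qed.

Lemma cont_eps_inv (f : R -> R) (x e : R) :
  cont f -> 0 < e -> exists d, 0 < d /\ forall y, Rabs (y - x) < d -> Rabs (f y - f x) <= e.
Proof.
  intros H He. specialize (H x).
  destruct (proj1 (filterlim_locally f (f x)) H (mkposreal e He)) as [[d Hd] Hb].
  exists d; split; [exact Hd|]. intros y Hy. specialize (Hb y Hy).
  unfold ball in Hb; simpl in Hb; unfold AbsRing_ball, abs, minus, plus, opp in Hb; simpl in Hb.
  unfold Rminus. lra.
Qed.

Lemma cont_cosI (a : R) : cont (fun x => cos (a * x)).
Proof. apply cont_derive with (fun x => - (a * sin (a * x))). intros x. auto_derive; [easy | ring]. Qed.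

Lemma cont_sinI (a : R) : cont (fun x => sin (a * x)).
Proof. apply cont_derive with (fun x => a * cos (a * x)). intros x. auto_derive; [easy | ring]. Qed.

Lemma cont_RI (f : R -> R) (a b : R) : cont f -> ex_RInt f a b.
Proof. intros H. apply (@ex_RInt_continuous R_CompleteNormedModule). intros; apply H. Qed.

Lemma RI_plus (f g : R -> R) (a b : R) : cont f -> cont g ->
  RInt (fun x => f x + g x) a b = RInt f a b + RInt g a b.
Proof. intros Hf Hg. apply (RInt_plus f g a b); now apply cont_RI. Qed.

Lemma RI_minus (f g : R -> R) (a b : R) : cont f -> cont g ->
  RInt (fun x => f x - g x) a b = RInt f a b - RInt g a b.
Proof. intros Hf Hg. apply (RInt_minus f g a b); now apply cont_RI. Qed.

Lemma RI_scal (k : R) (f : R -> R) (a b : R) : cont f ->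
  RInt (fun x => k * f x) a b = k * RInt f a b.
Proof. intros Hf. apply (RInt_scal f a b k); now apply cont_RI. Qed.

Lemma RI_Chasles (f : R -> R) (a b c : R) : cont f ->
  RInt f a b + RInt f b c = RInt f a c.
Proof. intros Hf. apply (RInt_Chasles f a b c); now apply cont_RI. Qed.

Lemma RI_ext (f g : R -> R) (a b : R) : (forall x, f x = g x) -> RInt f a b = RInt g a b.
Proof. intros H. apply RInt_ext. intros; apply H. Qed.

Lemma RI_le (f g : R -> R) (a b : R) : a <= b -> cont f -> cont g ->
  (forall x, a <= x <= b -> f x <= g x) -> RInt f a b <= RInt g a b.
Proof.
  intros Hab Hf Hg H. apply RInt_le; try apply cont_RI; auto.
  intros x Hx; apply H; lra.
Qed.

Lemma RI_const (a b k : R) : RInt (fun _ => k) a b = (b - a) * k.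
Proof. rewrite RInt_const. reflexivity. Qed.

Lemma RI_ge0 (f : R -> R) (a b : R) : a <= b -> cont f ->
  (forall x, a <= x <= b -> 0 <= f x) -> 0 <= RInt f a b.
Proof. intros Hab Hf H. apply RInt_ge_0; try apply cont_RI; auto. intros x Hx; apply H; lra. Qed.

Lemma RI_swap (f : R -> R) (a b : R) : cont f -> RInt f b a = - RInt f a b.
Proof.
  intros Hf. assert (H := RI_Chasles f a b a Hf). rewrite RInt_point in H.
  unfold zero in H; simpl in H. lra.
Qed.

Lemma RI_abs (f : R -> R) (a b : R) : a <= b -> cont f ->
  Rabs (RInt f a b) <= RInt (fun x => Rabs (f x)) a b.
Proof. intros Hab Hf. apply abs_RInt_le; auto. now apply cont_RI. Qed.

Lemma RI_abs_le (f g : R -> R) (a b : R) : a <= b -> cont f -> cont g ->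
  (forall x, a <= x <= b -> Rabs (f x) <= g x) -> Rabs (RInt f a b) <= RInt g a b.
Proof.
  intros Hab Hf Hg H. eapply Rle_trans; [apply RI_abs; auto|].
  apply RI_le; auto. now apply cont_Rabs.
Qed.

Lemma is_derive_RI (f : R -> R) (a x : R) : cont f -> is_derive (fun t => RInt f a t) x (f x).
Proof.
  intros Hf. apply (is_derive_RInt f (fun t => RInt f a t) a x); [|apply Hf].
  apply filter_forall. intros y. apply (RInt_correct f). now apply cont_RI.
Qed.

(** * Cosine polynomials *)

(** Pairs of coefficient and frequency. Frequencies may repeat, so sums and products are plain list
    operations; [tnorm] is then an upper bound for the weighted coefficient norm of the collected
    polynomial. *)
Definition tpoly := list (R * nat).

Fixpoint tev (l : tpoly) (x : R) : R :=
  match l with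
  | nil => 0
  | (a, j) :: l' => a * cos (INR j * x) + tev l' x
  end.

Fixpoint tnorm (q : R) (l : tpoly) : R :=
  match l with
  | nil => 0
  | (a, j) :: l' => Rabs a * q ^ j + tnorm q l'
  end.

Fixpoint tcoef (l : tpoly) (n : nat) : R :=
  match l with
  | nil => 0
  | (a, j) :: l' => (if Nat.eq_dec j n then a else 0) + tcoef l' n
  end.

Definition ndist (i j : nat) : nat := ((i - j) + (j - i))%nat.

Fixpoint tmono (a : R) (j : nat) (l : tpoly) : tpoly :=
  match l with
  | nil => nil
  | (b, i) :: l' => (a * b / 2, (i + j)%nat) :: (a * b / 2, ndist i j) :: tmono a j l'
  end.

Fixpoint tmul (l m : tpoly) : tpoly :=
  match l with
  | nil => nil
  | (a, j) :: l' => tmono a j m ++ tmul l' m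
  end.

Lemma cos_prod (i j : nat) (x : R) :
  cos (INR i * x) * cos (INR j * x)
  = / 2 * cos (INR (i + j) * x) + / 2 * cos (INR (ndist i j) * x).
Proof.
  assert (E : cos (INR (ndist i j) * x) = cos (INR i * x - INR j * x)).
  { unfold ndist. destruct (le_ge_dec i j) as [H|H].
    - replace (i - j + (j - i))%nat with (j - i)%nat by lia.
      rewrite minus_INR by lia. rewrite <- cos_neg. f_equal; ring.
    - replace (i - j + (j - i))%nat with (i - j)%nat by lia.
      rewrite minus_INR by lia. f_equal; ring. }
  rewrite E, plus_INR, Rmult_plus_distr_r, cos_plus, cos_minus. field.
Qed.

Lemma tev_app (l m : tpoly) (x : R) : tev (l ++ m) x = tev l x + tev m x.
Proof. induction l as [|[a j] l IH]; simpl; [ring|]. rewrite IH; ring. Qed.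

Lemma tnorm_app (q : R) (l m : tpoly) : tnorm q (l ++ m) = tnorm q l + tnorm q m.
Proof. induction l as [|[a j] l IH]; simpl; [ring|]. rewrite IH; ring. Qed.

Lemma tev_mono (a : R) (j : nat) (l : tpoly) (x : R) :
  tev (tmono a j l) x = a * cos (INR j * x) * tev l x.
Proof.
  induction l as [|[b i] l IH]; simpl; [ring|].
  rewrite IH.
  replace (a * cos (INR j * x) * (b * cos (INR i * x) + tev l x))
    with (a * b * (cos (INR i * x) * cos (INR j * x)) + a * cos (INR j * x) * tev l x) by ring.
  rewrite cos_prod. field.
Qed.

Lemma tev_mul (l m : tpoly) (x : R) : tev (tmul l m) x = tev l x * tev m x.
Proof.
  induction l as [|[a j] l IH]; simpl; [ring|].
  rewrite tev_app, IH, tev_mono. ring.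
Qed.

Lemma pow_ge_1 (q : R) (n : nat) : 1 <= q -> 1 <= q ^ n.
Proof. intros H. apply pow_R1_Rle, H. Qed.

Lemma tnorm_nonneg (q : R) (l : tpoly) : 1 <= q -> 0 <= tnorm q l.
Proof.
  intros Hq. induction l as [|[a j] l IH]; simpl; [lra|].
  assert (0 <= Rabs a * q ^ j) by (apply Rmult_le_pos; [apply Rabs_pos | apply pow_le; lra]). lra.
Qed.

(** The product-to-sum formula splits each product into two halves at the frequencies i + j and |i -
    j|; since q >= 1, both weights are at most q^i q^j. This is the source of the algebra
    property. *)
Lemma tnorm_mono (q a : R) (j : nat) (l : tpoly) : 1 <= q ->
  tnorm q (tmono a j l) <= Rabs a * q ^ j * tnorm q l.
Proof.
  intros Hq. induction l as [|[b i] l IH]; simpl; [lra|].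
  assert (H1 : q ^ ndist i j <= q ^ (i + j)) by (apply Rle_pow; [lra | unfold ndist; lia]).
  assert (H2 : Rabs (a * b / 2) = Rabs a * Rabs b / 2).
  { unfold Rdiv. rewrite !Rabs_mult, (Rabs_pos_eq (/ 2)) by lra. ring. }
  rewrite H2. rewrite pow_add in *.
  assert (H3 : 0 <= Rabs a * Rabs b / 2).
  { assert (0 <= Rabs a * Rabs b) by (apply Rmult_le_pos; apply Rabs_pos). lra. }
  assert (H4 := Rmult_le_compat_l _ _ _ H3 H1). nra.
Qed.

Lemma tnorm_mul (q : R) (l m : tpoly) : 1 <= q ->
  tnorm q (tmul l m) <= tnorm q l * tnorm q m.
Proof.
  intros Hq. induction l as [|[a j] l IH]; simpl; [lra|].
  rewrite tnorm_app. assert (H := tnorm_mono q a j m Hq). lra.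
Qed.

Lemma tev_bound (q : R) (l : tpoly) (x : R) : 1 <= q -> Rabs (tev l x) <= tnorm q l.
Proof.
  intros Hq. induction l as [|[a j] l IH]; simpl; [rewrite Rabs_R0; lra|].
  eapply Rle_trans; [apply Rabs_triang|]. apply Rplus_le_compat; [|exact IH].
  rewrite Rabs_mult. apply Rmult_le_compat_l; [apply Rabs_pos|].
  eapply Rle_trans; [|apply pow_ge_1, Hq].
  apply Rabs_le. destruct (COS_bound (INR j * x)); lra.
Qed.

Lemma tev_cont (l : tpoly) : cont (tev l).
Proof.
  induction l as [|[a j] l IH]; simpl; [apply cont_const|].
  apply cont_plus; [apply cont_scal, cont_cosI | exact IH].
Qed.

Lemma cos_INR_shift (j : nat) (x : R) : cos (INR j * (x + 2 * PI)) = cos (INR j * x).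
Proof. rewrite <- (cos_period (INR j * x) j). f_equal; ring. Qed.

Lemma sin_INR_shift (j : nat) (x : R) : sin (INR j * (x + 2 * PI)) = sin (INR j * x).
Proof. rewrite <- (sin_period (INR j * x) j). f_equal; ring. Qed.

Lemma tev_period (l : tpoly) (x : R) : tev l (x + 2 * PI) = tev l x.
Proof.
  induction l as [|[a j] l IH]; simpl; [easy|]. now rewrite IH, cos_INR_shift.
Qed.

Lemma tev_even (l : tpoly) (x : R) : tev l (- x) = tev l x.
Proof.
  induction l as [|[a j] l IH]; simpl; [easy|]. rewrite IH.
  replace (INR j * - x) with (- (INR j * x)) by ring. now rewrite cos_neg.
Qed.

Lemma sum_f_R0_le (a b : nat -> R) (n : nat) :
  (forall k, (k <= n)%nat -> a k <= b k) -> sum_f_R0 a n <= sum_f_R0 b n.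
Proof. intros H. apply sum_Rle. intros k Hk; now apply H. Qed.

Lemma sum_delta (a : R) (j n : nat) (f : nat -> R) :
  sum_f_R0 (fun k => (if Nat.eq_dec j k then a else 0) * f k) n
  = if le_dec j n then a * f j else 0.
Proof.
  induction n as [|n IH]; simpl.
  - destruct (Nat.eq_dec j 0), (le_dec j 0); subst; try lia; ring.
  - rewrite IH. destruct (Nat.eq_dec j (S n)), (le_dec j n), (le_dec j (S n)); subst; try lia; ring.
Qed.

Lemma sum_zero (a : nat -> R) (n : nat) : (forall k, (k <= n)%nat -> a k = 0) -> sum_f_R0 a n = 0.
Proof.
  intros H. induction n as [|n IH]; simpl; [now apply H|].
  rewrite IH, H by (try (intros; apply H); lia). ring.
Qed.

Lemma tcoef_sum (q : R) (l : tpoly) (n : nat) : 1 <= q ->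
  sum_f_R0 (fun k => Rabs (tcoef l k) * q ^ k) n <= tnorm q l.
Proof.
  intros Hq. induction l as [|[a j] l IH]; simpl.
  - rewrite sum_zero; [lra|]. intros; rewrite Rabs_R0; ring.
  - eapply Rle_trans; [apply sum_f_R0_le with (b := fun k =>
      (if Nat.eq_dec j k then Rabs a else 0) * q ^ k + Rabs (tcoef l k) * q ^ k)|].
    + intros k _. rewrite <- Rmult_plus_distr_r. apply Rmult_le_compat_r; [apply pow_le; lra|].
      eapply Rle_trans; [apply Rabs_triang|]. apply Rplus_le_compat_r.
      destruct (Nat.eq_dec j k); [lra | rewrite Rabs_R0; lra].
    + rewrite sum_plus, sum_delta.
      assert (0 <= Rabs a * q ^ j) by (apply Rmult_le_pos; [apply Rabs_pos | apply pow_le; lra]).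
      destruct (le_dec j n); lra.
Qed.

(** A mode j > n is bounded by its weighted size divided by q^j, hence by q^n; repeated entries are
    harmless because the estimate is made entry by entry. *)
Lemma tev_tail (q : R) (l : tpoly) (n : nat) (x : R) : 1 <= q ->
  Rabs (tev l x - sum_f_R0 (fun k => tcoef l k * cos (INR k * x)) n) <= tnorm q l * (/ q) ^ n.
Proof.
  intros Hq. induction l as [|[a j] l IH]; simpl.
  - rewrite sum_zero by (intros; ring). rewrite Rminus_0_r, Rabs_R0; lra.
  - rewrite (sum_eq _ (fun k => (if Nat.eq_dec j k then a else 0) * cos (INR k * x)
       + tcoef l k * cos (INR k * x))); [|intros; ring].
    rewrite sum_plus, sum_delta, Rmult_plus_distr_r.
    match goal with |- Rabs (?u + ?v - (?w + ?z)) <= _ =>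
      replace (u + v - (w + z)) with ((u - w) + (v - z)) by ring end.
    eapply Rle_trans; [apply Rabs_triang|]. apply Rplus_le_compat; [|exact IH].
    assert (Hqn : 0 < (/ q) ^ n) by (apply pow_lt, Rinv_0_lt_compat; lra).
    destruct (le_dec j n) as [Hj|Hj].
    + rewrite Rminus_diag, Rabs_R0.
      repeat apply Rmult_le_pos; try apply Rabs_pos; try lra. apply pow_le; lra.
    + rewrite Rminus_0_r, Rabs_mult, Rmult_assoc. apply Rmult_le_compat_l; [apply Rabs_pos|].
      apply Rle_trans with 1; [apply Rabs_le; destruct (COS_bound (INR j * x)); lra|].
      replace j with (n + (j - n))%nat by lia. rewrite pow_add, pow_inv.
      assert (0 < q ^ n) by (apply pow_lt; lra).
      assert (1 <= q ^ (j - n)) by now apply pow_ge_1.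
      replace (q ^ n * q ^ (j - n) * / q ^ n) with (q ^ (j - n)) by (field; lra). lra.
Qed.

(** * Cosine coefficients *)

(** Normalised so that an even f is the sum of [cf f n] cos(n x): for n > 0 this is twice the
    complex Fourier coefficient. *)
Definition cf (f : R -> R) (n : nat) : R :=
  (if Nat.eq_dec n 0 then / (2 * PI) else / PI) * RInt (fun x => f x * cos (INR n * x)) 0 (2 * PI).

Lemma cont_mcos (f : R -> R) (n : nat) : cont f -> cont (fun x => f x * cos (INR n * x)).
Proof. intros H. apply cont_mult; [exact H | apply cont_cosI]. Qed.

Lemma cf_plus (f g : R -> R) (n : nat) : cont f -> cont g ->
  cf (fun x => f x + g x) n = cf f n + cf g n.
Proof.
  intros Hf Hg. unfold cf.
  rewrite (RI_ext _ (fun x => f x * cos (INR n * x) + g x * cos (INR n * x))) by (intros; ring).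
  rewrite RI_plus by now apply cont_mcos. ring.
Qed.

Lemma cf_scal (a : R) (f : R -> R) (n : nat) : cont f -> cf (fun x => a * f x) n = a * cf f n.
Proof.
  intros Hf. unfold cf.
  rewrite (RI_ext _ (fun x => a * (f x * cos (INR n * x)))) by (intros; ring).
  rewrite RI_scal by now apply cont_mcos. ring.
Qed.

Lemma cf_minus (f g : R -> R) (n : nat) : cont f -> cont g ->
  cf (fun x => f x - g x) n = cf f n - cf g n.
Proof.
  intros Hf Hg. unfold cf.
  rewrite (RI_ext _ (fun x => f x * cos (INR n * x) - g x * cos (INR n * x))) by (intros; ring).
  rewrite RI_minus by now apply cont_mcos. ring.
Qed.

Lemma cf_weight (n : nat) : 0 < (if Nat.eq_dec n 0 then / (2 * PI) else / PI) <= / PI.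
Proof.
  assert (H := PI_RGT_0). assert (H1 := Rinv_0_lt_compat _ H).
  destruct (Nat.eq_dec n 0); [|lra]. rewrite Rinv_mult. lra.
Qed.

Lemma cf_bound (f g : R -> R) (n : nat) : cont f -> cont g ->
  (forall x, Rabs (f x) <= g x) -> Rabs (cf f n) <= / PI * RInt g 0 (2 * PI).
Proof.
  intros Hf Hg H. unfold cf. assert (HP := PI_RGT_0). destruct (cf_weight n) as [W1 W2].
  rewrite Rabs_mult, Rabs_pos_eq by lra.
  apply Rmult_le_compat; try lra; try apply Rabs_pos.
  apply RI_abs_le; [lra | now apply cont_mcos | exact Hg |].
  intros x _. rewrite Rabs_mult, <- (Rmult_1_r (g x)).
  apply Rmult_le_compat; try apply Rabs_pos; auto.
  apply Rabs_le. destruct (COS_bound (INR n * x)); lra.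
Qed.

Lemma cf_bound_const (f : R -> R) (n : nat) (e : R) : cont f ->
  (forall x, Rabs (f x) <= e) -> Rabs (cf f n) <= 2 * e.
Proof.
  intros Hf H. eapply Rle_trans; [apply (cf_bound f (fun _ => e)); auto using cont_const|].
  rewrite RI_const. apply Req_le. field. apply PI_neq0.
Qed.

Lemma RI_cos_nat (k : nat) : (0 < k)%nat -> RInt (fun x => cos (INR k * x)) 0 (2 * PI) = 0.
Proof.
  intros Hk. assert (H0 : INR k <> 0) by (apply not_0_INR; lia).
  apply is_RInt_unique.
  replace 0 with (minus (sin (INR k * (2 * PI)) / INR k) (sin (INR k * 0) / INR k)) at 2.
  - apply (is_RInt_derive (fun x => sin (INR k * x) / INR k)).
    + intros x _. auto_derive; [easy|]. field. exact H0.
    + intros x _. apply cont_cosI.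
  - unfold minus, plus, opp; simpl. rewrite <- (Rplus_0_l (2 * PI)), sin_INR_shift.
    ring.
Qed.

Lemma cf_cos (j n : nat) : cf (fun x => cos (INR j * x)) n = if Nat.eq_dec j n then 1 else 0.
Proof.
  assert (HP := PI_neq0).
  unfold cf.
  rewrite (RI_ext _ (fun x => / 2 * cos (INR (j + n) * x) + / 2 * cos (INR (ndist j n) * x)))
    by (intros; apply cos_prod).
  rewrite RI_plus by apply cont_scal, cont_cosI.
  rewrite !RI_scal by apply cont_cosI.
  destruct (Nat.eq_dec j n) as [->|Hj].
  - replace (ndist n n) with 0%nat by (unfold ndist; lia).
    rewrite (RI_ext (fun x => cos (INR 0 * x)) (fun _ => 1))
      by (intros; simpl; now rewrite Rmult_0_l, cos_0).
    rewrite RI_const. destruct (Nat.eq_dec n 0) as [->|Hn].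
    + rewrite (RI_ext (fun x => cos (INR (0 + 0) * x)) (fun _ => 1))
        by (intros; simpl; now rewrite Rmult_0_l, cos_0).
      rewrite RI_const. field. exact HP.
    + rewrite RI_cos_nat by lia. field. exact HP.
  - rewrite !RI_cos_nat by (unfold ndist; lia). ring.
Qed.

Lemma cf_ext (f g : R -> R) (n : nat) : (forall x, f x = g x) -> cf f n = cf g n.
Proof. intros H. unfold cf. f_equal. apply RI_ext. intros; now rewrite H. Qed.

Lemma cf_tev (l : tpoly) (n : nat) : cf (tev l) n = tcoef l n.
Proof.
  induction l as [|[a j] l IH].
  - simpl. rewrite (cf_ext _ (fun x => 0 * 1)) by (intros; simpl; ring).
    rewrite cf_scal by apply cont_const. ring.
  - rewrite (cf_ext _ (fun x => a * cos (INR j * x) + tev l x)) by easy.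
    rewrite cf_plus by (try apply cont_scal, cont_cosI; apply tev_cont).
    rewrite cf_scal by apply cont_cosI. rewrite cf_cos, IH. simpl.
    destruct (Nat.eq_dec j n); ring.
Qed.

(** * The weighted Wiener algebra *)

(* [W q f B] says that [f] has a cosine series with [sum |f_j| q^j <= B]; phrasing it through
   approximation by polynomials makes the algebra property a finite computation. *)
Definition W (q : R) (f : R -> R) (B : R) : Prop :=
  forall e, 0 < e -> exists l, tnorm q l <= B /\ forall x, Rabs (f x - tev l x) <= e.

Lemma W_ext (q : R) (f g : R -> R) (B : R) : (forall x, f x = g x) -> W q f B -> W q g B.
Proof.
  intros E H e He. destruct (H e He) as (l & H1 & H2). exists l; split; [exact H1|].
  intros x; now rewrite <- E.
Qed.

Lemma W_le (q : R) (f : R -> R) (B B' : R) : B <= B' -> W q f B -> W q f B'.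
Proof. intros HB H e He. destruct (H e He) as (l & H1 & H2). exists l; split; [lra | exact H2]. Qed.

Lemma W_nonneg (q : R) (f : R -> R) (B : R) : 1 <= q -> W q f B -> 0 <= B.
Proof. intros Hq H. destruct (H 1) as (l & H1 & _); [lra|]. assert (H2 := tnorm_nonneg q l Hq). lra. Qed.

Lemma W_sup (q : R) (f : R -> R) (B : R) (x : R) : 1 <= q -> W q f B -> Rabs (f x) <= B.
Proof.
  intros Hq H. apply le_epsilon. intros e He. destruct (H e He) as (l & H1 & H2).
  specialize (H2 x). assert (H3 := tev_bound q l x Hq).
  replace (f x) with ((f x - tev l x) + tev l x) by ring.
  eapply Rle_trans; [apply Rabs_triang|]. lra.
Qed.

Lemma W_cont (q : R) (f : R -> R) (B : R) : W q f B -> cont f.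
Proof.
  intros H. apply cont_eps. intros x e He. destruct (H (e / 3)) as (l & _ & H2); [lra|].
  destruct (cont_eps_inv (tev l) x (e / 3) (tev_cont l)) as (d & Hd & Hy); [lra|].
  exists d; split; [exact Hd|]. intros y Hyx. specialize (Hy y Hyx).
  assert (Hx := H2 x). specialize (H2 y). apply Rabs_le_between in Hx, Hy, H2. apply Rabs_le. lra.
Qed.

Lemma Rabs_le_eps_0 (x : R) : (forall e, 0 < e -> Rabs x <= e) -> x = 0.
Proof.
  intros H. destruct (Req_dec x 0) as [|Hx]; [easy|].
  assert (H1 := Rabs_pos_lt x Hx). specialize (H (Rabs x / 2)). lra.
Qed.

Lemma W_period (q : R) (f : R -> R) (B : R) (x : R) : W q f B -> f (x + 2 * PI) = f x.
Proof.
  intros H. apply Rminus_diag_uniq, Rabs_le_eps_0. intros e He.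
  destruct (H (e / 2)) as (l & _ & H2); [lra|].
  assert (H3 := H2 x). specialize (H2 (x + 2 * PI)). rewrite tev_period in H2.
  apply Rabs_le_between in H2, H3. apply Rabs_le. lra.
Qed.

Lemma W_even (q : R) (f : R -> R) (B : R) (x : R) : W q f B -> f (- x) = f x.
Proof.
  intros H. apply Rminus_diag_uniq, Rabs_le_eps_0. intros e He.
  destruct (H (e / 2)) as (l & _ & H2); [lra|].
  assert (H3 := H2 x). specialize (H2 (- x)). rewrite tev_even in H2.
  apply Rabs_le_between in H2, H3. apply Rabs_le. lra.
Qed.

(** Balls of the Wiener norm are closed under uniform convergence. This lets bounds on the Picard
    iterates pass to their limit without a completeness theorem for the algebra. *)
Lemma W_lim (q : R) (f : R -> R) (B : R) :
  (forall e, 0 < e -> exists g, W q g B /\ forall x, Rabs (f x - g x) <= e) -> W q f B.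
Proof.
  intros H e He. destruct (H (e / 2)) as (g & Hg & H1); [lra|].
  destruct (Hg (e / 2)) as (l & Hl & H2); [lra|]. exists l; split; [exact Hl|].
  intros x. specialize (H1 x). specialize (H2 x). apply Rabs_le_between in H1, H2. apply Rabs_le. lra.
Qed.

Lemma W_cos (q a : R) (j : nat) : W q (fun x => a * cos (INR j * x)) (Rabs a * q ^ j).
Proof.
  intros e He. exists ((a, j) :: nil). simpl. split; [lra|]. intros x.
  rewrite Rplus_0_r, Rminus_diag, Rabs_R0. lra.
Qed.

Lemma W_const (q a : R) : W q (fun _ => a) (Rabs a).
Proof.
  apply (W_ext q (fun x => a * cos (INR 0 * x))).
  - intros x; simpl. rewrite Rmult_0_l, cos_0; ring.
  - apply (W_le q _ (Rabs a * q ^ 0)); [simpl; lra|]. apply W_cos.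
Qed.

Lemma W_plus (q : R) (f g : R -> R) (B C : R) : W q f B -> W q g C -> W q (fun x => f x + g x) (B + C).
Proof.
  intros Hf Hg e He. destruct (Hf (e / 2)) as (l & Hl & H1); [lra|].
  destruct (Hg (e / 2)) as (m & Hm & H2); [lra|]. exists (l ++ m). rewrite tnorm_app. split; [lra|].
  intros x. rewrite tev_app. specialize (H1 x). specialize (H2 x).
  apply Rabs_le_between in H1, H2. apply Rabs_le. lra.
Qed.

Lemma W_mul (q : R) (f g : R -> R) (B C : R) : 1 <= q ->
  W q f B -> W q g C -> W q (fun x => f x * g x) (B * C).
Proof.
  intros Hq Hf Hg e He.
  assert (HB := W_nonneg q f B Hq Hf). assert (HC := W_nonneg q g C Hq Hg).
  set (d := e / (B + C + 1)). assert (Hd : 0 < d) by (apply Rdiv_lt_0_compat; lra).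
  destruct (Hf d Hd) as (l & Hl & H1). destruct (Hg d Hd) as (m & Hm & H2).
  exists (tmul l m). split.
  - eapply Rle_trans; [apply tnorm_mul, Hq|].
    apply Rmult_le_compat; auto using tnorm_nonneg.
  - intros x. rewrite tev_mul. specialize (H1 x). specialize (H2 x).
    assert (H3 := tev_bound q l x Hq). assert (H4 := W_sup q g C x Hq Hg).
    replace (f x * g x - tev l x * tev m x)
      with ((f x - tev l x) * g x + tev l x * (g x - tev m x)) by ring.
    eapply Rle_trans; [apply Rabs_triang|]. rewrite !Rabs_mult.
    apply Rle_trans with (d * C + B * d).
    + apply Rplus_le_compat; apply Rmult_le_compat; try apply Rabs_pos; lra.
    + replace e with (d * (B + C + 1)) by (unfold d; field; lra). nra.
Qed.

Lemma W_scal (q a : R) (f : R -> R) (B : R) : 1 <= q -> W q f B -> W q (fun x => a * f x) (Rabs a * B).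
Proof. intros Hq H. apply W_mul; [exact Hq | apply W_const | exact H]. Qed.

Lemma W_pow (q : R) (f : R -> R) (B : R) (n : nat) : 1 <= q -> W q f B -> W q (fun x => f x ^ n) (B ^ n).
Proof.
  intros Hq H. induction n as [|n IH]; simpl.
  - apply (W_le q _ (Rabs 1)); [rewrite Rabs_R1; lra | apply W_const].
  - now apply W_mul.
Qed.

Lemma W_cf_approx (q : R) (f : R -> R) (B : R) (l : tpoly) (e : R) (k : nat) : W q f B ->
  (forall x, Rabs (f x - tev l x) <= e) -> Rabs (cf f k - tcoef l k) <= 2 * e.
Proof.
  intros H Hl. rewrite <- cf_tev, <- cf_minus by (try apply tev_cont; now apply (W_cont q f B)).
  apply cf_bound_const; [|exact Hl]. apply cont_minus; [now apply (W_cont q f B) | apply tev_cont].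
Qed.

Lemma W_cf_sum (q : R) (f : R -> R) (B : R) (n : nat) : 1 <= q -> W q f B ->
  sum_f_R0 (fun k => Rabs (cf f k) * q ^ k) n <= B.
Proof.
  intros Hq H. apply le_epsilon. intros e He.
  set (Q := sum_f_R0 (fun k => q ^ k) n).
  assert (HQ : 0 <= Q) by (apply cond_pos_sum; intros; apply pow_le; lra).
  (* Each coefficient moves by at most 2 d under the approximation, so the finite weighted sum moves
     by at most 2 d Q <= e. *)
  set (d := e / (2 * Q + 1)). assert (Hd : 0 < d) by (apply Rdiv_lt_0_compat; lra).
  destruct (H d Hd) as (l & Hl & H1).
  apply Rle_trans with (sum_f_R0 (fun k => Rabs (tcoef l k) * q ^ k + q ^ k * (2 * d)) n).
  - apply sum_f_R0_le. intros k _. assert (H2 := W_cf_approx q f B l d k H H1).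
    assert (0 <= q ^ k) by (apply pow_le; lra).
    assert (Rabs (cf f k) <= Rabs (tcoef l k) + 2 * d).
    { replace (cf f k) with (tcoef l k + (cf f k - tcoef l k)) by ring.
      eapply Rle_trans; [apply Rabs_triang|]. lra. }
    replace (Rabs (tcoef l k) * q ^ k + q ^ k * (2 * d)) with ((Rabs (tcoef l k) + 2 * d) * q ^ k) by ring.
    now apply Rmult_le_compat_r.
  - rewrite sum_plus, <- (scal_sum (fun k => q ^ k) n (2 * d)). fold Q.
    assert (H2 := tcoef_sum q l n Hq).
    assert (2 * d * Q <= e); [|lra].
    replace e with (d * (2 * Q + 1)) by (unfold d; field; lra). nra.
Qed.

Lemma sum_ge_term (a : nat -> R) (n k : nat) : (forall i, 0 <= a i) -> (k <= n)%nat -> a k <= sum_f_R0 a n.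
Proof.
  intros Ha Hk. induction n as [|n IH]; simpl.
  - replace k with 0%nat by lia. lra.
  - destruct (Nat.eq_dec k (S n)) as [->|]; [|specialize (IH ltac:(lia)); specialize (Ha (S n)); lra].
    assert (H := cond_pos_sum a n Ha). lra.
Qed.

Lemma pow_decay (q c B : R) (k : nat) : 1 <= q -> Rabs c * q ^ k <= B -> Rabs c <= B * (/ q) ^ k.
Proof.
  intros Hq H. assert (0 < q ^ k) by (apply pow_lt; lra).
  rewrite pow_inv. apply Rmult_le_reg_r with (q ^ k); [lra|].
  replace (B * / q ^ k * q ^ k) with B by (field; lra). exact H.
Qed.

Lemma W_cf_decay (q : R) (f : R -> R) (B : R) (k : nat) : 1 <= q -> W q f B ->
  Rabs (cf f k) <= B * (/ q) ^ k.
Proof.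
  intros Hq H. apply pow_decay; [exact Hq|].
  eapply Rle_trans; [|apply (W_cf_sum q f B k Hq H)].
  apply (sum_ge_term (fun k => Rabs (cf f k) * q ^ k)); [|lia].
  intros i. apply Rmult_le_pos; [apply Rabs_pos | apply pow_le; lra].
Qed.

Lemma W_tail (q : R) (f : R -> R) (B : R) (n : nat) (x : R) : 1 <= q -> W q f B ->
  Rabs (f x - sum_f_R0 (fun k => cf f k * cos (INR k * x)) n) <= B * (/ q) ^ n.
Proof.
  intros Hq H. apply le_epsilon. intros e He.
  set (d := e / (2 * (INR (S n)) + 1)).
  assert (Hn := pos_INR (S n)).
  assert (Hd : 0 < d) by (apply Rdiv_lt_0_compat; lra).
  destruct (H d Hd) as (l & Hl & H1).
  assert (H2 := tev_tail q l n x Hq). specialize (H1 x) as H1x.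
  assert (H3 : Rabs (sum_f_R0 (fun k => tcoef l k * cos (INR k * x)) n
                     - sum_f_R0 (fun k => cf f k * cos (INR k * x)) n) <= 2 * d * INR (S n)).
  { rewrite <- minus_sum. eapply Rle_trans; [apply Rsum_abs|].
    apply Rle_trans with (sum_f_R0 (fun _ => 2 * d) n).
    - apply sum_f_R0_le. intros k _. rewrite <- Rmult_minus_distr_r, Rabs_mult, Rabs_minus_sym.
      assert (H3 := W_cf_approx q f B l d k H H1).
      assert (Rabs (cos (INR k * x)) <= 1) by (apply Rabs_le; destruct (COS_bound (INR k * x)); lra).
      assert (0 <= Rabs (cf f k - tcoef l k)) by apply Rabs_pos. nra.
    - rewrite sum_cte. lra. }
  assert (H4 : tnorm q l * (/ q) ^ n <= B * (/ q) ^ n).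
  { apply Rmult_le_compat_r; [apply pow_le, Rlt_le, Rinv_0_lt_compat; lra | exact Hl]. }
  replace (f x - sum_f_R0 (fun k => cf f k * cos (INR k * x)) n)
    with ((f x - tev l x) + (tev l x - sum_f_R0 (fun k => tcoef l k * cos (INR k * x)) n)
      + (sum_f_R0 (fun k => tcoef l k * cos (INR k * x)) n
                     - sum_f_R0 (fun k => cf f k * cos (INR k * x)) n)) by ring.
  eapply Rle_trans; [apply Rabs_triang|].
  eapply Rle_trans; [apply Rplus_le_compat_r, Rabs_triang|].
  assert (d + 2 * d * INR (S n) = e) by (unfold d; field; lra). lra.
Qed.

(** Cosine series are even and periodic, so the substitution y -> 2 PI - y changes the sign of the
    integral. *)
Lemma W_sin (q : R) (f : R -> R) (B : R) (n : nat) : W q f B ->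
  RInt (fun x => f x * sin (INR n * x)) 0 (2 * PI) = 0.
Proof.
  intros H. assert (Hc := W_cont q f B H).
  set (g := fun x => f x * sin (INR n * x)).
  assert (Hg : cont g) by (apply cont_mult; [exact Hc | apply cont_sinI]).
  assert (E := RInt_comp_lin g (-1) (2 * PI) 0 (2 * PI)).
  rewrite (RI_ext _ g) in E.
  - replace (-1 * 0 + 2 * PI) with (2 * PI) in E by ring.
    replace (-1 * (2 * PI) + 2 * PI) with 0 in E by ring.
    rewrite (RI_swap g 0 (2 * PI) Hg) in E. specialize (E (cont_RI g _ _ Hg)). lra.
  - intros y. unfold scal; simpl; unfold mult; simpl. unfold g.
    replace (-1 * y + 2 * PI) with (- y + 2 * PI) by ring.
    rewrite (W_period q f B (- y) H), (W_even q f B y H), sin_INR_shift.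
    replace (INR n * - y) with (- (INR n * y)) by ring. rewrite sin_neg. ring.
Qed.

Lemma is_series_sum_f (a : nat -> R) (l : R) : is_lim_seq (fun n => sum_f_R0 a n) l -> is_series a l.
Proof.
  intros H. apply is_lim_seq_ext with (v := fun n => sum_n a n) in H; [exact H|].
  intros n; now rewrite sum_n_Reals.
Qed.

Lemma is_lim_seq_geom_scal (B r : R) : 0 <= r < 1 -> is_lim_seq (fun n => B * r ^ n) 0.
Proof.
  intros Hr. replace (Finite 0) with (Rbar_mult (Finite B) (Finite 0)) by (simpl; now rewrite Rmult_0_r).
  apply is_lim_seq_scal_l. apply is_lim_seq_geom. rewrite Rabs_pos_eq; lra.
Qed.

Lemma is_series_tail (a : nat -> R) (s B r : R) : 0 <= r < 1 ->
  (forall n, Rabs (s - sum_f_R0 a n) <= B * r ^ n) -> is_series a s.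
Proof.
  intros Hr H. apply is_series_sum_f.
  apply is_lim_seq_le_le with (u := fun n => s - B * r ^ n) (w := fun n => s + B * r ^ n).
  - intros n. specialize (H n). apply Rabs_le_between in H. lra.
  - replace (Finite s) with (Finite (s - 0)) by (f_equal; ring).
    apply is_lim_seq_minus'; [apply is_lim_seq_const | now apply is_lim_seq_geom_scal].
  - replace (Finite s) with (Finite (s + 0)) by (f_equal; ring).
    apply is_lim_seq_plus'; [apply is_lim_seq_const | now apply is_lim_seq_geom_scal].
Qed.

Lemma inv_q_range (q : R) : 1 < q -> 0 <= / q < 1.
Proof.
  intros Hq. split; [apply Rlt_le, Rinv_0_lt_compat; lra|].
  rewrite <- Rinv_1. apply Rinv_lt_contravar; lra.
Qed.

Lemma W_series (q : R) (f : R -> R) (B : R) (x : R) : 1 < q -> W q f B ->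
  is_series (fun k => cf f k * cos (INR k * x)) (f x).
Proof.
  intros Hq H. apply is_series_tail with B (/ q); [now apply inv_q_range|].
  intros n. apply W_tail; [lra | exact H].
Qed.

(** * Functions built from given cosine coefficients *)

Definition cser (a : nat -> R) (x : R) : R := Series (fun k => a k * cos (INR k * x)).

Lemma ex_series_geom_bound (a : nat -> R) (B r : R) : 0 <= r < 1 ->
  (forall k, Rabs (a k) <= B * r ^ k) -> ex_series a.
Proof.
  intros Hr H. apply (@ex_series_le R_AbsRing R_CompleteNormedModule a (fun k => B * r ^ k)).
  - exact H.
  - apply (@ex_series_scal_l R_AbsRing). apply ex_series_geom. rewrite Rabs_pos_eq; lra.
Qed.

Lemma sum_decay (q : R) (a : nat -> R) (B : R) (k : nat) : 1 <= q ->
  (forall n, sum_f_R0 (fun k => Rabs (a k) * q ^ k) n <= B) -> Rabs (a k) <= B * (/ q) ^ k.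
Proof.
  intros Hq H. apply pow_decay; [exact Hq|]. eapply Rle_trans; [|apply (H k)].
  apply (sum_ge_term (fun k => Rabs (a k) * q ^ k)); [|lia].
  intros i. apply Rmult_le_pos; [apply Rabs_pos | apply pow_le; lra].
Qed.

Lemma Rabs_mcos (a b : R) : Rabs (a * cos b) <= Rabs a.
Proof.
  rewrite Rabs_mult. assert (Rabs (cos b) <= 1) by (apply Rabs_le; destruct (COS_bound b); lra).
  assert (0 <= Rabs a) by apply Rabs_pos. nra.
Qed.

Lemma partial_sums_gap (q : R) (a : nat -> R) (B : R) (n m : nat) (x : R) : 1 <= q ->
  (forall n, sum_f_R0 (fun k => Rabs (a k) * q ^ k) n <= B) -> (n <= m)%nat ->
  Rabs (sum_f_R0 (fun k => a k * cos (INR k * x)) m - sum_f_R0 (fun k => a k * cos (INR k * x)) n)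
  <= B * (/ q) ^ n.
Proof.
  intros Hq H Hnm.
  assert (Hqn : 0 < q ^ n) by (apply pow_lt; lra).
  assert (K : Rabs (sum_f_R0 (fun k => a k * cos (INR k * x)) m
                    - sum_f_R0 (fun k => a k * cos (INR k * x)) n) * q ^ n
    <= sum_f_R0 (fun k => Rabs (a k) * q ^ k) m - sum_f_R0 (fun k => Rabs (a k) * q ^ k) n).
  { induction Hnm as [|m Hm IH]; [rewrite !Rminus_diag, Rabs_R0; lra|].
    rewrite !tech5.
    set (u := sum_f_R0 (fun k => a k * cos (INR k * x)) m) in *.
    set (v := sum_f_R0 (fun k => a k * cos (INR k * x)) n) in *.
    set (u' := sum_f_R0 (fun k => Rabs (a k) * q ^ k) m) in *.
    set (v' := sum_f_R0 (fun k => Rabs (a k) * q ^ k) n) in *.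
    replace (u + a (S m) * cos (INR (S m) * x) - v) with (u - v + a (S m) * cos (INR (S m) * x)) by ring.
    eapply Rle_trans; [apply Rmult_le_compat_r; [lra | apply Rabs_triang]|].
    rewrite Rmult_plus_distr_r.
    assert (Rabs (a (S m) * cos (INR (S m) * x)) * q ^ n <= Rabs (a (S m)) * q ^ S m); [|lra].
    apply Rmult_le_compat; try apply Rabs_pos; try lra; [apply Rabs_mcos|].
    apply Rle_pow; [lra | lia]. }
  rewrite pow_inv. apply Rmult_le_reg_r with (q ^ n); [lra|].
  replace (B * / q ^ n * q ^ n) with B by (field; lra).
  assert (0 <= sum_f_R0 (fun k => Rabs (a k) * q ^ k) n).
  { apply cond_pos_sum. intros k. apply Rmult_le_pos; [apply Rabs_pos | apply pow_le; lra]. }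
  specialize (H m). lra.
Qed.

Lemma cser_tail (q : R) (a : nat -> R) (B : R) (n : nat) (x : R) : 1 < q ->
  (forall n, sum_f_R0 (fun k => Rabs (a k) * q ^ k) n <= B) ->
  Rabs (cser a x - sum_f_R0 (fun k => a k * cos (INR k * x)) n) <= B * (/ q) ^ n.
Proof.
  intros Hq H.
  assert (E : ex_series (fun k => a k * cos (INR k * x))).
  { apply ex_series_geom_bound with B (/ q); [now apply inv_q_range|]. intros k.
    eapply Rle_trans; [apply Rabs_mcos|]. apply sum_decay; [lra | exact H]. }
  apply Series_correct in E. fold (cser a x) in E.
  assert (E' : is_lim_seq (fun m => sum_f_R0 (fun k => a k * cos (INR k * x)) m) (cser a x)).
  { apply is_lim_seq_ext with (2 := E). intros m. apply sum_n_Reals. }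
  set (s := sum_f_R0 (fun k => a k * cos (INR k * x)) n).
  assert (L : is_lim_seq (fun m => Rabs (sum_f_R0 (fun k => a k * cos (INR k * x)) (m + n) - s))
                (Rabs (cser a x - s))).
  { apply (is_lim_seq_abs _ (Finite (cser a x - s))).
    apply is_lim_seq_minus'; [|apply is_lim_seq_const].
    now apply (is_lim_seq_incr_n (fun m => sum_f_R0 (fun k => a k * cos (INR k * x)) m) n). }
  apply (is_lim_seq_le _ (fun _ => B * (/ q) ^ n) (Rabs (cser a x - s)) (B * (/ q) ^ n) ) in L;
    [exact L | | apply is_lim_seq_const].
  intros m. apply partial_sums_gap; [lra | exact H | lia].
Qed.

Fixpoint tlist (a : nat -> R) (n : nat) : tpoly :=
  match n with
  | O => (a 0%nat, 0%nat) :: nil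
  | S m => (a (S m), S m) :: tlist a m
  end.

Lemma tev_tlist (a : nat -> R) (n : nat) (x : R) :
  tev (tlist a n) x = sum_f_R0 (fun k => a k * cos (INR k * x)) n.
Proof. induction n as [|n IH]; simpl tlist; simpl tev; simpl sum_f_R0; [ring|]. rewrite IH. apply Rplus_comm. Qed.

Lemma tnorm_tlist (q : R) (a : nat -> R) (n : nat) :
  tnorm q (tlist a n) = sum_f_R0 (fun k => Rabs (a k) * q ^ k) n.
Proof. induction n as [|n IH]; simpl tlist; simpl tnorm; simpl sum_f_R0; [ring|]. rewrite IH. apply Rplus_comm. Qed.

Lemma tcoef_tlist (a : nat -> R) (n k : nat) :
  tcoef (tlist a n) k = if le_dec k n then a k else 0.
Proof.
  induction n as [|n IH]; cbn [tlist tcoef].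
  - destruct (Nat.eq_dec 0 k), (le_dec k 0); subst; try lia; ring.
  - rewrite IH. destruct (Nat.eq_dec (S n) k), (le_dec k n), (le_dec k (S n)); subst; try lia; try ring.
Qed.

Lemma geom_small (B r e : R) : 0 <= r < 1 -> 0 < e -> exists N, forall n, (N <= n)%nat -> B * r ^ n <= e.
Proof.
  intros Hr He. assert (H := is_lim_seq_geom_scal B r Hr). apply is_lim_seq_spec in H.
  destruct (H (mkposreal e He)) as [N HN]. exists N. intros n Hn. specialize (HN n Hn).
  simpl in HN. rewrite Rminus_0_r in HN. apply Rabs_lt_between in HN. lra.
Qed.

(** Converse of [W_cf_sum]: partial sums are admissible polynomials, and q > 1 makes their
    convergence uniform. *)
Lemma W_cser (q : R) (a : nat -> R) (B : R) : 1 < q ->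
  (forall n, sum_f_R0 (fun k => Rabs (a k) * q ^ k) n <= B) -> W q (cser a) B.
Proof.
  intros Hq H e He. destruct (geom_small B (/ q) e (inv_q_range q Hq) He) as [N HN].
  exists (tlist a N). rewrite tnorm_tlist. split; [apply H|]. intros x. rewrite tev_tlist.
  eapply Rle_trans; [apply (cser_tail q a B); auto|]. apply HN; lia.
Qed.

Lemma cf_cser (q : R) (a : nat -> R) (B : R) (k : nat) : 1 < q ->
  (forall n, sum_f_R0 (fun k => Rabs (a k) * q ^ k) n <= B) -> cf (cser a) k = a k.
Proof.
  intros Hq H. apply Rminus_diag_uniq, Rabs_le_eps_0. intros e He.
  destruct (geom_small B (/ q) (e / 2) (inv_q_range q Hq) ltac:(lra)) as [N HN].
  (* The length [max N k] makes the partial sum both accurate and long enough to contain mode k. *)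
  assert (K := W_cf_approx q (cser a) B (tlist a (max N k)) (e / 2) k (W_cser q a B Hq H)).
  rewrite tcoef_tlist in K. destruct (le_dec k (max N k)) as [_|]; [|lia].
  replace e with (2 * (e / 2)) by field. apply K. intros x. rewrite tev_tlist.
  eapply Rle_trans; [apply (cser_tail q a B); auto|]. apply HN; lia.
Qed.

(** * Concentration integrals *)

(** Periodic substitute for a Gaussian of width lam^(-1/2), peaked at every zero of the sine.
    Products of two such profiles, one in t and one in x, dominate the high powers of the linear
    solution. *)
Definition Eg (lam t : R) : R := exp (- (lam * (sin t) ^ 2 / 2)).

Lemma Eg_pos (lam t : R) : 0 < Eg lam t.
Proof. apply exp_pos. Qed.

Lemma Eg_cont (lam : R) : cont (Eg lam).
Proof.
  apply cont_derive with (fun t => - (lam * sin t * cos t) * exp (- (lam * (sin t) ^ 2 / 2))).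
  intros t. unfold Eg. auto_derive; [easy|]. simpl. field_simplify. reflexivity.
Qed.

Lemma Eg_period (lam t : R) : Eg lam (t + 2 * PI) = Eg lam t.
Proof. unfold Eg. now rewrite sin_plus, cos_2PI, sin_2PI, Rmult_1_r, Rmult_0_r, Rplus_0_r. Qed.

(** From the Taylor lower bound of order 7: x <= PI/2 <= 2 gives 1 - x^2/6 >= 1/3, and the last two
    terms together are nonnegative. *)
Lemma sin_ge_third (x : R) : 0 <= x <= PI / 2 -> x / 3 <= sin x.
Proof.
  intros Hx. assert (HP := PI_4). assert (HP0 := PI_RGT_0).
  destruct (SIN x) as [H _]; try lra.
  unfold sin_lb, sin_approx, sin_term in H. simpl in H.
  assert (x / 3 <= x * (1 - x ^ 2 / 6) + x ^ 5 * (/ 120 - x ^ 2 / 5040)); [|simpl in *; lra].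
  assert (0 <= x ^ 2 <= 4) by (simpl; nra).
  assert (0 <= x ^ 5) by (apply pow_le; lra).
  assert (x * (1 / 3) <= x * (1 - x ^ 2 / 6)) by (apply Rmult_le_compat_l; lra).
  assert (0 <= x ^ 5 * (/ 120 - x ^ 2 / 5040)) by (apply Rmult_le_pos; lra). lra.
Qed.

Lemma sin_sq_ge (x : R) : Rabs x <= PI / 2 -> (x / 3) ^ 2 <= (sin x) ^ 2.
Proof.
  intros Hx. assert (H : forall y, 0 <= y <= PI / 2 -> (y / 3) ^ 2 <= sin y ^ 2).
  { intros y Hy. apply pow_incr. split; [lra | now apply sin_ge_third]. }
  destruct (Rle_dec 0 x) as [Hp|Hp].
  - apply H. rewrite Rabs_pos_eq in Hx; lra.
  - rewrite Rabs_left in Hx by lra. specialize (H (- x)). rewrite sin_neg in H.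
    replace ((x / 3) ^ 2) with ((- x / 3) ^ 2) by field.
    replace (sin x ^ 2) with ((- sin x) ^ 2) by ring. apply H; lra.
Qed.

(** A Lorentzian, used in place of the Gaussian because its primitive is an arctangent, which bounds
    its area by PI / k. *)
Definition bump (k z t : R) : R := / (1 + (k * (t - z)) ^ 2).

Lemma bump_pos (k z t : R) : 0 < bump k z t.
Proof. apply Rinv_0_lt_compat. assert (0 <= (k * (t - z)) ^ 2) by apply pow2_ge_0. lra. Qed.

Lemma bump_cont (k z : R) : cont (bump k z).
Proof.
  intros t. apply (@ex_derive_continuous R_AbsRing R_NormedModule). unfold bump. auto_derive.
  assert (0 <= (k * (t - z)) ^ 2) by apply pow2_ge_0. simpl in H. unfold Rminus in *. lra.
Qed.

Lemma bump_RInt (k z a b : R) : 0 < k -> a <= b -> RInt (bump k z) a b <= PI / k.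
Proof.
  intros Hk Hab.
  rewrite (is_RInt_unique (bump k z) a b (minus (atan (k * (b - z)) / k) (atan (k * (a - z)) / k))).
  - unfold minus, plus, opp; simpl. assert (H1 := atan_bound (k * (b - z))).
    assert (H2 := atan_bound (k * (a - z))). unfold Rdiv.
    rewrite Ropp_mult_distr_l, <- Rmult_plus_distr_r. apply Rmult_le_compat_r; [|lra].
    apply Rlt_le, Rinv_0_lt_compat, Hk.
  - apply (is_RInt_derive (fun t => atan (k * (t - z)) / k)); [|intros; apply bump_cont].
    intros t _. unfold bump. auto_derive; [easy|].
    assert (0 <= (k * (t - z)) ^ 2) by apply pow2_ge_0. simpl in *. unfold Rsqr, Rminus in *. field. lra.
Qed.

Lemma exp_neg_le (z : R) : 0 <= z -> exp (- z) <= / (1 + z).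
Proof.
  intros Hz. rewrite exp_Ropp. apply Rinv_le_contravar; [lra | apply exp_ineq1_le].
Qed.

(** Combines exp(-z) <= 1/(1 + z) with sin^2 >= (distance)^2 / 9 near a zero of the sine; the two
    denominators 2 and 9 give lam / 18. *)
Lemma Eg_bump (lam z t : R) (n : nat) : 0 < lam -> z = INR n * PI -> Rabs (t - z) <= PI / 2 ->
  Eg lam t <= bump (sqrt (lam / 18)) z t.
Proof.
  intros Hl Hz Ht. unfold Eg, bump.
  assert (E : sin t ^ 2 = sin (t - z) ^ 2).
  { rewrite sin_minus. assert (Hs : sin z = 0) by (apply sin_eq_0_1; exists (Z.of_nat n);
      rewrite <- INR_IZR_INZ; exact Hz). rewrite Hs.
    assert (Hc := sin2_cos2 z). rewrite Hs in Hc. unfold Rsqr in Hc.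
    replace ((sin t * cos z - cos t * 0) ^ 2) with (sin t ^ 2 * (cos z * cos z)) by ring.
    replace (cos z * cos z) with 1 by lra. ring. }
  rewrite E. assert (H := sin_sq_ge _ Ht).
  assert (H0 : 0 <= (t - z) ^ 2) by apply pow2_ge_0.
  apply Rle_trans with (/ (1 + lam * sin (t - z) ^ 2 / 2)).
  - apply exp_neg_le. assert (0 <= lam * sin (t - z) ^ 2) by (apply Rmult_le_pos; [lra | apply pow2_ge_0]). lra.
  - rewrite Rpow_mult_distr, pow2_sqrt by lra.
    apply Rinv_le_contravar.
    + assert (0 <= lam / 18 * (t - z) ^ 2) by (apply Rmult_le_pos; lra). lra.
    + assert (lam * (((t - z) / 3) ^ 2) <= lam * sin (t - z) ^ 2) by (apply Rmult_le_compat_l; lra).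
      replace (((t - z) / 3) ^ 2) with ((t - z) ^ 2 / 9) in H1 by field. lra.
Qed.

(* Five bumps of area [PI / k], [k = sqrt (lam / 18)], one for each zero of [sin] on [[0, 4 PI]]. *)
Definition Gb (lam : R) : R := 5 * (PI / sqrt (lam / 18)).

Lemma Gb_sq (l : R) : 0 < l -> Gb l * Gb l = 450 * PI ^ 2 / l.
Proof.
  intros Hl. unfold Gb. assert (H := sqrt_lt_R0 (l / 18) ltac:(lra)).
  replace (5 * (PI / sqrt (l / 18)) * (5 * (PI / sqrt (l / 18))))
    with (25 * PI ^ 2 / (sqrt (l / 18) * sqrt (l / 18))) by (field; lra).
  rewrite sqrt_sqrt by lra. field. lra.
Qed.

Lemma Gb_pos (l : R) : 0 < l -> 0 < Gb l.
Proof.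
  intros Hl. unfold Gb. apply Rmult_lt_0_compat; [lra|].
  apply Rdiv_lt_0_compat; [apply PI_RGT_0 | apply sqrt_lt_R0; lra].
Qed.

Lemma Gb_mono (l l' : R) : 0 < l -> l <= l' -> Gb l' <= Gb l.
Proof.
  intros Hl Hll. unfold Gb. apply Rmult_le_compat_l; [lra|]. unfold Rdiv at 1 3.
  apply Rmult_le_compat_l; [apply Rlt_le, PI_RGT_0|].
  apply Rinv_le_contravar; [apply sqrt_lt_R0; lra|]. apply sqrt_le_1_alt. lra.
Qed.

(** 4 PI is the range of the argument 2 x when x runs over one period. Each point of it lies within
    PI/2 of one of the five zeros 0, ..., 4 PI, whose bump already dominates there. *)
Lemma Eg_RInt_4PI (lam : R) : 0 < lam -> RInt (Eg lam) 0 (4 * PI) <= Gb lam.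
Proof.
  intros Hl. set (k := sqrt (lam / 18)). assert (Hk : 0 < k) by (apply sqrt_lt_R0; lra).
  assert (HP := PI_RGT_0).
  set (b := fun n t => bump k (INR n * PI) t).
  assert (Hb : forall n, cont (b n)) by (intros; apply bump_cont).
  apply Rle_trans with (RInt (fun t => b 0%nat t + (b 1%nat t + (b 2%nat t + (b 3%nat t + b 4%nat t)))) 0 (4 * PI)).
  - apply RI_le; [lra | apply Eg_cont | repeat apply cont_plus; apply Hb |].
    intros t Ht.
    assert (P : forall n, 0 < b n t) by (intros; apply bump_pos).
    assert (K : forall n, Rabs (t - INR n * PI) <= PI / 2 -> Eg lam t <= b n t)
      by (intros n Hn; now apply Eg_bump with n).
    pose proof (P 0%nat); pose proof (P 1%nat); pose proof (P 2%nat); pose proof (P 3%nat); pose proof (P 4%nat).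
    destruct (Rle_dec t (PI / 2)); [assert (HH := K 0%nat ltac:(apply Rabs_le; simpl; lra)); lra|].
    destruct (Rle_dec t (3 * PI / 2)); [assert (HH := K 1%nat ltac:(apply Rabs_le; simpl; lra)); lra|].
    destruct (Rle_dec t (5 * PI / 2)); [assert (HH := K 2%nat ltac:(apply Rabs_le; simpl; lra)); lra|].
    destruct (Rle_dec t (7 * PI / 2)); [assert (HH := K 3%nat ltac:(apply Rabs_le; simpl; lra)); lra|].
    assert (HH := K 4%nat ltac:(apply Rabs_le; simpl; lra)); lra.
  - rewrite !RI_plus by (repeat apply cont_plus; apply Hb).
    assert (K : forall n, RInt (b n) 0 (4 * PI) <= PI / k) by (intros; apply bump_RInt; lra).
    unfold Gb. fold k.
    pose proof (K 0%nat); pose proof (K 1%nat); pose proof (K 2%nat); pose proof (K 3%nat); pose proof (K 4%nat).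
    lra.
Qed.

Lemma Eg_RInt (lam : R) : 0 < lam -> RInt (Eg lam) 0 (2 * PI) <= Gb lam.
Proof.
  intros Hl. eapply Rle_trans; [|apply Eg_RInt_4PI, Hl]. assert (HP := PI_RGT_0).
  rewrite <- (RI_Chasles (Eg lam) 0 (2 * PI) (4 * PI)) by apply Eg_cont.
  assert (0 <= RInt (Eg lam) (2 * PI) (4 * PI)); [|lra].
  apply RI_ge0; [lra | apply Eg_cont | intros; apply Rlt_le, Eg_pos].
Qed.

Lemma Eg2_cont (lam : R) : cont (fun x => Eg lam (2 * x)).
Proof.
  intros x. apply (continuous_comp (fun x => 2 * x) (Eg lam)); [|apply Eg_cont].
  apply (cont_scal 2 (fun x => x)). intros y; apply continuous_id.
Qed.

Lemma Eg2_RInt (lam : R) : 0 < lam -> RInt (fun x => Eg lam (2 * x)) 0 (2 * PI) <= Gb lam.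
Proof.
  intros Hl. assert (E := RInt_comp_lin (Eg lam) 2 0 0 (2 * PI) (cont_RI _ _ _ (Eg_cont lam))).
  replace (2 * 0 + 0) with 0 in E by ring. replace (2 * (2 * PI) + 0) with (4 * PI) in E by ring.
  rewrite (RI_ext _ (fun x => 2 * Eg lam (2 * x))) in E
    by (intros; unfold scal; simpl; unfold mult; simpl; now rewrite Rplus_0_r).
  rewrite RI_scal in E by apply Eg2_cont.
  assert (H := Eg_RInt_4PI lam Hl). assert (HP := PI_RGT_0).
  assert (0 <= RInt (fun x => Eg lam (2 * x)) 0 (2 * PI)); [|lra].
  apply RI_ge0; [lra | apply Eg2_cont | intros; apply Rlt_le, Eg_pos].
Qed.

(** With z = lam sin^2 t / 4, one half of the exponent absorbs z through z exp(-z) <= 1. A factor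
    sin^2 thus gains 1/lam at the price of halving lam. *)
Lemma Eg_moment (lam t : R) : 0 < lam -> sin t ^ 2 * Eg lam t <= 4 / lam * Eg (lam / 2) t.
Proof.
  intros Hl. unfold Eg. set (z := lam * sin t ^ 2 / 4).
  replace (- (lam * sin t ^ 2 / 2)) with (- z + - z) by (unfold z; field).
  replace (- (lam / 2 * sin t ^ 2 / 2)) with (- z) by (unfold z; field).
  replace (sin t ^ 2) with (4 / lam * z) by (unfold z; field; lra).
  rewrite exp_plus. assert (H0 : 0 <= z).
  { unfold z. assert (0 <= lam * sin t ^ 2) by (apply Rmult_le_pos; [lra | apply pow2_ge_0]). lra. }
  assert (H := exp_neg_le z H0). assert (He := exp_pos (- z)).
  assert (Hz : z * exp (- z) <= 1).
  { apply Rle_trans with (z * / (1 + z)); [apply Rmult_le_compat_l; lra|].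
    apply Rmult_le_reg_r with (1 + z); [lra|]. field_simplify; lra. }
  assert (H4 : 0 < 4 / lam) by (apply Rdiv_lt_0_compat; lra).
  replace (4 / lam * z * (exp (- z) * exp (- z))) with (4 / lam * ((z * exp (- z)) * exp (- z))) by ring.
  apply Rmult_le_compat_l; [lra|].
  apply Rle_trans with (1 * exp (- z)); [apply Rmult_le_compat_r|]; lra.
Qed.

(** * Integrals over many periods *)

Lemma RI_blocks_le (f : R -> R) (a M : R) (K : nat) : cont f ->
  (forall i, RInt f (a + INR i * (2 * PI)) (a + INR (S i) * (2 * PI)) <= M) ->
  RInt f a (a + INR K * (2 * PI)) <= INR K * M.
Proof.
  intros Hf H. induction K as [|K IH].
  - change (INR 0) with 0. rewrite !Rmult_0_l, Rplus_0_r, RInt_point. apply Rle_refl.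
  - rewrite <- (RI_Chasles f a (a + INR K * (2 * PI))) by exact Hf.
    specialize (H K). rewrite (S_INR K) at 2. lra.
Qed.

Lemma RI_blocks_ge (f : R -> R) (a M : R) (K : nat) : cont f ->
  (forall i, M <= RInt f (a + INR i * (2 * PI)) (a + INR (S i) * (2 * PI))) ->
  INR K * M <= RInt f a (a + INR K * (2 * PI)).
Proof.
  intros Hf H. induction K as [|K IH].
  - change (INR 0) with 0. rewrite !Rmult_0_l, Rplus_0_r, RInt_point. apply Rle_refl.
  - rewrite <- (RI_Chasles f a (a + INR K * (2 * PI))) by exact Hf.
    specialize (H K). rewrite (S_INR K) at 1. lra.
Qed.

Lemma RI_shift (f : R -> R) (a b : R) : cont f -> (forall t, f (t + 2 * PI) = f t) ->
  RInt f (a + 2 * PI) (b + 2 * PI) = RInt f a b.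
Proof.
  intros Hf Hp. assert (E := RInt_comp_lin f 1 (2 * PI) a b (cont_RI _ _ _ Hf)).
  rewrite !Rmult_1_l in E. rewrite <- E. apply RI_ext. intros y.
  unfold scal; simpl; unfold mult; simpl. now rewrite !Rmult_1_l, Hp.
Qed.

(** Periods are counted from -2 PI, the left end of the time window that contains the support of the
    cut-off force. *)
Lemma RI_period (f : R -> R) (i : nat) : cont f -> (forall t, f (t + 2 * PI) = f t) ->
  RInt f (- (2 * PI) + INR i * (2 * PI)) (- (2 * PI) + INR (S i) * (2 * PI)) = RInt f 0 (2 * PI).
Proof.
  intros Hf Hp. induction i as [|i IH].
  - rewrite <- (RI_shift f (-(2 * PI) + INR 0 * (2 * PI))) by easy.
    rewrite (S_INR 0). change (INR 0) with 0. f_equal; ring.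
  - rewrite <- IH. rewrite <- (RI_shift f (-(2 * PI) + INR i * (2 * PI))) by easy.
    rewrite !S_INR. f_equal; ring.
Qed.

Lemma Eg_RInt_long (lam : R) (K : nat) : 0 < lam ->
  RInt (Eg lam) (- (2 * PI)) (INR (S K) * (2 * PI)) <= INR (K + 2) * Gb lam.
Proof.
  intros Hl. replace (INR (S K) * (2 * PI)) with (- (2 * PI) + INR (K + 2) * (2 * PI))
    by (rewrite plus_INR, !S_INR; change (INR 0) with 0; ring).
  apply RI_blocks_le; [apply Eg_cont|]. intros i.
  rewrite RI_period by (apply Eg_cont || apply Eg_period). now apply Eg_RInt.
Qed.

(** * Phases and heights near the peaks *)

Lemma Rabs_sin_mul (n : nat) (z : R) : Rabs (sin (INR n * z)) <= INR n * Rabs (sin z).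
Proof.
  induction n as [|n IH]; [simpl; rewrite !Rmult_0_l, sin_0, Rabs_R0; lra|].
  rewrite S_INR, Rmult_plus_distr_r, Rmult_1_l, sin_plus.
  eapply Rle_trans; [apply Rabs_triang|]. rewrite !Rabs_mult.
  assert (H1 : Rabs (cos z) <= 1) by (apply Rabs_le; destruct (COS_bound z); lra).
  assert (H2 : Rabs (cos (INR n * z)) <= 1) by (apply Rabs_le; destruct (COS_bound (INR n * z)); lra).
  assert (H3 := Rabs_pos (sin z)). assert (H4 := Rabs_pos (sin (INR n * z))).
  assert (H5 := Rabs_pos (cos z)). nra.
Qed.

Lemma sin_mul_sq (n : nat) (z : R) : sin (INR n * z) ^ 2 <= INR n ^ 2 * sin z ^ 2.
Proof.
  rewrite <- (pow2_abs (sin (INR n * z))), <- (pow2_abs (sin z)), <- Rpow_mult_distr.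
  apply pow_incr. split; [apply Rabs_pos | apply Rabs_sin_mul].
Qed.

Lemma cos_double (z : R) : cos (2 * z) = 1 - 2 * sin z ^ 2.
Proof. rewrite cos_2a_sin. ring. Qed.

Lemma cos_ge_quadratic (z : R) : 0 <= z -> 1 - z ^ 2 / 2 <= cos z.
Proof.
  intros Hz. replace z with (2 * (z / 2)) at 2 by field. rewrite cos_double.
  assert (sin (z / 2) ^ 2 <= (z / 2) ^ 2); [|lra].
  rewrite <- (pow2_abs (sin (z / 2))). apply pow_incr. split; [apply Rabs_pos|].
  destruct (Rle_dec (z / 2) 1) as [H1|H1].
  - assert (HP := PI2_1). destruct (Req_dec z 0) as [->|H0].
    + unfold Rdiv. rewrite Rmult_0_l, sin_0, Rabs_R0. lra.
    + rewrite Rabs_pos_eq; [apply Rlt_le, sin_lt_x; lra | apply sin_ge_0; lra].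
  - apply Rle_trans with 1; [|lra]. apply Rabs_le. destruct (SIN_bound (z / 2)); lra.
Qed.

(* Multiples of 4 are in phase at both kinds of peaks, [(0, 0)] and [(PI, PI / 2)], of the linear solution. *)
Lemma cos_cos_ge (n : nat) (s x : R) :
  1 - 8 * INR n ^ 2 * sin s ^ 2 - 2 * INR n ^ 2 * sin (2 * x) ^ 2
  <= cos (INR (4 * n) * s) * cos (INR (4 * n) * x).
Proof.
  assert (E : INR (4 * n) = 4 * INR n) by (rewrite mult_INR; simpl; ring).
  assert (H1 := sin_mul_sq (2 * n) s). assert (H2 := sin_mul_sq n (2 * x)).
  assert (E2 : INR (2 * n) = 2 * INR n) by (rewrite mult_INR; simpl; ring). rewrite E2 in H1.
  replace (INR (4 * n) * s) with (2 * (2 * INR n * s)) by (rewrite E; ring).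
  replace (INR (4 * n) * x) with (2 * (INR n * (2 * x))) by (rewrite E; ring).
  rewrite !cos_double. assert (H3 := pow2_ge_0 (sin (2 * INR n * s))).
  assert (H4 := pow2_ge_0 (sin (INR n * (2 * x)))). nra.
Qed.

Lemma exp_INR_pow (n : nat) (z : R) : exp z ^ n = exp (INR n * z).
Proof.
  induction n as [|k IH]; [simpl; now rewrite Rmult_0_l, exp_0|].
  rewrite S_INR. simpl. rewrite IH, <- exp_plus. f_equal; ring.
Qed.

(** The 5 is 4 + 1: the linear solution loses at most 4/p on a box of side p^(-1/2) at a peak, and
    the solution differs from it by at most 1/p. The bound uses exp(-2 z) <= 1 - z for 0 < z <=
    1/2. *)
Lemma one_minus_pow (p : nat) : (10 <= p)%nat -> exp (-10) <= (1 - 5 / INR p) ^ p.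
Proof.
  intros Hp. assert (H : 10 <= INR p) by (apply le_INR in Hp; simpl in Hp; lra).
  set (z := 5 / INR p). assert (Hz : 0 < z <= / 2).
  { unfold z. split; [apply Rdiv_lt_0_compat; lra|].
    apply Rmult_le_reg_r with (INR p); [lra|]. unfold Rdiv. rewrite Rmult_assoc, Rinv_l; lra. }
  assert (H1 : exp (- (2 * z)) <= 1 - z).
  { eapply Rle_trans; [apply exp_neg_le; lra|]. apply Rmult_le_reg_l with (1 + 2 * z); [lra|].
    rewrite Rinv_r by lra. nra. }
  replace (-10) with (INR p * (- (2 * z))) by (unfold z; field; lra).
  rewrite <- exp_INR_pow. apply pow_incr. split; [apply Rlt_le, exp_pos | exact H1].
Qed.

(** * Duhamel's formula for one oscillator *)

Definition DC (w : R) (h : R -> R) (t : R) : R := RInt (fun s => cos (w * s) * h s) 0 t.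
Definition DS (w : R) (h : R -> R) (t : R) : R := RInt (fun s => sin (w * s) * h s) 0 t.
(** Variation of constants for z'' + w^2 z = h with zero data. The kernel sin(w (t - s)) is expanded
    so that t leaves the integrals; [DC] and [DS] are then the slowly growing amplitudes in which
    resonance shows. *)
Definition Duh (w : R) (h : R -> R) (t : R) : R :=
  (sin (w * t) * DC w h t - cos (w * t) * DS w h t) / w.
Definition Duh' (w : R) (h : R -> R) (t : R) : R :=
  cos (w * t) * DC w h t + sin (w * t) * DS w h t.

Lemma DC_derive (w : R) (h : R -> R) (t : R) : cont h -> is_derive (DC w h) t (cos (w * t) * h t).
Proof. intros H. apply (is_derive_RI (fun s => cos (w * s) * h s)). apply cont_mult; [apply cont_cosI | exact H]. Qed.

Lemma DS_derive (w : R) (h : R -> R) (t : R) : cont h -> is_derive (DS w h) t (sin (w * t) * h t).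
Proof. intros H. apply (is_derive_RI (fun s => sin (w * s) * h s)). apply cont_mult; [apply cont_sinI | exact H]. Qed.

Lemma Duh_derive (w : R) (h : R -> R) (t : R) : w <> 0 -> cont h -> is_derive (Duh w h) t (Duh' w h t).
Proof.
  intros Hw H. assert (H1 := DC_derive w h t H). assert (H2 := DS_derive w h t H).
  unfold Duh. auto_derive.
  - repeat split; [now exists (cos (w * t) * h t) | now exists (sin (w * t) * h t)].
  - apply is_derive_unique in H1, H2. cbv beta in H1, H2 |- *.
    replace (Derive (fun x => DC w h x) t) with (cos (w * t) * h t).
    replace (Derive (fun x => DS w h x) t) with (sin (w * t) * h t).
    unfold Duh'. field. exact Hw.
Qed.

Lemma Duh'_derive (w : R) (h : R -> R) (t : R) : w <> 0 -> cont h ->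
  is_derive (Duh' w h) t (- (w ^ 2 * Duh w h t) + h t).
Proof.
  intros Hw H. assert (H1 := DC_derive w h t H). assert (H2 := DS_derive w h t H).
  unfold Duh'. auto_derive.
  - repeat split; [now exists (cos (w * t) * h t) | now exists (sin (w * t) * h t)].
  - apply is_derive_unique in H1, H2. cbv beta in H1, H2 |- *.
    replace (Derive (fun x => DC w h x) t) with (cos (w * t) * h t).
    replace (Derive (fun x => DS w h x) t) with (sin (w * t) * h t).
    unfold Duh.
    replace (w ^ 2 * ((sin (w * t) * DC w h t - cos (w * t) * DS w h t) / w))
      with (w * (sin (w * t) * DC w h t - cos (w * t) * DS w h t)) by (field; exact Hw).
    assert (E := sin2_cos2 (w * t)). unfold Rsqr in E.
    match goal with |- ?l = ?r =>
      replace l with (- (w * (sin (w * t) * DC w h t - cos (w * t) * DS w h t))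
        + (sin (w * t) * sin (w * t) + cos (w * t) * cos (w * t)) * h t) by ring end.
    rewrite E. ring.
Qed.

(** As g vanishes outside the window, the bound holds for every real t, of either sign. This makes
    the Duhamel estimates global in time. *)
Lemma RI_supp (f g : R -> R) (a b t : R) : a <= 0 <= b -> cont f -> cont g ->
  (forall s, Rabs (f s) <= g s) -> (forall s, s < a \/ b < s -> g s = 0) ->
  Rabs (RInt f 0 t) <= RInt g a b.
Proof.
  intros Hab Hf Hg Hfg Hs.
  assert (G0 : forall s, 0 <= g s) by (intros s; eapply Rle_trans; [apply Rabs_pos | apply Hfg]).
  assert (P : forall u v, u <= v -> 0 <= RInt g u v) by (intros; apply RI_ge0; auto).
  assert (Z : forall u v, u <= v -> (forall s, u < s < v -> g s = 0) -> RInt g u v = 0).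
  { intros u v Huv Hz. rewrite (RInt_ext g (fun _ => 0)).
    - rewrite RI_const. apply Rmult_0_r.
    - intros s. rewrite Rmin_left, Rmax_right by lra. apply Hz. }
  destruct (Rle_dec 0 t) as [Ht|Ht].
  - apply Rle_trans with (RInt g 0 t); [apply RI_abs_le; auto|].
    destruct (Rle_dec t b) as [Htb|Htb].
    + rewrite <- (RI_Chasles g a 0 b), <- (RI_Chasles g 0 t b) by exact Hg.
      assert (A1 := P a 0 ltac:(lra)). assert (A2 := P t b ltac:(lra)). lra.
    + rewrite <- (RI_Chasles g 0 b t), <- (RI_Chasles g a 0 b) by exact Hg.
      assert (A1 := P a 0 ltac:(lra)). rewrite (Z b t); [lra | lra |]. intros; apply Hs; lra.
  - rewrite RI_swap, Rabs_Ropp by exact Hf.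
    apply Rle_trans with (RInt g t 0); [apply RI_abs_le; auto; lra|].
    destruct (Rle_dec a t) as [Hta|Hta].
    + rewrite <- (RI_Chasles g a t b), <- (RI_Chasles g t 0 b) by exact Hg.
      assert (A1 := P a t ltac:(lra)). assert (A2 := P 0 b ltac:(lra)). lra.
    + rewrite <- (RI_Chasles g t a 0), <- (RI_Chasles g a 0 b) by exact Hg.
      assert (A1 := P 0 b ltac:(lra)). rewrite (Z t a); [lra | lra |]. intros; apply Hs; lra.
Qed.

Lemma DC_bound (w : R) (h : R -> R) (a b t : R) : a <= 0 <= b -> cont h ->
  (forall s, s < a \/ b < s -> h s = 0) -> Rabs (DC w h t) <= RInt (fun s => Rabs (h s)) a b.
Proof.
  intros Hab Hh Hs. apply RI_supp; auto using cont_Rabs.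
  - apply cont_mult; [apply cont_cosI | exact Hh].
  - intros s. rewrite Rmult_comm. apply Rabs_mcos.
  - intros s H. rewrite (Hs s H). apply Rabs_R0.
Qed.

Lemma Rabs_msin (a b : R) : Rabs (a * sin b) <= Rabs a.
Proof.
  rewrite Rabs_mult. assert (Rabs (sin b) <= 1) by (apply Rabs_le; destruct (SIN_bound b); lra).
  assert (0 <= Rabs a) by apply Rabs_pos. nra.
Qed.

Lemma DS_bound (w : R) (h : R -> R) (a b t : R) : a <= 0 <= b -> cont h ->
  (forall s, s < a \/ b < s -> h s = 0) -> Rabs (DS w h t) <= RInt (fun s => Rabs (h s)) a b.
Proof.
  intros Hab Hh Hs. apply RI_supp; auto using cont_Rabs.
  - apply cont_mult; [apply cont_sinI | exact Hh].
  - intros s. rewrite Rmult_comm. apply Rabs_msin.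
  - intros s H. rewrite (Hs s H). apply Rabs_R0.
Qed.

Lemma Duh_bound (w : R) (h : R -> R) (a b t : R) : 0 < w -> a <= 0 <= b -> cont h ->
  (forall s, s < a \/ b < s -> h s = 0) ->
  Rabs (Duh w h t) <= 2 / w * RInt (fun s => Rabs (h s)) a b.
Proof.
  intros Hw Hab Hh Hs. unfold Duh, Rdiv. rewrite Rabs_mult, (Rabs_pos_eq (/ w))
    by (apply Rlt_le, Rinv_0_lt_compat, Hw).
  replace (2 * / w * RInt (fun s => Rabs (h s)) a b)
    with (2 * RInt (fun s => Rabs (h s)) a b * / w) by ring.
  apply Rmult_le_compat_r; [apply Rlt_le, Rinv_0_lt_compat, Hw|].
  unfold Rminus. eapply Rle_trans; [apply Rabs_triang|]. rewrite Rabs_Ropp.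
  assert (H1 := DC_bound w h a b t Hab Hh Hs). assert (H2 := DS_bound w h a b t Hab Hh Hs).
  assert (H3 := Rabs_msin (DC w h t) (w * t)). assert (H4 := Rabs_mcos (DS w h t) (w * t)).
  rewrite Rmult_comm in H3. rewrite Rmult_comm in H4. lra.
Qed.

Lemma Duh'_bound (w : R) (h : R -> R) (a b t : R) : a <= 0 <= b -> cont h ->
  (forall s, s < a \/ b < s -> h s = 0) ->
  Rabs (Duh' w h t) <= 2 * RInt (fun s => Rabs (h s)) a b.
Proof.
  intros Hab Hh Hs. unfold Duh'. eapply Rle_trans; [apply Rabs_triang|].
  assert (H1 := DC_bound w h a b t Hab Hh Hs). assert (H2 := DS_bound w h a b t Hab Hh Hs).
  assert (H3 := Rabs_mcos (DC w h t) (w * t)). assert (H4 := Rabs_msin (DS w h t) (w * t)).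
  rewrite Rmult_comm in H3. rewrite Rmult_comm in H4. lra.
Qed.

Lemma RI_sum (f : nat -> R -> R) (n : nat) (a b : R) : (forall k, cont (f k)) ->
  RInt (fun s => sum_f_R0 (fun k => f k s) n) a b = sum_f_R0 (fun k => RInt (f k) a b) n.
Proof.
  intros H. induction n as [|n IH]; simpl; [reflexivity|].
  rewrite <- IH. apply (RI_plus (fun s => sum_f_R0 (fun k => f k s) n) (f (S n))); [|apply H].
  clear IH. induction n as [|n IH]; simpl; [apply H|]. now apply cont_plus.
Qed.

Lemma cont_sum (f : nat -> R -> R) (n : nat) : (forall k, cont (f k)) ->
  cont (fun s => sum_f_R0 (fun k => f k s) n).
Proof. intros H. induction n as [|n IH]; simpl; [apply H|]. now apply cont_plus. Qed.

Lemma sum_trunc (x : nat -> R) (p n : nat) : (forall k, 0 <= x k) ->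
  sum_f_R0 (fun k => if le_dec k p then x k else 0) n <= sum_f_R0 x p.
Proof.
  intros Hx. destruct (le_lt_dec n p) as [H|H].
  - apply Rle_trans with (sum_f_R0 x n).
    + apply sum_f_R0_le. intros k _. destruct (le_dec k p); [lra | apply Hx].
    + induction H as [|m H IH]; [lra|]. simpl. specialize (Hx (S m)). lra.
  - induction H as [|m H IH]; simpl.
    + destruct (le_dec (S p) p); [lia|]. rewrite Rplus_0_r. apply sum_f_R0_le. intros k _.
      destruct (le_dec k p); [lra | apply Hx].
    + destruct (le_dec (S m) p); [lia|]. lra.
Qed.

(* The low modes use the concentration of the force, the high ones only the factor [1 / w j]. *)
Lemma Duh_sum (q : R) (p : nat) (w : nat -> R) (chi : R -> R) (g : nat -> R -> R) (E : R -> R)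
  (a b G H L : R) (n : nat) (t : R) :
  1 <= q -> (0 < p)%nat -> (forall j, 1 <= w j) -> (forall j, INR j <= w j) ->
  a <= 0 <= b -> cont chi -> (forall s, 0 <= chi s <= 1) -> (forall s, s < a \/ b < s -> chi s = 0) ->
  (forall j, cont (g j)) -> cont E -> (forall s, 0 <= E s) -> 0 <= G -> 0 <= H ->
  (forall j s, Rabs (g j s) <= G * E s) ->
  (forall m s, sum_f_R0 (fun j => Rabs (g j s) * q ^ j) m <= H) ->
  sum_f_R0 (fun j => q ^ j / w j) p <= L ->
  sum_f_R0 (fun j => Rabs (Duh (w j) (fun s => chi s * g j s) t) * q ^ j) n
  <= 2 * L * G * RInt E a b + 2 / INR p * H * (b - a).
Proof.
  intros Hq Hp Hw1 Hw Hab Hchi Hc01 Hc0 Hg HE HE0 HG HH Hlow Hhigh HL.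
  assert (Hp' : 0 < INR p) by (apply lt_0_INR, Hp).
  set (I := fun j => RInt (fun s => Rabs (chi s * g j s)) a b).
  assert (Hh : forall j, cont (fun s => chi s * g j s)) by (intros; now apply cont_mult).
  assert (I0 : forall j, 0 <= I j).
  { intros j. apply RI_ge0; [lra | now apply cont_Rabs | intros; apply Rabs_pos]. }
  assert (HQ : 0 <= RInt E a b) by (apply RI_ge0; auto; lra).
  assert (I1 : forall j, I j <= G * RInt E a b).
  { intros j. unfold I. rewrite <- RI_scal by exact HE. apply RI_le; [lra | now apply cont_Rabs | now apply cont_scal|].
    intros s _. rewrite Rabs_mult, (Rabs_pos_eq (chi s)) by apply Hc01.
    specialize (Hlow j s). specialize (Hc01 s). assert (0 <= Rabs (g j s)) by apply Rabs_pos. nra. }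
  assert (I2 : sum_f_R0 (fun j => I j * q ^ j) n <= H * (b - a)).
  { rewrite (sum_eq _ (fun j => RInt (fun s => q ^ j * Rabs (chi s * g j s)) a b)).
    - rewrite <- (RI_sum (fun j s => q ^ j * Rabs (chi s * g j s)))
        by (intros; apply cont_scal, cont_Rabs, Hh).
      rewrite Rmult_comm, <- RI_const. apply RI_le; [lra | | apply cont_const |].
      + apply (cont_sum (fun j s => q ^ j * Rabs (chi s * g j s))).
        intros; apply cont_scal, cont_Rabs, Hh.
      + intros s _. eapply Rle_trans; [|apply (Hhigh n s)].
        apply sum_f_R0_le. intros k _. rewrite Rmult_comm.
        apply Rmult_le_compat_r; [apply pow_le; lra|].
        rewrite Rabs_mult, (Rabs_pos_eq (chi s)) by apply Hc01.
        specialize (Hc01 s). assert (0 <= Rabs (g k s)) by apply Rabs_pos. nra.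
    - intros k _. rewrite RI_scal by apply cont_Rabs, Hh. unfold I. ring. }
  apply Rle_trans with (sum_f_R0 (fun j => (if le_dec j p then q ^ j / w j else 0) * (2 * G * RInt E a b)
     + I j * q ^ j * (2 / INR p)) n).
  - apply sum_f_R0_le. intros j _.
    assert (Hqj : 0 < q ^ j) by (apply pow_lt; lra).
    assert (Hwj := Hw1 j). assert (Hiw : 0 < / w j) by (apply Rinv_0_lt_compat; lra).
    assert (HD : Rabs (Duh (w j) (fun s => chi s * g j s) t) <= 2 / w j * I j).
    { apply (Duh_bound (w j) (fun s => chi s * g j s)); [lra | exact Hab | apply Hh |].
      intros s Hs. rewrite (Hc0 s Hs). ring. }
    apply Rle_trans with (2 / w j * I j * q ^ j); [apply Rmult_le_compat_r; lra|].
    assert (Hip : 0 < / INR p) by now apply Rinv_0_lt_compat.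
    specialize (I0 j). specialize (I1 j).
    destruct (le_dec j p) as [Hj|Hj].
    + apply Rle_trans with (q ^ j / w j * (2 * G * RInt E a b)).
      * replace (2 / w j * I j * q ^ j) with (q ^ j / w j * (2 * I j)) by (field; lra).
        apply Rmult_le_compat_l; [|lra]. apply Rlt_le, Rdiv_lt_0_compat; lra.
      * assert (0 <= I j * q ^ j * (2 / INR p)); [|lra].
        repeat apply Rmult_le_pos; lra.
    + rewrite Rmult_0_l, Rplus_0_l.
      assert (Hjp : / w j <= / INR p).
      { apply Rinv_le_contravar; [exact Hp'|]. eapply Rle_trans; [|apply Hw]. apply le_INR; lia. }
      replace (2 / w j * I j * q ^ j) with (I j * q ^ j * (2 * / w j)) by (field; lra).
      apply Rmult_le_compat_l; [|unfold Rdiv; lra]. apply Rmult_le_pos; lra.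
  - rewrite sum_plus, <- (scal_sum (fun j => if le_dec j p then q ^ j / w j else 0)),
      <- (scal_sum (fun j => I j * q ^ j)).
    apply Rplus_le_compat.
    + replace (2 * L * G * RInt E a b) with (2 * G * RInt E a b * L) by ring.
      apply Rmult_le_compat_l.
      * repeat apply Rmult_le_pos; lra.
      * eapply Rle_trans; [apply sum_trunc|exact HL].
        intros k. apply Rmult_le_pos; [apply pow_le; lra|]. specialize (Hw1 k).
        apply Rlt_le, Rinv_0_lt_compat; lra.
    + rewrite Rmult_assoc. apply Rmult_le_compat_l; [|exact I2].
      apply Rlt_le, Rdiv_lt_0_compat; lra.
Qed.

(** * Space-time functions *)

(** Continuity in t, uniform in x but only in the sup norm. This suffices because each cosine
    coefficient is controlled by the sup norm, and sup-norm continuity passes easily to powers and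
    limits. *)
Definition UC (y : R -> R -> R) : Prop :=
  forall t e, 0 < e -> exists d, 0 < d /\ forall t', Rabs (t' - t) < d -> forall x, Rabs (y t' x - y t x) <= e.

Lemma UC_ext (y z : R -> R -> R) : (forall t x, y t x = z t x) -> UC y -> UC z.
Proof.
  intros E H t e He. destruct (H t e He) as (d & Hd & Hy). exists d; split; [exact Hd|].
  intros t' Ht x. rewrite <- !E. now apply Hy.
Qed.

Lemma UC_plus (y z : R -> R -> R) : UC y -> UC z -> UC (fun t x => y t x + z t x).
Proof.
  intros Hy Hz t e He. destruct (Hy t (e / 2)) as (d1 & Hd1 & H1); [lra|].
  destruct (Hz t (e / 2)) as (d2 & Hd2 & H2); [lra|].
  exists (Rmin d1 d2). split; [now apply Rmin_glb_lt|]. intros t' Ht x.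
  assert (A1 := Rmin_l d1 d2). assert (A2 := Rmin_r d1 d2).
  specialize (H1 t' ltac:(lra) x). specialize (H2 t' ltac:(lra) x).
  apply Rabs_le_between in H1, H2. apply Rabs_le. lra.
Qed.

Lemma UC_scal (a : R) (y : R -> R -> R) : UC y -> UC (fun t x => a * y t x).
Proof.
  intros Hy t e He. assert (Ha := Rabs_pos a).
  destruct (Hy t (e / (Rabs a + 1))) as (d & Hd & H); [apply Rdiv_lt_0_compat; lra|].
  exists d; split; [exact Hd|]. intros t' Ht x. specialize (H t' Ht x).
  rewrite <- Rmult_minus_distr_l, Rabs_mult.
  apply Rle_trans with (Rabs a * (e / (Rabs a + 1))); [now apply Rmult_le_compat_l|].
  apply Rmult_le_reg_r with (Rabs a + 1); [lra|]. field_simplify; lra.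
Qed.

Lemma UC_minus (y z : R -> R -> R) : UC y -> UC z -> UC (fun t x => y t x - z t x).
Proof.
  intros Hy Hz. apply (UC_ext (fun t x => y t x + (-1) * z t x)); [intros; ring|].
  apply UC_plus; [exact Hy | now apply UC_scal].
Qed.

Lemma UC_mult (y z : R -> R -> R) (M : R) : UC y -> UC z ->
  (forall t x, Rabs (y t x) <= M) -> (forall t x, Rabs (z t x) <= M) -> UC (fun t x => y t x * z t x).
Proof.
  intros Hy Hz By Bz t e He.
  assert (HM : 0 <= M) by (eapply Rle_trans; [apply Rabs_pos | apply (By 0 0)]).
  set (k := e / (2 * M + 1)). assert (Hk : 0 < k) by (apply Rdiv_lt_0_compat; lra).
  destruct (Hy t k Hk) as (d1 & Hd1 & H1). destruct (Hz t k Hk) as (d2 & Hd2 & H2).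
  exists (Rmin d1 d2). split; [now apply Rmin_glb_lt|]. intros t' Ht x.
  assert (A1 := Rmin_l d1 d2). assert (A2 := Rmin_r d1 d2).
  specialize (H1 t' ltac:(lra) x). specialize (H2 t' ltac:(lra) x).
  replace (y t' x * z t' x - y t x * z t x)
    with ((y t' x - y t x) * z t' x + y t x * (z t' x - z t x)) by ring.
  eapply Rle_trans; [apply Rabs_triang|]. rewrite !Rabs_mult.
  apply Rle_trans with (k * M + M * k).
  - apply Rplus_le_compat; apply Rmult_le_compat; auto using Rabs_pos.
  - replace e with (k * (2 * M + 1)) by (unfold k; field; lra). nra.
Qed.

Lemma UC_pow (y : R -> R -> R) (M : R) (n : nat) : 1 <= M -> UC y ->
  (forall t x, Rabs (y t x) <= M) -> UC (fun t x => y t x ^ n).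
Proof.
  intros HM Hy By. induction n as [|n IH]; simpl.
  - intros t e He. exists 1; split; [lra|]. intros. rewrite Rminus_diag, Rabs_R0. lra.
  - assert (P : forall k, 1 <= M ^ k) by (intros; now apply pow_ge_1).
    apply UC_mult with (M ^ (S n)); auto.
    + intros t x. simpl. specialize (By t x). specialize (P n). assert (H := Rabs_pos (y t x)). nra.
    + intros t x. rewrite <- RPow_abs. simpl.
      apply Rle_trans with (M ^ n); [apply pow_incr; split; [apply Rabs_pos | apply By]|].
      specialize (P n). nra.
Qed.

Lemma UC_cf (y : R -> R -> R) (j : nat) : UC y -> (forall t, cont (y t)) -> cont (fun t => cf (y t) j).
Proof.
  intros Hy Hc. apply cont_eps. intros t e He. destruct (Hy t (e / 2)) as (d & Hd & H); [lra|].
  exists d; split; [exact Hd|]. intros t' Ht. rewrite <- cf_minus by apply Hc.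
  replace e with (2 * (e / 2)) by field. apply cf_bound_const; [apply cont_minus; apply Hc|].
  now apply H.
Qed.

(** The uniform Wiener bound makes the tails small uniformly in t, which leaves finitely many
    continuous coefficients. *)
Lemma UC_of_cf (q : R) (y : R -> R -> R) (B : R) : 1 < q -> (forall t, W q (y t) B) ->
  (forall j, cont (fun t => cf (y t) j)) -> UC y.
Proof.
  intros Hq HW Hc t e He.
  destruct (geom_small B (/ q) (e / 3) (inv_q_range q Hq) ltac:(lra)) as [N HN].
  specialize (HN N (le_n N)).
  assert (K : forall n k, 0 < k -> exists d, 0 < d /\ forall t', Rabs (t' - t) < d ->
    forall x, Rabs (sum_f_R0 (fun k => cf (y t') k * cos (INR k * x)) n
      - sum_f_R0 (fun k => cf (y t) k * cos (INR k * x)) n) <= k).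
  { induction n as [|n IH]; intros k Hk.
    - destruct (cont_eps_inv _ t k (Hc 0%nat) Hk) as (d & Hd & H). exists d; split; [exact Hd|].
      intros t' Ht x. cbn [sum_f_R0]. rewrite <- Rmult_minus_distr_r.
      eapply Rle_trans; [apply Rabs_mcos | now apply H].
    - destruct (cont_eps_inv _ t (k / 2) (Hc (S n)) ltac:(lra)) as (d1 & Hd1 & H1).
      destruct (IH (k / 2) ltac:(lra)) as (d2 & Hd2 & H2).
      exists (Rmin d1 d2). split; [now apply Rmin_glb_lt|]. intros t' Ht x.
      assert (A1 := Rmin_l d1 d2). assert (A2 := Rmin_r d1 d2).
      specialize (H1 t' ltac:(lra)). specialize (H2 t' ltac:(lra) x). rewrite !tech5.
      assert (H3 := Rabs_mcos (cf (y t') (S n) - cf (y t) (S n)) (INR (S n) * x)).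
      assert (H4 := Rle_trans _ _ _ H3 H1).
      apply Rabs_le_between in H4, H2. apply Rabs_le. lra. }
  destruct (K N (e / 3) ltac:(lra)) as (d & Hd & H). exists d; split; [exact Hd|].
  intros t' Ht x. specialize (H t' Ht x).
  assert (T1 := W_tail q (y t') B N x ltac:(lra) (HW t')).
  assert (T2 := W_tail q (y t) B N x ltac:(lra) (HW t)).
  apply Rabs_le_between in H, T1, T2. apply Rabs_le. lra.
Qed.

(** * Differences of powers and linearity of the Duhamel integral *)

(** The difference quotient of the n-th power, in Horner form so that it is defined without division
    and makes sense for a = b. *)
Fixpoint dpow (n : nat) (a b : R) : R :=
  match n with
  | O => 0
  | S m => a ^ m + b * dpow m a b
  end.

Lemma dpow_spec (n : nat) (a b : R) : a ^ n - b ^ n = (a - b) * dpow n a b.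
Proof.
  induction n as [|n IH]; simpl; [ring|].
  replace (a * a ^ n - b * b ^ n) with ((a - b) * a ^ n + b * (a ^ n - b ^ n)) by ring.
  rewrite IH. ring.
Qed.

Lemma W_dpow (q : R) (f g : R -> R) (B : R) (n : nat) : 1 <= q -> W q f B -> W q g B ->
  W q (fun x => dpow (S n) (f x) (g x)) (INR (S n) * B ^ n).
Proof.
  intros Hq Hf Hg. induction n as [|n IH].
  - apply (W_ext q (fun x => 1)); [intros; simpl; ring|].
    apply (W_le q _ (Rabs 1)); [rewrite Rabs_R1; simpl; lra | apply W_const].
  - apply (W_ext q (fun x => f x ^ S n + g x * dpow (S n) (f x) (g x))); [easy|].
    apply (W_le q _ (B ^ S n + B * (INR (S n) * B ^ n))); [rewrite (S_INR (S n)); simpl; lra|].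
    apply W_plus; [now apply W_pow | now apply W_mul].
Qed.

(** Pointwise companion of [W_dpow]. The low modes need it, since only a pointwise bound sees the
    concentration; the Wiener bound is for the high modes. *)
Lemma dpow_bound (n : nat) (a b m : R) : Rabs a <= m -> Rabs b <= m ->
  Rabs (dpow (S n) a b) <= INR (S n) * m ^ n.
Proof.
  intros Ha Hb. induction n as [|n IH].
  - simpl. rewrite Rmult_0_r, Rplus_0_r, Rabs_R1. lra.
  - change (dpow (S (S n)) a b) with (a ^ S n + b * dpow (S n) a b).
    eapply Rle_trans; [apply Rabs_triang|]. rewrite Rabs_mult, <- RPow_abs.
    replace (INR (S (S n)) * m ^ S n) with (m ^ S n + m * (INR (S n) * m ^ n))
      by (rewrite (S_INR (S n)); simpl; ring).
    apply Rplus_le_compat; [apply pow_incr; split; [apply Rabs_pos | exact Ha]|].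
    apply Rmult_le_compat; auto using Rabs_pos.
Qed.

Lemma DC_minus (w : R) (f g : R -> R) (t : R) : cont f -> cont g ->
  DC w (fun s => f s - g s) t = DC w f t - DC w g t.
Proof.
  intros Hf Hg. unfold DC. rewrite <- RI_minus by (apply cont_mult; auto using cont_cosI).
  apply RI_ext. intros; ring.
Qed.

Lemma DS_minus (w : R) (f g : R -> R) (t : R) : cont f -> cont g ->
  DS w (fun s => f s - g s) t = DS w f t - DS w g t.
Proof.
  intros Hf Hg. unfold DS. rewrite <- RI_minus by (apply cont_mult; auto using cont_sinI).
  apply RI_ext. intros; ring.
Qed.

Lemma Duh_ext (w : R) (f g : R -> R) (t : R) : (forall s, f s = g s) -> Duh w f t = Duh w g t.
Proof.
  intros H. unfold Duh, DC, DS.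
  rewrite (RI_ext (fun s => cos (w * s) * f s) (fun s => cos (w * s) * g s)),
    (RI_ext (fun s => sin (w * s) * f s) (fun s => sin (w * s) * g s)); intros; rewrite ?H; reflexivity.
Qed.

Lemma Duh_minus (w : R) (f g : R -> R) (t : R) : cont f -> cont g ->
  Duh w (fun s => f s - g s) t = Duh w f t - Duh w g t.
Proof. intros Hf Hg. unfold Duh, Rdiv. rewrite DC_minus, DS_minus by easy. ring. Qed.

Lemma cser_minus (q : R) (a b : nat -> R) (A B : R) (x : R) : 1 < q ->
  (forall n, sum_f_R0 (fun k => Rabs (a k) * q ^ k) n <= A) ->
  (forall n, sum_f_R0 (fun k => Rabs (b k) * q ^ k) n <= B) ->
  cser (fun k => a k - b k) x = cser a x - cser b x.
Proof.
  intros Hq Ha Hb. unfold cser.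
  rewrite <- Series_minus.
  - apply Series_ext. intros; ring.
  - apply ex_series_geom_bound with A (/ q); [now apply inv_q_range|]. intros k.
    eapply Rle_trans; [apply Rabs_mcos | apply sum_decay; [lra | exact Ha]].
  - apply ex_series_geom_bound with B (/ q); [now apply inv_q_range|]. intros k.
    eapply Rle_trans; [apply Rabs_mcos | apply sum_decay; [lra | exact Hb]].
Qed.

(** * The fixed point *)

Section Picard.

Variables (p : nat) (q eps a b : R) (w : nat -> R) (chi E1 E2 : R -> R) (Y : R -> R -> R).

Hypothesis Hp : (4 <= p)%nat.
Hypothesis Hq : 1 < q.
Hypothesis Heps : 0 <= eps.
Hypothesis Hw1 : forall j, 1 <= w j.
Hypothesis Hwj : forall j, INR j <= w j.
Hypothesis Hab : a <= 0 <= b.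
Hypothesis Hchi : cont chi.
Hypothesis Hc01 : forall s, 0 <= chi s <= 1.
Hypothesis Hc0 : forall s, s < a \/ b < s -> chi s = 0.
Hypothesis HE1 : cont E1.
Hypothesis HE1p : forall s, 0 <= E1 s.
Hypothesis HE2 : cont E2.
Hypothesis HE2p : forall s, 0 <= E2 s.
Hypothesis HYW : forall t, W q (Y t) (1 + 3 / INR p).
Hypothesis HYU : UC Y.
(** The exponent is p - 1 since differences of p-th powers have to be dominated, and the shift 1/p
    covers every function in the ball around [Y]. The product form separates the gains in t and in
    x. *)
Hypothesis HYE : forall t x, (Rabs (Y t x) + / INR p) ^ (p - 1) <= 3 * (E1 t * E2 x).

Let J : R := RInt E2 0 (2 * PI).
Let Q1 : R := RInt E1 a b.
Let L := sum_f_R0 (fun j => q ^ j / w j) p.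

(** The bracket is the Lipschitz constant of the Duhamel term. Low modes give 2 L (3 p J / PI) Q1;
    high modes give (2/p) (81 p) (b - a), whence 162. In the application J Q1 is of order K/p, with
    K the number of periods, which cancels the explicit p. *)
Hypothesis HH : eps * (6 * L * INR p * J * Q1 / PI + 162 * (b - a)) <= / 2.

Definition hist (f : R -> R -> R) (j : nat) (s : R) : R := chi s * cf (f s) j.
(** Solution with zero data at time 0 of the linear equation with frequencies [w] and force chi
    f. *)
Definition wave (f : R -> R -> R) (t : R) : R -> R := cser (fun j => Duh (w j) (hist f j) t).

Lemma INRp_ge : 4 <= INR p.
Proof. apply le_INR in Hp. simpl in Hp. lra. Qed.

Lemma invp_pos : 0 < / INR p <= / 4.
Proof.
  assert (H := INRp_ge). split; [apply Rinv_0_lt_compat; lra|]. apply Rinv_le_contravar; lra.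
Qed.

(** Integrating the pointwise bound in x turns it into the bound G J / PI times E1 for every
    coefficient at once, which is the input for the low modes. *)
Lemma force_sum (f : R -> R -> R) (G H t : R) (n : nat) :
  UC f -> (forall s, W q (f s) H) -> 0 <= G -> (forall s x, Rabs (f s x) <= G * (E1 s * E2 x)) ->
  sum_f_R0 (fun j => Rabs (Duh (w j) (hist f j) t) * q ^ j) n
  <= 2 * L * (G * J / PI) * Q1 + 2 / INR p * H * (b - a).
Proof.
  intros HU HWf HG Hb. assert (HP := PI_RGT_0).
  assert (HJ : 0 <= J) by (apply RI_ge0; auto; lra).
  apply (Duh_sum q p w chi (fun j s => cf (f s) j) E1 a b (G * J / PI) H L n t); auto; try lra; try lia.
  - intros j. apply UC_cf; [exact HU|]. intros s. apply (W_cont q (f s) H), HWf.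
  - apply Rmult_le_pos; [now apply Rmult_le_pos | apply Rlt_le, Rinv_0_lt_compat, HP].
  - apply (W_nonneg q (f 0) H); [lra | apply HWf].
  - intros j s. eapply Rle_trans.
    + apply (cf_bound (f s) (fun x => (G * E1 s) * E2 x)).
      * apply (W_cont q (f s) H), HWf.
      * now apply cont_scal.
      * intros x. rewrite Rmult_assoc. apply Hb.
    + rewrite RI_scal by exact HE2. fold J. apply Req_le. field. lra.
  - intros m s. apply W_cf_sum; [lra | apply HWf].
  - apply Rle_refl.
Qed.

Lemma force_W (f : R -> R -> R) (G H : R) :
  UC f -> (forall s, W q (f s) H) -> 0 <= G -> (forall s x, Rabs (f s x) <= G * (E1 s * E2 x)) ->
  forall t, W q (wave f t) (2 * L * (G * J / PI) * Q1 + 2 / INR p * H * (b - a)).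
Proof. intros HU HWf HG Hb t. apply W_cser; [exact Hq|]. intros n. now apply force_sum. Qed.

Lemma hist_cont (f : R -> R -> R) (H : R) (j : nat) : UC f -> (forall s, W q (f s) H) -> cont (hist f j).
Proof.
  intros HU HWf. apply cont_mult; [exact Hchi|]. apply UC_cf; [exact HU|].
  intros s. apply (W_cont q (f s) H), HWf.
Qed.

Lemma force_UC (f : R -> R -> R) (G H : R) :
  UC f -> (forall s, W q (f s) H) -> 0 <= G -> (forall s x, Rabs (f s x) <= G * (E1 s * E2 x)) ->
  UC (wave f).
Proof.
  intros HU HWf HG Hb.
  apply (UC_of_cf q (wave f) (2 * L * (G * J / PI) * Q1 + 2 / INR p * H * (b - a)) Hq).
  - now apply force_W.
  - intros j. apply (cont_ext (fun t => Duh (w j) (hist f j) t)).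
    + intros t. symmetry. unfold wave.
      apply (cf_cser q (fun j => Duh (w j) (hist f j) t)
        (2 * L * (G * J / PI) * Q1 + 2 / INR p * H * (b - a)) j Hq). intros n.
      now apply (force_sum f G H).
    + apply (cont_derive _ (Duh' (w j) (hist f j))). intros t. apply Duh_derive.
      * specialize (Hw1 j). lra.
      * now apply hist_cont with H.
Qed.

(** The ball of radius 1/p about the linear solution, the largest scale on which p-th powers stay
    bounded by a constant. *)
Definition good (y : R -> R -> R) : Prop :=
  UC y /\ forall t, W q (fun x => y t x - Y t x) (/ INR p).

Lemma good_W (y : R -> R -> R) (t : R) : good y -> W q (y t) (1 + 4 / INR p).
Proof.
  intros [_ H]. apply (W_ext q (fun x => (y t x - Y t x) + Y t x)); [intros; ring|].
  apply (W_le q _ (/ INR p + (1 + 3 / INR p))); [unfold Rdiv; lra|].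
  apply W_plus; [apply H | apply HYW].
Qed.

Lemma good_sup (y : R -> R -> R) (t x : R) : good y -> Rabs (y t x) <= Rabs (Y t x) + / INR p.
Proof.
  intros [_ H]. specialize (H t). apply (W_sup q _ _ x) in H; [|lra].
  replace (y t x) with (Y t x + (y t x - Y t x)) by ring.
  eapply Rle_trans; [apply Rabs_triang|]. lra.
Qed.

Lemma good_le2 (y : R -> R -> R) (t x : R) : good y -> Rabs (y t x) <= 2.
Proof.
  intros H. apply Rle_trans with (1 + 4 / INR p).
  - apply (W_sup q (y t)); [lra | now apply good_W].
  - assert (H1 := invp_pos). unfold Rdiv. lra.
Qed.

Lemma good_pow_UC (y : R -> R -> R) : good y -> UC (fun t x => y t x ^ p).
Proof.
  intros H. apply UC_pow with 2; [lra | apply H|]. intros; now apply good_le2.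
Qed.

(** 4 = 3 + 1 from the norm of [Y] and the radius of the ball; 81 = 3^4 bounds e^4. *)
Lemma base_pow (n : nat) : (n <= p)%nat -> (1 + 4 / INR p) ^ n <= 81.
Proof.
  intros Hn. assert (H := INRp_ge). assert (H1 := invp_pos).
  apply Rle_trans with (exp (4 / INR p) ^ p).
  - apply Rle_trans with ((1 + 4 / INR p) ^ p); [apply Rle_pow; [unfold Rdiv; lra | exact Hn]|].
    apply pow_incr. split; [unfold Rdiv; lra | apply exp_ineq1_le].
  - rewrite exp_INR_pow. replace (INR p * (4 / INR p)) with (1 + 1 + 1 + 1) by (field; lra).
    rewrite !exp_plus. assert (H3 := exp_le_3). assert (H4 := exp_pos 1).
    assert (exp 1 * exp 1 <= 9) by nra. nra.
Qed.

Lemma good_pow_W (y : R -> R -> R) (t : R) : good y -> W q (fun x => y t x ^ p) 81.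
Proof.
  intros H. apply (W_le q _ ((1 + 4 / INR p) ^ p)); [now apply base_pow|].
  apply W_pow; [lra | now apply good_W].
Qed.

(** One factor is bounded by 2 and the other p - 1 by the profile, hence 6 = 2 times 3. *)
Lemma good_pow_bound (y : R -> R -> R) (t x : R) : good y -> Rabs (y t x ^ p) <= 6 * (E1 t * E2 x).
Proof.
  intros H. replace p with (S (p - 1)) at 1 by lia. simpl. rewrite Rabs_mult, <- RPow_abs.
  replace (6 * (E1 t * E2 x)) with (2 * (3 * (E1 t * E2 x))) by ring.
  apply Rmult_le_compat; try apply Rabs_pos; [apply pow_le, Rabs_pos | now apply good_le2 |].
  eapply Rle_trans; [|apply HYE]. apply pow_incr. split; [apply Rabs_pos | now apply good_sup].
Qed.

Definition Phi (y : R -> R -> R) (t x : R) : R := Y t x - eps * wave (fun s x => y s x ^ p) t x.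

Lemma Phi_UC (y : R -> R -> R) : good y -> UC (Phi y).
Proof.
  intros H. apply UC_minus; [exact HYU|]. apply (UC_scal eps (wave (fun s x => y s x ^ p))).
  apply (force_UC _ 6 81).
  - now apply good_pow_UC.
  - intros s; now apply good_pow_W.
  - lra.
  - intros; now apply good_pow_bound.
Qed.

Lemma Phi_good (y : R -> R -> R) : good y -> good (Phi y).
Proof.
  intros H. split; [now apply Phi_UC|]. intros t.
  apply (W_ext q (fun x => (- eps) * wave (fun s x => y s x ^ p) t x)); [intros; unfold Phi; ring|].
  assert (HW := force_W (fun s x => y s x ^ p) 6 81 (good_pow_UC y H)
    (fun s => good_pow_W y s H) ltac:(lra) (fun s x => good_pow_bound y s x H) t).
  apply (W_scal q (- eps)) in HW; [|lra]. rewrite Rabs_Ropp, Rabs_pos_eq in HW by exact Heps.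
  eapply W_le; [|exact HW].
  assert (H1 := invp_pos). assert (H2 := INRp_ge). assert (HP := PI_RGT_0).
  (* The bound on the Duhamel term is 2/p times the bracket of [HH] with 81 in place of 162, so the
     same smallness condition gives both invariance of the ball and contraction. *)
  apply Rle_trans with (2 * / INR p * (eps * (6 * L * INR p * J * Q1 / PI + 162 * (b - a)))).
  - apply Rle_trans with (2 * / INR p * (eps * (6 * L * INR p * J * Q1 / PI + 81 * (b - a)))).
    + apply Req_le. field. lra.
    + apply Rmult_le_compat_l; [lra|]. apply Rmult_le_compat_l; [exact Heps|]. lra.
  - apply Rle_trans with (2 * / INR p * / 2); [apply Rmult_le_compat_l; lra | lra].
Qed.

Lemma wave_minus (f g : R -> R -> R) (Gf Hf Gg Hg t x : R) :
  UC f -> (forall s, W q (f s) Hf) -> 0 <= Gf -> (forall s x, Rabs (f s x) <= Gf * (E1 s * E2 x)) ->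
  UC g -> (forall s, W q (g s) Hg) -> 0 <= Gg -> (forall s x, Rabs (g s x) <= Gg * (E1 s * E2 x)) ->
  wave (fun s x => f s x - g s x) t x = wave f t x - wave g t x.
Proof.
  intros U1 W1 G1 B1 U2 W2 G2 B2. unfold wave.
  rewrite <- (cser_minus q _ _ (2 * L * (Gf * J / PI) * Q1 + 2 / INR p * Hf * (b - a))
     (2 * L * (Gg * J / PI) * Q1 + 2 / INR p * Hg * (b - a)) x Hq).
  - unfold cser. apply Series_ext. intros j. f_equal.
    rewrite <- Duh_minus; [| now apply hist_cont with Hf | now apply hist_cont with Hg].
    apply Duh_ext. intros s. unfold hist. rewrite cf_minus; [ring| |].
    + apply (W_cont q (f s) Hf), W1.
    + apply (W_cont q (g s) Hg), W2.
  - intros n. now apply force_sum.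
  - intros n. now apply force_sum.
Qed.

(** The difference of p-th powers costs a factor p in both bounds: 3 p D against the profile and 81
    p D in the Wiener norm. [HH] says exactly that concentration and high frequency pay for it. *)
Lemma Phi_contract (y z : R -> R -> R) (D : R) : good y -> good z ->
  (forall t, W q (fun x => y t x - z t x) D) ->
  forall t, W q (fun x => Phi y t x - Phi z t x) (D / 2).
Proof.
  intros Hy Hz HD t.
  assert (H1 := invp_pos). assert (H2 := INRp_ge). assert (HP := PI_RGT_0).
  assert (D0 : 0 <= D) by (apply (W_nonneg q _ _ ltac:(lra) (HD 0))).
  set (f := fun s x => y s x ^ p - z s x ^ p).
  apply (W_ext q (fun x => (- eps) * wave f t x)).
  { intros x. unfold Phi, f. rewrite (wave_minus (fun s x => y s x ^ p) (fun s x => z s x ^ p) 6 81 6 81);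
      try lra; try (intros; now apply good_pow_W); try (intros; now apply good_pow_bound);
      now apply good_pow_UC. }
  assert (Fe : forall s x, f s x = (y s x - z s x) * dpow (S (p - 1)) (y s x) (z s x)).
  { intros s x. unfold f. rewrite dpow_spec. replace (S (p - 1)) with p by lia. reflexivity. }
  assert (Ep : INR (S (p - 1)) = INR p) by (f_equal; lia).
  assert (FW : forall s, W q (f s) (D * (INR p * 81))).
  { intros s. apply (W_ext q _ _ _ (fun x => eq_sym (Fe s x))).
    apply (W_le q _ (D * (INR (S (p - 1)) * (1 + 4 / INR p) ^ (p - 1)))).
    - rewrite Ep. apply Rmult_le_compat_l; [exact D0|]. apply Rmult_le_compat_l; [lra|].
      apply base_pow; lia.
    - apply W_mul; [lra | apply HD | apply W_dpow; [lra | now apply good_W | now apply good_W]]. }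
  assert (FB : forall s x, Rabs (f s x) <= (3 * INR p * D) * (E1 s * E2 x)).
  { intros s x. rewrite Fe, Rabs_mult.
    apply Rle_trans with (D * (INR p * (3 * (E1 s * E2 x)))); [|apply Req_le; ring].
    apply Rmult_le_compat; try apply Rabs_pos.
    - apply (W_sup q (fun x => y s x - z s x)); [lra | apply HD].
    - eapply Rle_trans; [apply dpow_bound with (m := Rabs (Y s x) + / INR p); now apply good_sup|].
      rewrite Ep. apply Rmult_le_compat_l; [lra | apply HYE]. }
  assert (FU : UC f) by (apply UC_minus; now apply good_pow_UC).
  assert (G0 : 0 <= 3 * INR p * D) by (apply Rmult_le_pos; lra).
  assert (HW := force_W f _ _ FU FW G0 FB t).
  apply (W_scal q (- eps)) in HW; [|lra]. rewrite Rabs_Ropp, Rabs_pos_eq in HW by exact Heps.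
  eapply W_le; [|exact HW].
  apply Rle_trans with (D * (eps * (6 * L * INR p * J * Q1 / PI + 162 * (b - a)))).
  - apply Req_le. field. lra.
  - apply Rle_trans with (D * / 2); [now apply Rmult_le_compat_l | lra].
Qed.

Fixpoint picard (n : nat) : R -> R -> R :=
  match n with
  | O => Y
  | S m => Phi (picard m)
  end.

Lemma picard_good (n : nat) : good (picard n).
Proof.
  induction n as [|n IH]; [|now apply Phi_good]. split; [exact HYU|]. intros t.
  apply (W_ext q (fun _ => 0)); [intros; simpl; ring|].
  assert (H := invp_pos). apply (W_le q _ (Rabs 0)); [rewrite Rabs_R0; lra | apply W_const].
Qed.

Lemma picard_step (n : nat) (t : R) : W q (fun x => picard (S n) t x - picard n t x) ((/ 2) ^ n).
Proof.
  revert t. induction n as [|n IH]; intros t.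
  - assert (H := invp_pos). apply (W_le q _ (/ INR p)); [simpl; lra|].
    apply (proj2 (picard_good 1) t).
  - simpl pow. replace (/ 2 * (/ 2) ^ n) with ((/ 2) ^ n / 2) by (unfold Rdiv; ring).
    exact (Phi_contract (picard (S n)) (picard n) _ (picard_good (S n)) (picard_good n) IH t).
Qed.

(** The bound is the exact geometric sum of the steps, which is what closes the induction on k. *)
Lemma picard_gap (n k : nat) (t : R) : W q (fun x => picard (k + n) t x - picard n t x) (2 * (/ 2) ^ n * (1 - (/ 2) ^ k)).
Proof.
  induction k as [|k IH].
  - apply (W_ext q (fun _ => 0)); [intros; simpl; ring|].
    apply (W_le q _ (Rabs 0)); [rewrite Rabs_R0; simpl; lra | apply W_const].
  - apply (W_ext q (fun x => (picard (S (k + n)) t x - picard (k + n) t x) + (picard (k + n) t x - picard n t x)));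
      [intros; simpl; ring|].
    apply (W_le q _ ((/ 2) ^ (k + n) + 2 * (/ 2) ^ n * (1 - (/ 2) ^ k))).
    + rewrite pow_add. simpl. lra.
    + apply W_plus; [apply picard_step | exact IH].
Qed.

Lemma half_pow_pos (n : nat) : 0 < (/ 2) ^ n.
Proof. apply pow_lt; lra. Qed.

Lemma picard_gap' (n m : nat) (t : R) : (n <= m)%nat -> W q (fun x => picard m t x - picard n t x) (2 * (/ 2) ^ n).
Proof.
  intros H. replace m with ((m - n) + n)%nat by lia. eapply W_le; [|apply picard_gap].
  assert (H1 := half_pow_pos n). assert (H2 := half_pow_pos (m - n)). nra.
Qed.

Definition sol (t x : R) : R := real (Lim_seq (fun n => picard n t x)).

Lemma sol_lim (t x : R) : is_lim_seq (fun n => picard n t x) (sol t x).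
Proof.
  apply Lim_seq_correct', ex_lim_seq_cauchy_corr. intros e.
  destruct (geom_small 4 (/ 2) (e / 2)) as [N HN]; [lra | destruct e; simpl; lra |].
  exists N. intros n m Hn Hm. specialize (HN N (le_n N)).
  assert (H1 := W_sup q _ _ x ltac:(lra) (picard_gap' N n t Hn)).
  assert (H2 := W_sup q _ _ x ltac:(lra) (picard_gap' N m t Hm)).
  destruct e as [e He]; simpl in *. apply Rabs_le_between in H1, H2. apply Rabs_lt_between. lra.
Qed.

Lemma sol_gap_sup (n : nat) (t x : R) : Rabs (sol t x - picard n t x) <= 2 * (/ 2) ^ n.
Proof.
  assert (L' : is_lim_seq (fun m => Rabs (picard (m + n) t x - picard n t x)) (Rabs (sol t x - picard n t x))).
  { apply (is_lim_seq_abs _ (Finite (sol t x - picard n t x))).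
    apply is_lim_seq_minus'; [|apply is_lim_seq_const].
    apply (is_lim_seq_incr_n (fun m => picard m t x) n), sol_lim. }
  apply (is_lim_seq_le _ (fun _ => 2 * (/ 2) ^ n) (Rabs (sol t x - picard n t x)) (2 * (/ 2) ^ n)) in L';
    [exact L' | | apply is_lim_seq_const].
  intros m. apply (W_sup q (fun x => picard (m + n) t x - picard n t x)); [lra|].
  apply picard_gap'; lia.
Qed.

Lemma sol_near (e : R) : 0 < e -> exists N, forall n, (N <= n)%nat -> forall t x, Rabs (sol t x - picard n t x) <= e.
Proof.
  intros He. destruct (geom_small 2 (/ 2) e) as [N HN]; [lra | exact He |].
  exists N. intros n Hn t x. eapply Rle_trans; [apply sol_gap_sup | now apply HN].
Qed.

(** The bound on later iterates is uniform, so it passes to the uniform limit by closedness of the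
    Wiener balls. *)
Lemma sol_gap (n : nat) (t : R) : W q (fun x => sol t x - picard n t x) (2 * (/ 2) ^ n).
Proof.
  apply W_lim. intros e He. destruct (sol_near e He) as [N HN].
  exists (fun x => picard (max N n) t x - picard n t x). split; [apply picard_gap'; lia|].
  intros x. specialize (HN (max N n) ltac:(lia) t x).
  replace (sol t x - picard n t x - (picard (max N n) t x - picard n t x))
    with (sol t x - picard (max N n) t x) by ring. exact HN.
Qed.

Lemma sol_good : good sol.
Proof.
  split.
  - intros t e He. destruct (sol_near (e / 3) ltac:(lra)) as [N HN]. specialize (HN N (le_n N)).
    destruct (proj1 (picard_good N) t (e / 3) ltac:(lra)) as (d & Hd & H).
    exists d; split; [exact Hd|]. intros t' Ht x. specialize (H t' Ht x).
    assert (H1 := HN t x). assert (H2 := HN t' x).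
    apply Rabs_le_between in H, H1, H2. apply Rabs_le. lra.
  - intros t. apply W_lim. intros e He. destruct (sol_near e He) as [N HN]. specialize (HN N (le_n N)).
    exists (fun x => picard N t x - Y t x). split; [apply (proj2 (picard_good N) t)|].
    intros x. replace (sol t x - Y t x - (picard N t x - Y t x)) with (sol t x - picard N t x) by ring.
    apply HN.
Qed.

(** Both sides are close to the same iterate: [sol] by its rate of convergence, [Phi sol] by
    contraction applied to [sol] and [picard N]. *)
Lemma sol_fixed (t x : R) : sol t x = Y t x - eps * wave (fun s x => sol s x ^ p) t x.
Proof.
  apply Rminus_diag_uniq, Rabs_le_eps_0. intros e He. fold (Phi sol t x).
  destruct (geom_small 2 (/ 2) (e / 2)) as [N HN]; [lra | lra |].
  assert (H1 := sol_gap_sup (S N) t x).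
  assert (H2 := W_sup q _ _ x ltac:(lra) (Phi_contract sol (picard N) _ sol_good (picard_good N) (sol_gap N) t)).
  cbv beta in H2. change (Phi (picard N) t x) with (picard (S N) t x) in H2.
  specialize (HN N (le_n N)). assert (H3 := half_pow_pos N). simpl pow in H1.
  apply Rabs_le_between in H1, H2. apply Rabs_le. lra.
Qed.

Lemma picard_solution : exists y : R -> R -> R,
  UC (fun t x => y t x ^ p) /\
  (forall t x, Rabs (y t x - Y t x) <= / INR p) /\
  (forall t, W q (y t) 2) /\
  (forall t, W q (fun x => y t x ^ p) 81) /\
  (forall t x, Rabs (y t x ^ p) <= 6 * (E1 t * E2 x)) /\
  (forall t j, cf (y t) j = cf (Y t) j - eps * Duh (w j) (hist (fun s x => y s x ^ p) j) t).
Proof.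
  assert (G := sol_good). exists sol. repeat split.
  - now apply good_pow_UC.
  - intros t x. apply (W_sup q (fun x => sol t x - Y t x)); [lra | apply G].
  - intros t. apply (W_le q _ (1 + 4 / INR p)); [|now apply good_W].
    assert (H := invp_pos). unfold Rdiv. lra.
  - intros t. now apply good_pow_W.
  - intros t x. now apply good_pow_bound.
  - intros t j. set (f := fun s x => sol s x ^ p).
    rewrite (cf_ext _ (fun x => Y t x - eps * wave f t x)) by (intros; apply sol_fixed).
    assert (HS := fun n => force_sum f 6 81 t n (good_pow_UC sol G) (fun s => good_pow_W sol s G)
      ltac:(lra) (fun s x => good_pow_bound sol s x G)).
    assert (HC : cont (wave f t)) by (eapply W_cont, (W_cser q _ _ Hq HS)).
    rewrite cf_minus; [| apply (W_cont q _ _ (HYW t)) | now apply cont_scal].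
    rewrite cf_scal by exact HC. do 2 f_equal. exact (cf_cser q _ _ j Hq HS).
Qed.

End Picard.

(** * Termwise differentiation *)

Lemma sum_gap_bound (f b : nat -> R) (n m : nat) : (forall k, Rabs (f k) <= b k) -> (n <= m)%nat ->
  Rabs (sum_f_R0 f m - sum_f_R0 f n) <= sum_f_R0 b m - sum_f_R0 b n.
Proof.
  intros Hb H. induction H as [|m H IH]; [rewrite !Rminus_diag, Rabs_R0; lra|].
  rewrite !tech5. specialize (Hb (S m)). apply Rabs_le_between in IH, Hb. apply Rabs_le. lra.
Qed.

Lemma ex_series_bound (f b : nat -> R) : ex_series b -> (forall k, Rabs (f k) <= b k) -> ex_series f.
Proof. intros Hb H. apply (@ex_series_le R_AbsRing R_CompleteNormedModule f b H Hb). Qed.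

Lemma is_lim_sum_f (f : nat -> R) : ex_series f -> is_lim_seq (fun n => sum_f_R0 f n) (Series f).
Proof.
  intros H. apply Series_correct in H. apply is_lim_seq_ext with (2 := H). intros n. apply sum_n_Reals.
Qed.

Lemma Series_tail_bound (f b : nat -> R) (n : nat) : ex_series b -> (forall k, Rabs (f k) <= b k) ->
  Rabs (Series f - sum_f_R0 f n) <= Series b - sum_f_R0 b n.
Proof.
  intros Hb H. assert (Hf := ex_series_bound f b Hb H).
  assert (L1 : is_lim_seq (fun m => Rabs (sum_f_R0 f (m + n) - sum_f_R0 f n)) (Rabs (Series f - sum_f_R0 f n))).
  { apply (is_lim_seq_abs _ (Finite (Series f - sum_f_R0 f n))).
    apply is_lim_seq_minus'; [|apply is_lim_seq_const].
    apply (is_lim_seq_incr_n (fun m => sum_f_R0 f m) n), is_lim_sum_f, Hf. }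
  assert (L2 : is_lim_seq (fun m => sum_f_R0 b (m + n) - sum_f_R0 b n) (Series b - sum_f_R0 b n)).
  { apply is_lim_seq_minus'; [|apply is_lim_seq_const].
    apply (is_lim_seq_incr_n (fun m => sum_f_R0 b m) n), is_lim_sum_f, Hb. }
  refine (is_lim_seq_le _ _ _ _ _ L1 L2). intros m. apply sum_gap_bound; [exact H | lia].
Qed.

Lemma CVU_series (f : nat -> R -> R) (b : nat -> R) : ex_series b ->
  (forall k x, Rabs (f k x) <= b k) -> CVU_dom (fun n x => sum_f_R0 (fun k => f k x) n) (fun _ => True).
Proof.
  intros Hb H e. assert (L := is_lim_sum_f b Hb). apply is_lim_seq_spec in L.
  destruct (L e) as [N HN]. exists N. intros n Hn x _.
  assert (Hf : ex_series (fun k => f k x)) by (apply (ex_series_bound _ b Hb); intros; apply H).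
  rewrite (is_lim_seq_unique _ _ (is_lim_sum_f _ Hf)). simpl.
  assert (T := Series_tail_bound (fun k => f k x) b n Hb (fun k => H k x)).
  specialize (HN n Hn). simpl in HN. rewrite Rabs_minus_sym in T.
  apply Rabs_lt_between in HN. lra.
Qed.

Lemma is_derive_sum_f (f f' : nat -> R -> R) (n : nat) (x : R) :
  (forall k, is_derive (f k) x (f' k x)) ->
  is_derive (fun x => sum_f_R0 (fun k => f k x) n) x (sum_f_R0 (fun k => f' k x) n).
Proof.
  intros H. induction n as [|n IH]; simpl; [apply H|]. now apply (is_derive_plus (fun x => sum_f_R0 (fun k => f k x) n)).
Qed.

(** Weierstrass criterion: one summable majorant for the terms and their derivatives makes both
    series converge uniformly. *)
Lemma is_derive_Series (f f' : nat -> R -> R) (b : nat -> R) (x : R) : ex_series b ->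
  (forall k x, Rabs (f k x) <= b k) -> (forall k x, Rabs (f' k x) <= b k) ->
  (forall k x, is_derive (f k) x (f' k x)) -> (forall k, cont (f' k)) ->
  is_derive (fun x => Series (fun k => f k x)) x (Series (fun k => f' k x)).
Proof.
  intros Hb Hf Hf' Hd Hc.
  assert (E : forall n y, Derive (fun x => sum_f_R0 (fun k => f k x) n) y = sum_f_R0 (fun k => f' k y) n).
  { intros n y. apply is_derive_unique, is_derive_sum_f. intros; apply Hd. }
  assert (X : forall y, ex_series (fun k => f k y)) by (intros y; apply (ex_series_bound _ b Hb); intros; apply Hf).
  assert (X' : forall y, ex_series (fun k => f' k y)) by (intros y; apply (ex_series_bound _ b Hb); intros; apply Hf').
  assert (K := CVU_Derive (fun n x => sum_f_R0 (fun k => f k x) n) (fun _ => True)).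
  assert (K1 : is_derive (fun y => real (Lim_seq (fun n => sum_f_R0 (fun k => f k y) n))) x
    (real (Lim_seq (fun n => Derive (fun x => sum_f_R0 (fun k => f k x) n) x)))).
  { apply K; try easy.
    - apply open_true.
    - now apply CVU_series with b.
    - intros n y _. exists (sum_f_R0 (fun k => f' k y) n). apply is_derive_sum_f. intros; apply Hd.
    - intros n y _. apply continuity_pt_filterlim.
      apply (cont_ext (fun y => sum_f_R0 (fun k => f' k y) n)); [intros; now rewrite E|].
      now apply cont_sum.
    - assert (C := CVU_series f' b Hb Hf'). intros e. destruct (C e) as [N HN]. exists N.
      intros n Hn y Hy. rewrite E, (Lim_seq_ext _ (fun n => sum_f_R0 (fun k => f' k y) n)) by (intros; apply E).
      now apply HN. }
  rewrite (Lim_seq_ext _ (fun n => sum_f_R0 (fun k => f' k x) n)) in K1 by (intros; apply E).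
  rewrite (is_lim_seq_unique _ _ (is_lim_sum_f _ (X' x))) in K1.
  apply is_derive_ext with (2 := K1). intros y.
  now rewrite (is_lim_seq_unique _ _ (is_lim_sum_f _ (X y))).
Qed.

(** Ratio test: consecutive terms have ratio (1 + 1/(k + 1))^a r, which tends to r. *)
Lemma ex_series_Rpower_geom (a r : R) : 0 < r < 1 -> ex_series (fun k => Rpower (INR (S k)) a * r ^ k).
Proof.
  intros Hr.
  assert (P : forall k, 0 < Rpower (INR (S k)) a * r ^ k).
  { intros k. apply Rmult_lt_0_compat; [apply exp_pos | apply pow_lt; lra]. }
  apply ex_series_ext with (fun k => Rabs (Rpower (INR (S k)) a * r ^ k)).
  { intros k. apply Rabs_pos_eq. apply Rlt_le, P. }
  apply (ex_series_DAlembert (fun k => Rpower (INR (S k)) a * r ^ k) r); [lra | |].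
  { intros n. specialize (P n). lra. }
  apply is_lim_seq_ext with (fun k => exp (a * ln (1 + / INR (S k))) * r).
  - intros k. assert (Hk : 0 < INR (S k)) by (apply lt_0_INR; lia).
    assert (Hik := Rinv_0_lt_compat _ Hk).
    assert (Hk2 : 0 < INR (S (S k))) by (apply lt_0_INR; lia).
    rewrite Rabs_pos_eq by (apply Rlt_le, Rdiv_lt_0_compat; apply P).
    replace (1 + / INR (S k)) with (INR (S (S k)) * / INR (S k)) by (rewrite (S_INR (S k)); field; lra).
    rewrite ln_mult, ln_Rinv by lra. unfold Rpower.
    replace (a * (ln (INR (S (S k))) + - ln (INR (S k))))
      with (a * ln (INR (S (S k))) + - (a * ln (INR (S k)))) by ring.
    rewrite exp_plus, exp_Ropp. simpl pow. field. split; [|apply Rgt_not_eq, exp_pos].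
    apply pow_nonzero; lra.
  - replace (Finite r) with (Finite (exp (a * ln (1 + 0)) * r)).
    + apply is_lim_seq_mult'; [|apply is_lim_seq_const].
      apply (is_lim_seq_continuous (fun z => exp (a * ln (1 + z))) (fun k => / INR (S k)) 0).
      * apply continuity_pt_filterlim. change (continuous (fun z => exp (a * ln (1 + z))) 0).
        apply (@ex_derive_continuous R_AbsRing R_NormedModule).
        auto_derive. lra.
      * apply (is_lim_seq_incr_1 (fun n => / INR n)).
        replace (Finite 0) with (Rbar_inv p_infty) by reflexivity.
        apply is_lim_seq_inv; [apply is_lim_seq_INR | easy].
    + rewrite Rplus_0_r, ln_1, Rmult_0_r, exp_0. f_equal. ring.
Qed.

Lemma ex_series_poly_geom (m : nat) (M r : R) : 0 < r < 1 -> ex_series (fun k => M * (INR (S k) ^ m * r ^ k)).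
Proof.
  intros Hr. apply (@ex_series_scal_l R_AbsRing).
  apply ex_series_ext with (2 := ex_series_Rpower_geom (INR m) r Hr).
  intros k. rewrite Rpower_pow; [reflexivity|]. apply lt_0_INR; lia.
Qed.

(** * Frequencies, cutoff and the linear solution *)

(** Written as a sum of three indicators, so that a series weighted by [Vc] splits into three
    one-term series. *)
Definition Vc (p j : nat) : R :=
  (if Nat.eq_dec 0 j then 1 else 0) + (if Nat.eq_dec 1 j then 1 else 0)
  + (if Nat.eq_dec p j then INR p ^ 2 else 0).

Definition om (p j : nat) : R := sqrt (INR j ^ 2 + Vc p j).

Lemma Vc_bound (p j : nat) : 0 <= Vc p j <= 2 + INR p ^ 2.
Proof.
  unfold Vc. assert (0 <= INR p ^ 2) by apply pow2_ge_0.
  destruct (Nat.eq_dec 0 j), (Nat.eq_dec 1 j), (Nat.eq_dec p j); lra.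
Qed.

Lemma om_sq (p j : nat) : om p j ^ 2 = INR j ^ 2 + Vc p j.
Proof.
  unfold om. rewrite pow2_sqrt; [reflexivity|]. destruct (Vc_bound p j).
  assert (0 <= INR j ^ 2) by apply pow2_ge_0. lra.
Qed.

Lemma om_ge_INR (p j : nat) : INR j <= om p j.
Proof.
  unfold om. rewrite <- (sqrt_pow2 (INR j)) at 1 by apply pos_INR.
  apply sqrt_le_1_alt. destruct (Vc_bound p j). lra.
Qed.

Lemma om_ge_1 (p j : nat) : 1 <= om p j.
Proof.
  destruct j as [|j].
  - unfold om. rewrite <- sqrt_1 at 1. apply sqrt_le_1_alt. unfold Vc. simpl.
    assert (0 <= INR p ^ 2) by apply pow2_ge_0. simpl in H. destruct (Nat.eq_dec p 0); lra.
  - eapply Rle_trans; [|apply om_ge_INR]. apply (le_INR 1); lia.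
Qed.

Lemma om_eq (p j : nat) : (2 <= j)%nat -> j <> p -> om p j = INR j.
Proof.
  intros H1 H2. unfold om, Vc.
  destruct (Nat.eq_dec 0 j), (Nat.eq_dec 1 j), (Nat.eq_dec p j); try lia.
  rewrite !Rplus_0_r. apply sqrt_pow2, pos_INR.
Qed.

(* Cutting the force off outside [[-1, T + 1]] makes the fixed point problem global in time. *)
Definition cut (T t : R) : R := Rmax 0 (Rmin 1 (Rmin (t + 2) (T + 2 - t))).

Lemma cut_range (T t : R) : 0 <= cut T t <= 1.
Proof. unfold cut. split; [apply Rmax_l|]. apply Rmax_lub; [lra | apply Rmin_l]. Qed.

Lemma cut_1 (T t : R) : -1 <= t <= T + 1 -> cut T t = 1.
Proof.
  intros H. unfold cut. rewrite (Rmin_left 1) by (apply Rmin_glb; lra). apply Rmax_right; lra.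
Qed.

Lemma cut_0 (T t : R) : t <= -2 \/ T + 2 <= t -> cut T t = 0.
Proof.
  intros H. unfold cut. apply Rmax_left. eapply Rle_trans; [apply Rmin_r|].
  destruct H; [eapply Rle_trans; [apply Rmin_l|] | eapply Rle_trans; [apply Rmin_r|]]; lra.
Qed.

Lemma cut_cont (T : R) : cont (cut T).
Proof.
  apply cont_eps. intros t e He. exists e; split; [exact He|]. intros s Hs.
  apply Rabs_lt_between in Hs. apply Rabs_le. unfold cut, Rmax, Rmin.
  repeat destruct (Rle_dec _ _); lra.
Qed.

Definition Yfun (c d t x : R) : R := c * cos t + d * cos (2 * t) * cos (INR 2 * x).

(** Indicators instead of cases let one symbolic derivative treat all modes. *)
Definition Yc (c d : R) (j : nat) (t : R) : R :=
  (c * cos t) * (if Nat.eq_dec 0 j then 1 else 0) + (d * cos (2 * t)) * (if Nat.eq_dec 2 j then 1 else 0).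

Definition Yc1 (c d : R) (j : nat) (t : R) : R :=
  (- c * sin t) * (if Nat.eq_dec 0 j then 1 else 0) + (- 2 * d * sin (2 * t)) * (if Nat.eq_dec 2 j then 1 else 0).

Lemma cf_Yfun (c d t : R) (j : nat) : cf (Yfun c d t) j = Yc c d j t.
Proof.
  unfold Yfun.
  rewrite (cf_ext _ (fun x => c * cos t * cos (INR 0 * x) + d * cos (2 * t) * cos (INR 2 * x)))
    by (intros; change (INR 0) with 0; rewrite Rmult_0_l, cos_0; ring).
  rewrite cf_plus by apply cont_scal, cont_cosI.
  rewrite !cf_scal by apply cont_cosI. rewrite !cf_cos. reflexivity.
Qed.

Lemma Yc_derive (c d : R) (j : nat) (t : R) : is_derive (Yc c d j) t (Yc1 c d j t).
Proof.
  unfold Yc, Yc1. set (k0 := if Nat.eq_dec 0 j then 1 else 0). set (k2 := if Nat.eq_dec 2 j then 1 else 0).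
  auto_derive; [easy | ring].
Qed.

(** The squared frequencies of modes 0 and 2 are 1 and 4; p >= 4 keeps the potential at p away from
    both modes. *)
Lemma Yc1_derive (c d : R) (p j : nat) (t : R) : (4 <= p)%nat ->
  is_derive (Yc1 c d j) t (- (om p j ^ 2 * Yc c d j t)).
Proof.
  intros Hp. rewrite om_sq. unfold Yc, Yc1. set (Q := INR j ^ 2 + Vc p j).
  assert (H0 : Q * (if Nat.eq_dec 0 j then 1 else 0) = if Nat.eq_dec 0 j then 1 else 0).
  { unfold Q, Vc. destruct (Nat.eq_dec 0 j) as [<-|]; [|ring].
    destruct (Nat.eq_dec 1 0), (Nat.eq_dec p 0); try lia. simpl. ring. }
  assert (H2 : Q * (if Nat.eq_dec 2 j then 1 else 0) = 4 * if Nat.eq_dec 2 j then 1 else 0).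
  { unfold Q, Vc. destruct (Nat.eq_dec 2 j) as [<-|]; [|ring].
    destruct (Nat.eq_dec 0 2), (Nat.eq_dec 1 2), (Nat.eq_dec p 2); try lia. simpl. ring. }
  set (k0 := if Nat.eq_dec 0 j then 1 else 0) in *. set (k2 := if Nat.eq_dec 2 j then 1 else 0) in *.
  clearbody k0 k2 Q. auto_derive; [easy|].
  replace (Q * (c * cos t * k0 + d * cos (2 * t) * k2))
    with (c * cos t * (Q * k0) + d * cos (2 * t) * (Q * k2)) by ring.
  rewrite H0, H2. ring.
Qed.

Lemma Yfun_UC (c d : R) : UC (Yfun c d).
Proof.
  intros t e He.
  assert (H1 : cont (fun t => c * cos t)).
  { apply cont_derive with (fun t => - c * sin t). intros s. auto_derive; [easy | ring]. }
  assert (H2 : cont (fun t => d * cos (2 * t))) by apply cont_scal, cont_cosI.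
  destruct (cont_eps_inv _ t (e / 2) H1) as (d1 & Hd1 & K1); [lra|].
  destruct (cont_eps_inv _ t (e / 2) H2) as (d2 & Hd2 & K2); [lra|].
  exists (Rmin d1 d2). split; [now apply Rmin_glb_lt|]. intros t' Ht x.
  assert (A1 := Rmin_l d1 d2). assert (A2 := Rmin_r d1 d2).
  specialize (K1 t' ltac:(lra)). specialize (K2 t' ltac:(lra)). unfold Yfun.
  assert (K3 := Rle_trans _ _ _ (Rabs_mcos (d * cos (2 * t') - d * cos (2 * t)) (INR 2 * x)) K2).
  apply Rabs_le_between in K1, K3. apply Rabs_le. lra.
Qed.

(** Mode 2 carries the weight (1 + 1/p)^2 <= 1 + 3/p. *)
Lemma Yfun_W (c d : R) (p : nat) (t : R) : (4 <= p)%nat -> 0 <= c -> 0 <= d -> c + d = 1 ->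
  W (1 + / INR p) (Yfun c d t) (1 + 3 / INR p).
Proof.
  intros Hp Hc Hd Hcd. assert (H := invp_pos p Hp). set (q := 1 + / INR p).
  apply (W_le q _ (Rabs (c * cos t) + Rabs (d * cos (2 * t)) * q ^ 2)).
  - assert (A1 := Rabs_mcos c t). assert (A2 := Rabs_mcos d (2 * t)).
    rewrite (Rabs_pos_eq c) in A1 by exact Hc. rewrite (Rabs_pos_eq d) in A2 by exact Hd.
    assert (A3 : 0 <= q ^ 2 <= 1 + 3 / INR p) by (unfold q, Rdiv; simpl; nra).
    assert (A4 : Rabs (d * cos (2 * t)) * q ^ 2 <= d * (1 + 3 / INR p))
      by (apply Rmult_le_compat; try apply Rabs_pos; lra).
    assert (0 <= 3 / INR p) by (unfold Rdiv; lra).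
    assert (d * (3 / INR p) <= 1 * (3 / INR p)) by (apply Rmult_le_compat_r; lra). lra.
  - apply W_plus; [apply W_const | apply W_cos].
Qed.

(** sin^2 = (1 - |cos|)(1 + |cos|) and the second factor is at most 2. *)
Lemma one_minus_abs_cos (a : R) : sin a ^ 2 / 2 <= 1 - Rabs (cos a).
Proof.
  assert (H := sin2_cos2 a). unfold Rsqr in H.
  assert (H1 : Rabs (cos a) <= 1) by (apply Rabs_le; destruct (COS_bound a); lra).
  assert (H2 : Rabs (cos a) * Rabs (cos a) = cos a * cos a) by (rewrite <- Rabs_mult; apply Rabs_pos_eq; nra).
  assert (H3 := Rabs_pos (cos a)). simpl. nra.
Qed.

Lemma exp_le (x y : R) : x <= y -> exp x <= exp y.
Proof. intros [H | ->]; [apply Rlt_le, exp_increasing, H | apply Rle_refl]. Qed.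

(** Bounding |cos 2t| by 1 separates the variables: |Y| is at most c |cos t| + d |cos 2x|, so |Y| +
    1/p is below an exponential of a sum, whose power is a product of profiles. The constant 3
    bounds exp((p - 1)/p). *)
Lemma Yfun_pow (c d t x : R) (p : nat) : (4 <= p)%nat -> 0 <= c -> 0 <= d -> c + d = 1 ->
  (Rabs (Yfun c d t x) + / INR p) ^ (p - 1)
  <= 3 * (Eg (INR (p - 1) * c) t * Eg (INR (p - 1) * d) (2 * x)).
Proof.
  intros Hp Hc Hd Hcd. assert (H := invp_pos p Hp). assert (Hp4 := INRp_ge p Hp).
  set (z := / INR p - c * (sin t ^ 2 / 2) - d * (sin (2 * x) ^ 2 / 2)).
  assert (Hz : Rabs (Yfun c d t x) + / INR p <= exp z).
  { apply Rle_trans with (1 + z); [|apply exp_ineq1_le].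
    assert (A1 := one_minus_abs_cos t). assert (A2 := one_minus_abs_cos (2 * x)).
    assert (A3 : Rabs (Yfun c d t x) <= c * Rabs (cos t) + d * Rabs (cos (2 * x))).
    { unfold Yfun. simpl INR. eapply Rle_trans; [apply Rabs_triang|].
      rewrite !Rabs_mult, (Rabs_pos_eq c), (Rabs_pos_eq d) by lra.
      assert (A4 : Rabs (cos (2 * t)) <= 1) by (apply Rabs_le; destruct (COS_bound (2 * t)); lra).
      apply Rplus_le_compat_l. rewrite Rmult_assoc. apply Rmult_le_compat_l; [exact Hd|].
      assert (A5 := Rabs_pos (cos (2 * x))). replace (1 + 1) with 2 by ring. nra. }
    assert (c * (sin t ^ 2 / 2) <= c * (1 - Rabs (cos t))) by (apply Rmult_le_compat_l; lra).
    assert (d * (sin (2 * x) ^ 2 / 2) <= d * (1 - Rabs (cos (2 * x)))) by (apply Rmult_le_compat_l; lra).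
    unfold z. lra. }
  apply Rle_trans with (exp z ^ (p - 1)).
  - apply pow_incr. split; [|exact Hz]. assert (H0 := Rabs_pos (Yfun c d t x)). lra.
  - rewrite exp_INR_pow. unfold Eg. rewrite <- exp_plus.
    apply Rle_trans with (exp (1 + (- (INR (p - 1) * c * sin t ^ 2 / 2) + - (INR (p - 1) * d * sin (2 * x) ^ 2 / 2)))).
    + assert (INR (p - 1) * / INR p <= 1).
      { rewrite minus_INR by lia. simpl INR. apply Rmult_le_reg_r with (INR p); [lra|]. field_simplify; lra. }
      apply exp_le. unfold z.
      assert (E : INR (p - 1) * (/ INR p - c * (sin t ^ 2 / 2) - d * (sin (2 * x) ^ 2 / 2))
        = INR (p - 1) * / INR p + (- (INR (p - 1) * c * sin t ^ 2 / 2) + - (INR (p - 1) * d * sin (2 * x) ^ 2 / 2)))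
        by (field; lra). rewrite E. lra.
    + rewrite exp_plus. apply Rmult_le_compat_r; [apply Rlt_le, exp_pos | apply exp_le_3].
Qed.

(* Coquelicot states equalities in the carrier of a normed module, which [ring] does not recognise. *)
Ltac eq_in_R := match goal with |- ?l = ?u => change (@eq R l u) end.

(** * Sobolev norms and the potential in terms of cosine coefficients *)

Lemma fc_cos_cf (f : R -> R) (j : nat) :
  fc_cos f j = if Nat.eq_dec j 0 then cf f j else cf f j / 2.
Proof.
  unfold fc_cos, cf. destruct (Nat.eq_dec j 0); [reflexivity|]. field. apply PI_neq0.
Qed.

Lemma fc_sin_W (q : R) (f : R -> R) (B : R) (j : nat) : W q f B -> fc_sin f j = 0.
Proof. intros H. unfold fc_sin. rewrite (W_sin q f B j H). apply Rmult_0_r. Qed.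

Lemma fc_sq_0 (q : R) (f : R -> R) (B : R) : W q f B -> fc_sq f 0 = cf f 0 ^ 2.
Proof. intros H. unfold fc_sq. rewrite fc_cos_cf, (fc_sin_W q f B 0 H). simpl. ring. Qed.

Lemma fc_sq_S (q : R) (f : R -> R) (B : R) (k : nat) : W q f B -> fc_sq f (S k) = cf f (S k) ^ 2 / 4.
Proof. intros H. unfold fc_sq. rewrite fc_cos_cf, (fc_sin_W q f B (S k) H). simpl. field. Qed.

Lemma Hs_fin_decay (q : R) (f : R -> R) (B M rho s : R) : 0 < rho < 1 -> W q f B ->
  (forall k, Rabs (cf f k) <= M * rho ^ k) -> Hs_fin s f.
Proof.
  intros Hr HW HM. unfold Hs_fin.
  assert (H2 : 0 < rho ^ 2 < 1) by (simpl; nra).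
  apply (ex_series_bound _ (fun k => (M * rho) ^ 2 / 4 * (Rpower (INR (S k)) (2 * s) * (rho ^ 2) ^ k))).
  - apply (@ex_series_scal_l R_AbsRing). now apply ex_series_Rpower_geom.
  - intros k. unfold Hs_terms. rewrite (fc_sq_S q f B k HW).
    assert (HR : 0 < Rpower (INR (S k)) (2 * s)) by apply exp_pos.
    rewrite Rabs_mult, (Rabs_pos_eq (Rpower _ _)) by lra.
    rewrite Rabs_pos_eq by (assert (H := pow2_ge_0 (cf f (S k))); lra).
    replace ((M * rho) ^ 2 / 4 * (Rpower (INR (S k)) (2 * s) * (rho ^ 2) ^ k))
      with (Rpower (INR (S k)) (2 * s) * ((M * rho ^ S k) ^ 2 / 4))
      by (rewrite <- pow_mult, Nat.mul_comm, pow_mult; simpl; field).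
    apply Rmult_le_compat_l; [lra|]. unfold Rdiv. apply Rmult_le_compat_r; [lra|].
    rewrite <- (pow2_abs (cf f (S k))). apply pow_incr. split; [apply Rabs_pos | apply HM].
Qed.

(** After expanding the cosine of the difference, the sine part integrates to zero because f is
    even. *)
Lemma RI_cos_diff (q : R) (f : R -> R) (B : R) (n : nat) (x : R) : W q f B ->
  RInt (fun y => f y * cos (INR n * (x - y))) 0 (2 * PI)
  = cos (INR n * x) * RInt (fun y => f y * cos (INR n * y)) 0 (2 * PI).
Proof.
  intros H. assert (Hc := W_cont q f B H).
  assert (C1 : cont (fun y => f y * cos (INR n * y))) by now apply cont_mcos.
  assert (C2 : cont (fun y => f y * sin (INR n * y))) by (apply cont_mult; auto using cont_sinI).
  rewrite (RI_ext _ (fun y => cos (INR n * x) * (f y * cos (INR n * y))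
                            + sin (INR n * x) * (f y * sin (INR n * y))))
    by (intros z; rewrite Rmult_minus_distr_l, cos_minus; ring).
  rewrite (RI_plus (fun y => cos (INR n * x) * (f y * cos (INR n * y)))) by now apply cont_scal.
  rewrite !RI_scal, (W_sin q f B n H) by easy.
  eq_in_R. ring.
Qed.

Lemma Vconv_cf (q : R) (f : R -> R) (B : R) (p : nat) (x : R) : (1 <= p)%nat -> W q f B ->
  Vconv p f x = cf f 0 + cf f 1 * cos (INR 1 * x) + INR p ^ 2 * cf f p * cos (INR p * x).
Proof.
  intros Hp H. unfold Vconv.
  rewrite (RI_ext f (fun y => f y * cos (INR 0 * y)))
    by (intros; change (INR 0) with 0; rewrite Rmult_0_l, cos_0; ring).
  rewrite (RI_ext (fun y => f y * cos (x - y)) (fun y => f y * cos (INR 1 * (x - y))))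
    by (intros; change (INR 1) with 1; now rewrite Rmult_1_l).
  rewrite !(RI_cos_diff q f B _ x H). unfold cf.
  destruct (Nat.eq_dec 0 0), (Nat.eq_dec 1 0), (Nat.eq_dec p 0); try lia. field. apply PI_neq0.
Qed.

Lemma is_series_delta (a : R) (n : nat) (f : nat -> R) :
  is_series (fun k => (if Nat.eq_dec n k then a else 0) * f k) (a * f n).
Proof.
  apply is_series_sum_f. apply is_lim_seq_ext_loc with (fun _ => a * f n); [|apply is_lim_seq_const].
  exists n. intros m Hm. rewrite sum_delta. destruct (le_dec n m); [reflexivity | lia].
Qed.

Lemma is_series_plusR (a b : nat -> R) (A B : R) : is_series a A -> is_series b B ->
  is_series (fun k => a k + b k) (A + B).
Proof. exact (is_series_plus a b A B). Qed.

Lemma is_series_scalR (k : R) (a : nat -> R) (A : R) : is_series a A -> is_series (fun n => k * a n) (k * A).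
Proof. exact (is_series_scal k a A). Qed.

Lemma is_series_zero : is_series (fun _ : nat => 0) 0.
Proof.
  apply is_series_sum_f. apply is_lim_seq_ext with (fun _ => 0); [|apply is_lim_seq_const].
  intros n. symmetry. now apply sum_zero.
Qed.

Lemma is_series_Vc (p : nat) (f : nat -> R) :
  is_series (fun k => Vc p k * f k) (f 0%nat + f 1%nat + INR p ^ 2 * f p).
Proof.
  apply is_series_ext with (fun k => (if Nat.eq_dec 0 k then 1 else 0) * f k
    + (if Nat.eq_dec 1 k then 1 else 0) * f k + (if Nat.eq_dec p k then INR p ^ 2 else 0) * f k).
  - intros k. eq_in_R. unfold Vc. ring.
  - replace (f 0%nat + f 1%nat + INR p ^ 2 * f p)
      with (1 * f 0%nat + 1 * f 1%nat + INR p ^ 2 * f p) by ring.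
    apply is_series_plusR; [apply is_series_plusR|]; apply is_series_delta.
Qed.

Lemma Hs_norm_cf (q : R) (f : R -> R) (B r : R) : W q f B ->
  Hs_norm r f = sqrt (cf f 0 ^ 2 + 2 * Series (fun k => Rpower (INR (S k)) (2 * r) * (cf f (S k) ^ 2 / 4))).
Proof.
  intros H. unfold Hs_norm. rewrite (fc_sq_0 q f B H). do 3 f_equal. apply Series_ext.
  intros k. unfold Hs_terms. now rewrite (fc_sq_S q f B k H).
Qed.

(** * From the fixed point to the partial differential equation *)

Section Solution.

Variables (p K : nat) (c d eps : R) (y : R -> R -> R).

Let q : R := 1 + / INR p.
Let r : R := / q.
Let T : R := INR K * (2 * PI).
Let a : R := - (2 * PI).
Let b : R := INR (S K) * (2 * PI).
Let h (j : nat) : R -> R := hist (cut T) (fun s x => y s x ^ p) j.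

Hypothesis Hp : (4 <= p)%nat.
Hypothesis Hc : 0 <= c <= 1.
Hypothesis Hd : 0 <= d <= 1.
Hypothesis Heps : 0 <= eps.
Hypothesis HyU : UC (fun t x => y t x ^ p).
Hypothesis HyW : forall t, W q (y t) 2.
Hypothesis HypW : forall t, W q (fun x => y t x ^ p) 81.
Hypothesis Hycf : forall t j, cf (y t) j = cf (Yfun c d t) j - eps * Duh (om p j) (h j) t.

(** [mode1] and [mode2] are the first two time derivatives of the j-th coefficient. [mode2] is
    already written as the right-hand side of the oscillator equation, so the partial differential
    equation can be read off termwise. *)
Definition mode1 (j : nat) (t : R) : R := Yc1 c d j t - eps * Duh' (om p j) (h j) t.
Definition mode2 (j : nat) (t : R) : R := - (om p j ^ 2 * cf (y t) j) - eps * h j t.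

Lemma q_gt_1 : 1 < q.
Proof. assert (H := invp_pos p Hp). unfold q. lra. Qed.

Lemma r_range : 0 < r < 1.
Proof. assert (H := inv_q_range q q_gt_1). assert (H1 := q_gt_1). split; [apply Rinv_0_lt_compat; lra | apply H]. Qed.

Lemma h_cont (j : nat) : cont (h j).
Proof.
  apply (hist_cont q (cut T) (cut_cont T) (fun s x => y s x ^ p) 81 j HyU HypW).
Qed.

Lemma om_neq0 (j : nat) : om p j <> 0.
Proof. assert (H := om_ge_1 p j). lra. Qed.

Lemma mode_derive (j : nat) (t : R) : is_derive (fun t => cf (y t) j) t (mode1 j t).
Proof.
  apply is_derive_ext with (fun t => Yc c d j t - eps * Duh (om p j) (h j) t).
  { intros s. rewrite Hycf, cf_Yfun. reflexivity. }
  apply (is_derive_minus (Yc c d j) (fun t => eps * Duh (om p j) (h j) t)); [apply Yc_derive|].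
  apply (is_derive_scal (Duh (om p j) (h j))), Duh_derive; [apply om_neq0 | apply h_cont].
Qed.

Lemma mode1_derive (j : nat) (t : R) : is_derive (mode1 j) t (mode2 j t).
Proof.
  replace (mode2 j t) with (minus (- (om p j ^ 2 * Yc c d j t))
    (eps * (- (om p j ^ 2 * Duh (om p j) (h j) t) + h j t)))
    by (unfold mode2, minus, plus, opp; simpl; rewrite Hycf, cf_Yfun; ring).
  apply (is_derive_minus (Yc1 c d j) (fun t => eps * Duh' (om p j) (h j) t)); [now apply Yc1_derive|].
  apply (is_derive_scal (Duh' (om p j) (h j))), Duh'_derive; [apply om_neq0 | apply h_cont].
Qed.

Lemma mode_cont (j : nat) : cont (fun t => cf (y t) j).
Proof. apply (cont_derive _ (mode1 j)). apply mode_derive. Qed.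

Lemma mode2_cont (j : nat) : cont (mode2 j).
Proof.
  apply cont_minus; [|apply cont_scal, h_cont].
  apply (cont_ext (fun t => (- (om p j ^ 2)) * cf (y t) j)); [intros; ring|].
  apply cont_scal, mode_cont.
Qed.

Lemma h_bound (j : nat) (s : R) : Rabs (h j s) <= 81 * r ^ j.
Proof.
  unfold h, hist. rewrite Rabs_mult. assert (H := cut_range T s). rewrite (Rabs_pos_eq (cut T s)) by apply H.
  assert (H1 := W_cf_decay q _ _ j (Rlt_le _ _ q_gt_1) (HypW s)). fold r in H1.
  assert (H2 := Rabs_pos (cf (fun x => y s x ^ p) j)). nra.
Qed.

Lemma window_0 : a <= 0 <= b.
Proof.
  assert (HP := PI_RGT_0). unfold a, b. split; [lra|].
  apply Rmult_le_pos; [apply pos_INR | lra].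
Qed.

Lemma cut_supp (s : R) : s < a \/ b < s -> cut T s = 0.
Proof.
  intros H. apply cut_0. assert (HP := PI2_1). unfold a, b, T in *. rewrite S_INR in H.
  destruct H; [left | right]; lra.
Qed.

Lemma Duh'_h_bound (j : nat) (t : R) : Rabs (Duh' (om p j) (h j) t) <= 162 * (b - a) * r ^ j.
Proof.
  eapply Rle_trans.
  - apply (Duh'_bound (om p j) (h j) a b t window_0 (h_cont j)).
    intros s Hs. unfold h, hist. rewrite (cut_supp s Hs). ring.
  - replace (162 * (b - a) * r ^ j) with (2 * ((b - a) * (81 * r ^ j))) by ring.
    apply Rmult_le_compat_l; [lra|]. rewrite <- RI_const. assert (H := window_0).
    apply RI_le; [lra | apply cont_Rabs, h_cont | apply cont_const | intros; apply h_bound].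
Qed.

(** One constant above all those in the coefficient bounds: 2 for y, 3 q^2 + 162 eps (b - a) for
    [mode1], and 2 (3 + p^2) + 81 eps for [mode2]. It allows a single majorant [dom] for all
    termwise derivatives. *)
Definition Mdom : R := 2 + 3 * q ^ 2 + eps * (162 * (b - a)) + 2 * (3 + INR p ^ 2) + eps * 81.
Definition dom (k : nat) : R := Mdom * (INR (S k) ^ 4 * r ^ k).

Lemma Mdom_parts : 0 <= 3 * q ^ 2 /\ 0 <= eps * (162 * (b - a)) /\ 0 <= INR p ^ 2 /\ 0 <= eps * 81.
Proof.
  assert (H := window_0). assert (H1 := pow2_ge_0 q). assert (H2 := pow2_ge_0 (INR p)).
  assert (0 <= eps * (162 * (b - a))) by (apply Rmult_le_pos; lra). lra.
Qed.

Lemma dom_summable : ex_series dom.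
Proof. apply ex_series_poly_geom, r_range. Qed.

Lemma r_pow_pos (j : nat) : 0 < r ^ j.
Proof. apply pow_lt, r_range. Qed.

Lemma INR_S_ge (j : nat) : 1 <= INR (S j) /\ 0 <= INR j <= INR (S j).
Proof. rewrite S_INR. assert (H := pos_INR j). lra. Qed.

Lemma dom_le (j : nat) (z M : R) (n : nat) : (n <= 4)%nat -> M <= Mdom -> 0 <= M ->
  z <= M * INR (S j) ^ n * r ^ j -> z <= dom j.
Proof.
  intros Hn HM HM0 Hz. eapply Rle_trans; [exact Hz|]. unfold dom. rewrite <- Rmult_assoc.
  apply Rmult_le_compat_r; [apply Rlt_le, r_pow_pos|].
  apply Rmult_le_compat; try lra; [apply pow_le, pos_INR|].
  apply Rle_pow; [apply INR_S_ge | exact Hn].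
Qed.

Lemma mode_decay (j : nat) (t : R) : Rabs (cf (y t) j) <= 2 * r ^ j.
Proof. apply (W_cf_decay q _ _ j (Rlt_le _ _ q_gt_1) (HyW t)). Qed.

(** Purely geometric decay, without a power of j: the velocity form of Duhamel involves no
    frequency, and the linear part lives on modes 0 and 2, where q^2 r^2 = 1. The Sobolev and Wiener
    bounds on the time derivative rest on it. *)
Lemma mode1_decay (j : nat) (t : R) : Rabs (mode1 j t) <= Mdom * r ^ j.
Proof.
  destruct Mdom_parts as (M1 & M2 & M3 & M4).
  assert (H := Duh'_h_bound j t). assert (Hr := r_pow_pos j).
  assert (H1 : Rabs (Yc1 c d j t) <= 3 * q ^ 2 * r ^ j).
  { unfold Yc1. assert (Hq := q_gt_1).
    assert (Hq2 : 1 <= q ^ 2) by (apply pow_ge_1; lra).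
    assert (Hqr : q ^ 2 * r ^ 2 = 1) by (unfold r; field; lra).
    assert (S1 : Rabs (- c * sin t) <= 1).
    { eapply Rle_trans; [apply Rabs_msin|]. rewrite Rabs_Ropp, Rabs_pos_eq; lra. }
    assert (S2 : Rabs (-2 * d * sin (2 * t)) <= 2).
    { eapply Rle_trans; [apply Rabs_msin|]. rewrite Rabs_mult, Rabs_left, Rabs_pos_eq; lra. }
    destruct (Nat.eq_dec 0 j) as [<-|H0].
    - destruct (Nat.eq_dec 2 0); [lia|]. rewrite Rmult_0_r, Rplus_0_r, Rmult_1_r. simpl pow at 2. lra.
    - destruct (Nat.eq_dec 2 j) as [<-|H2].
      + rewrite Rmult_0_r, Rplus_0_l, Rmult_1_r.
        replace (3 * q ^ 2 * r ^ 2) with (3 * (q ^ 2 * r ^ 2)) by ring. lra.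
      + rewrite !Rmult_0_r, Rplus_0_r, Rabs_R0. apply Rmult_le_pos; lra. }
  unfold mode1. unfold Rminus at 1. eapply Rle_trans; [apply Rabs_triang|].
  rewrite Rabs_Ropp, Rabs_mult, (Rabs_pos_eq eps) by exact Heps.
  assert (H2 : eps * Rabs (Duh' (om p j) (h j) t) <= eps * (162 * (b - a) * r ^ j))
    by now apply Rmult_le_compat_l.
  assert (H3 : (3 * q ^ 2 + eps * (162 * (b - a))) * r ^ j <= Mdom * r ^ j).
  { apply Rmult_le_compat_r; [lra|]. unfold Mdom. lra. }
  lra.
Qed.

Lemma mode2_decay (j : nat) (t : R) : Rabs (mode2 j t) <= dom j.
Proof.
  destruct Mdom_parts as (M1 & M2 & M3 & M4).
  assert (Hr := r_pow_pos j). destruct (INR_S_ge j) as [S1 S2].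
  apply (dom_le j _ (2 * (3 + INR p ^ 2) + eps * 81) 2); [lia | unfold Mdom; lra | lra |].
  unfold mode2. unfold Rminus. eapply Rle_trans; [apply Rabs_triang|].
  rewrite !Rabs_Ropp, !Rabs_mult, (Rabs_pos_eq eps) by exact Heps.
  assert (H1 := mode_decay j t). assert (H2 := h_bound j t).
  assert (Q : 1 <= INR (S j) ^ 2) by (apply pow_ge_1; lra).
  assert (H3 : Rabs (om p j ^ 2) <= (3 + INR p ^ 2) * INR (S j) ^ 2).
  { rewrite Rabs_pos_eq by apply pow2_ge_0. rewrite om_sq. destruct (Vc_bound p j).
    assert (INR j ^ 2 <= INR (S j) ^ 2) by (apply pow_incr; lra). nra. }
  assert (H4 : Rabs (om p j ^ 2) * Rabs (cf (y t) j) <= (3 + INR p ^ 2) * INR (S j) ^ 2 * (2 * r ^ j))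
    by (apply Rmult_le_compat; try apply Rabs_pos; lra).
  assert (H5 : eps * Rabs (h j t) <= eps * (81 * r ^ j)) by now apply Rmult_le_compat_l.
  assert (H6 : eps * 81 * r ^ j * 1 <= eps * 81 * r ^ j * INR (S j) ^ 2).
  { apply Rmult_le_compat_l; [apply Rmult_le_pos; lra | exact Q]. }
  lra.
Qed.

Lemma Mdom_ge_2 : 2 <= Mdom.
Proof. destruct Mdom_parts as (M1 & M2 & M3 & M4). unfold Mdom. lra. Qed.

Lemma y_series (t x : R) : y t x = Series (fun j => cf (y t) j * cos (INR j * x)).
Proof. symmetry. apply is_series_unique. apply (W_series q _ 2); [apply q_gt_1 | apply HyW]. Qed.

Lemma mode_dom (j : nat) (t : R) : Rabs (cf (y t) j) <= dom j.
Proof.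
  apply (dom_le j _ 2 0); [lia | apply Mdom_ge_2 | lra |]. simpl pow. rewrite Rmult_1_r. apply mode_decay.
Qed.

Lemma mode1_dom (j : nat) (t : R) : Rabs (mode1 j t) <= dom j.
Proof.
  assert (H := Mdom_ge_2).
  apply (dom_le j _ Mdom 0); [lia | lra | lra |]. simpl pow. rewrite Rmult_1_r. apply mode1_decay.
Qed.

Lemma y_dt (t x : R) : is_derive (fun t => y t x) t (Series (fun j => mode1 j t * cos (INR j * x))).
Proof.
  apply is_derive_ext with (fun t => Series (fun j => cf (y t) j * cos (INR j * x))).
  { intros s. symmetry. apply y_series. }
  apply (is_derive_Series (fun j t => cf (y t) j * cos (INR j * x)) (fun j t => mode1 j t * cos (INR j * x)) dom).
  - apply dom_summable.
  - intros k s. eapply Rle_trans; [apply Rabs_mcos | apply mode_dom].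
  - intros k s. eapply Rle_trans; [apply Rabs_mcos | apply mode1_dom].
  - intros k s. rewrite (Rmult_comm (mode1 k s)).
    apply is_derive_ext with (fun t => cos (INR k * x) * cf (y t) k); [intros; apply Rmult_comm|].
    apply (is_derive_scal (fun t => cf (y t) k)), mode_derive.
  - intros k. apply cont_mult; [|apply cont_const]. apply (cont_derive _ (mode2 k)), mode1_derive.
Qed.

Lemma y_dtt (t x : R) : is_derive (fun t => Series (fun j => mode1 j t * cos (INR j * x))) t
  (Series (fun j => mode2 j t * cos (INR j * x))).
Proof.
  apply (is_derive_Series (fun j t => mode1 j t * cos (INR j * x)) (fun j t => mode2 j t * cos (INR j * x)) dom).
  - apply dom_summable.
  - intros k s. eapply Rle_trans; [apply Rabs_mcos | apply mode1_dom].
  - intros k s. eapply Rle_trans; [apply Rabs_mcos | apply mode2_decay].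
  - intros k s. rewrite (Rmult_comm (mode2 k s)).
    apply is_derive_ext with (fun t => cos (INR k * x) * mode1 k t); [intros; apply Rmult_comm|].
    apply (is_derive_scal (mode1 k)), mode1_derive.
  - intros k. apply cont_mult; [apply mode2_cont | apply cont_const].
Qed.

Lemma mode_poly_dom (j n : nat) (t z : R) : (n <= 4)%nat -> Rabs z <= INR j ^ n -> Rabs (cf (y t) j * z) <= dom j.
Proof.
  intros Hn Hz. apply (dom_le j _ 2 n); [exact Hn | apply Mdom_ge_2 | lra |].
  rewrite Rabs_mult. replace (2 * INR (S j) ^ n * r ^ j) with ((2 * r ^ j) * INR (S j) ^ n) by ring.
  apply Rmult_le_compat; try apply Rabs_pos; [apply mode_decay|].
  eapply Rle_trans; [exact Hz|]. apply pow_incr. apply INR_S_ge.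
Qed.

Lemma y_dx (t x : R) : is_derive (fun x => y t x) x
  (Series (fun j => cf (y t) j * (- (INR j * sin (INR j * x))))).
Proof.
  apply is_derive_ext with (fun x => Series (fun j => cf (y t) j * cos (INR j * x))).
  { intros s. symmetry. apply y_series. }
  apply (is_derive_Series (fun j x => cf (y t) j * cos (INR j * x))
    (fun j x => cf (y t) j * (- (INR j * sin (INR j * x)))) dom).
  - apply dom_summable.
  - intros k s. eapply Rle_trans; [apply Rabs_mcos | apply mode_dom].
  - intros k s. apply mode_poly_dom with 1%nat; [lia|]. rewrite Rabs_Ropp.
    eapply Rle_trans; [apply Rabs_msin|]. rewrite Rabs_pos_eq by apply pos_INR. simpl; lra.
  - intros k s. auto_derive; [easy | ring].
  - intros k. apply cont_scal. apply (cont_ext (fun x => - INR k * sin (INR k * x))); [intros; ring|].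
    apply cont_scal, cont_sinI.
Qed.

Lemma y_dxx (t x : R) : is_derive (fun x => Series (fun j => cf (y t) j * (- (INR j * sin (INR j * x))))) x
  (Series (fun j => cf (y t) j * (- (INR j ^ 2 * cos (INR j * x))))).
Proof.
  apply (is_derive_Series (fun j x => cf (y t) j * (- (INR j * sin (INR j * x))))
    (fun j x => cf (y t) j * (- (INR j ^ 2 * cos (INR j * x)))) dom).
  - apply dom_summable.
  - intros k s. apply mode_poly_dom with 1%nat; [lia|]. rewrite Rabs_Ropp.
    eapply Rle_trans; [apply Rabs_msin|]. rewrite Rabs_pos_eq by apply pos_INR. simpl; lra.
  - intros k s. apply mode_poly_dom with 2%nat; [lia|]. rewrite Rabs_Ropp.
    eapply Rle_trans; [apply Rabs_mcos|]. rewrite Rabs_pos_eq by apply pow2_ge_0. lra.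
  - intros k s. auto_derive; [easy | ring].
  - intros k. apply cont_scal. apply (cont_ext (fun x => - INR k ^ 2 * cos (INR k * x))); [intros; ring|].
    apply cont_scal, cont_cosI.
Qed.

(** The interval is where the cutoff equals 1, so that the cut-off force is the true one. There the
    four series cancel mode by mode. *)
Lemma y_pde (t x : R) : -1 <= t <= T + 1 ->
  Series (fun j => mode2 j t * cos (INR j * x)) - Series (fun j => cf (y t) j * (- (INR j ^ 2 * cos (INR j * x))))
  + Vconv p (y t) x + eps * y t x ^ p = 0.
Proof.
  intros Ht. rewrite (Vconv_cf q (y t) 2 p x) by (try lia; apply HyW).
  set (e := fun j => cf (y t) j * cos (INR j * x)).
  assert (E2 : is_series (fun j => mode2 j t * cos (INR j * x)) (Series (fun j => mode2 j t * cos (INR j * x)))).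
  { apply Series_correct, (ex_series_bound _ dom dom_summable). intros k.
    eapply Rle_trans; [apply Rabs_mcos | apply mode2_decay]. }
  assert (Ex : is_series (fun j => cf (y t) j * (- (INR j ^ 2 * cos (INR j * x))))
    (Series (fun j => cf (y t) j * (- (INR j ^ 2 * cos (INR j * x)))))).
  { apply Series_correct, (ex_series_bound _ dom dom_summable). intros k.
    apply mode_poly_dom with 2%nat; [lia|]. rewrite Rabs_Ropp.
    eapply Rle_trans; [apply Rabs_mcos|]. rewrite Rabs_pos_eq by apply pow2_ge_0. lra. }
  assert (EV := is_series_Vc p e).
  assert (Ep := is_series_scalR eps _ _ (W_series q _ 81 x q_gt_1 (HypW t))).
  assert (S := is_series_plusR _ _ _ _ (is_series_plusR _ _ _ _
    (is_series_plusR _ _ _ _ E2 (is_series_scalR (-1) _ _ Ex)) EV) Ep).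
  apply is_series_unique in S.
  rewrite (Series_ext _ (fun _ => 0)), (is_series_unique _ _ is_series_zero) in S.
  - unfold e in S. change (INR 0) with 0 in S. rewrite Rmult_0_l, cos_0 in S. lra.
  - intros j. unfold mode2, h, hist, e. rewrite cut_1, om_sq by exact Ht. ring.
Qed.

(** The decay q^(-j) of [mode1] is summable only against a smaller weight, hence q' = 1 + 1/(2p),
    strictly between 1 and q. *)
Lemma y_dt_cf (t : R) (j : nat) : cf (fun x => Series (fun j => mode1 j t * cos (INR j * x))) j = mode1 j t
  /\ exists q' B, 1 < q' /\ W q' (fun x => Series (fun j => mode1 j t * cos (INR j * x))) B.
Proof.
  assert (HI := invp_pos p Hp). assert (Hq := q_gt_1). assert (HM := Mdom_ge_2).
  set (q' := 1 + / INR p / 2). assert (Hq' : 1 < q') by (unfold q'; lra).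
  assert (Hrho : 0 <= q' * r < 1).
  { split; [apply Rmult_le_pos; [lra | apply Rlt_le, r_range]|]. unfold r.
    apply Rmult_lt_reg_r with q; [lra|]. rewrite Rmult_assoc, Rinv_l by lra. unfold q', q. lra. }
  assert (HS : forall n, sum_f_R0 (fun k => Rabs (mode1 k t) * q' ^ k) n <= Series (fun k => Mdom * (q' * r) ^ k)).
  { intros n.
    assert (Hex : ex_series (fun k => Mdom * (q' * r) ^ k)).
    { apply ex_series_geom_bound with Mdom (q' * r); [exact Hrho|]. intros k.
      rewrite Rabs_pos_eq; [lra|]. apply Rmult_le_pos; [lra | apply pow_le; lra]. }
    apply Rle_trans with (sum_f_R0 (fun k => Mdom * (q' * r) ^ k) n).
    - apply sum_f_R0_le. intros k _. rewrite Rpow_mult_distr.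
      replace (Mdom * (q' ^ k * r ^ k)) with (Mdom * r ^ k * q' ^ k) by ring.
      apply Rmult_le_compat_r; [apply pow_le; lra | apply mode1_decay].
    - assert (T0 := Series_tail_bound (fun _ => 0) (fun k => Mdom * (q' * r) ^ k) n Hex).
      assert (0 <= Series (fun k => Mdom * (q' * r) ^ k) - sum_f_R0 (fun k => Mdom * (q' * r) ^ k) n); [|lra].
      eapply Rle_trans; [apply Rabs_pos | apply T0]. intros k. rewrite Rabs_R0.
      apply Rmult_le_pos; [lra | apply pow_le; lra]. }
  split.
  - exact (cf_cser q' (fun j => mode1 j t) _ j Hq' HS).
  - exists q', (Series (fun k => Mdom * (q' * r) ^ k)). split; [exact Hq'|].
    exact (W_cser q' (fun j => mode1 j t) _ Hq' HS).
Qed.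

(** * Undoing the scaling *)

Variable A : R.
Hypothesis HA : 0 < A.
Hypothesis HAeps : eps = A ^ (p - 1).

Definition usol (t x : R) : R := A * y t x.

Lemma usol_dt (t x : R) :
  is_derive (fun t => usol t x) t (A * Series (fun j => mode1 j t * cos (INR j * x))).
Proof. apply (is_derive_scal (fun t => y t x)), y_dt. Qed.

Lemma usol_Derive (t x : R) :
  Derive (fun t => usol t x) t = A * Series (fun j => mode1 j t * cos (INR j * x)).
Proof. apply is_derive_unique, usol_dt. Qed.

Lemma usol_W (t : R) : W q (usol t) (Rabs A * 2).
Proof. apply W_scal; [apply Rlt_le, q_gt_1 | apply HyW]. Qed.

Lemma usol_cf (t : R) (j : nat) : cf (usol t) j = A * cf (y t) j.
Proof. apply cf_scal. apply (W_cont q _ _ (HyW t)). Qed.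

Lemma dt_usol_W (t : R) : exists q' B, W q' (dt usol t) B.
Proof.
  destruct (y_dt_cf t 0) as [_ (q' & B & Hq' & HW)]. exists q', (Rabs A * B).
  apply (W_ext q' (fun x => A * Series (fun j => mode1 j t * cos (INR j * x)))).
  - intros x. symmetry. apply usol_Derive.
  - apply W_scal; [lra | exact HW].
Qed.

Lemma dt_usol_cf (t : R) (j : nat) : cf (dt usol t) j = A * mode1 j t.
Proof.
  destruct (y_dt_cf t j) as [E (q' & B & Hq' & HW)].
  rewrite (cf_ext _ (fun x => A * Series (fun j => mode1 j t * cos (INR j * x)))) by (intros; apply usol_Derive).
  rewrite cf_scal, E; [reflexivity | apply (W_cont q' _ _ HW)].
Qed.

Lemma usol_fin (s t : R) : Hs_fin s (usol t).
Proof.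
  apply (Hs_fin_decay q (usol t) (Rabs A * 2) (A * 2) r); [apply r_range | apply usol_W |].
  intros k. rewrite usol_cf, Rabs_mult, (Rabs_pos_eq A), Rmult_assoc by lra.
  apply Rmult_le_compat_l; [lra | apply mode_decay].
Qed.

Lemma dt_usol_fin (s t : R) : Hs_fin s (dt usol t).
Proof.
  destruct (dt_usol_W t) as (q' & B & HW).
  apply (Hs_fin_decay q' (dt usol t) B (A * Mdom) r); [apply r_range | exact HW |].
  intros k. rewrite dt_usol_cf, Rabs_mult, (Rabs_pos_eq A), Rmult_assoc by lra.
  apply Rmult_le_compat_l; [lra | apply mode1_decay].
Qed.

Lemma usol_is_solution (s : R) : is_solution s p usol T.
Proof.
  split; [|split].
  - intros t x. apply (W_period q _ _ x (usol_W t)).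
  (* The margin 1 is the one on which the cutoff stays equal to 1 on either side of [0, T]. *)
  - exists 1. split; [lra|]. intros t Ht x.
    assert (D1 := fun t => usol_dt t x).
    assert (D2 : is_derive (fun tau => Derive (fun sig => usol sig x) tau) t
      (A * Series (fun j => mode2 j t * cos (INR j * x)))).
    { apply is_derive_ext with (fun t => A * Series (fun j => mode1 j t * cos (INR j * x))).
      - intros; symmetry; apply usol_Derive.
      - apply (is_derive_scal (fun t => Series (fun j => mode1 j t * cos (INR j * x)))), y_dtt. }
    assert (X1 : forall x, is_derive (fun x => usol t x) x
      (A * Series (fun j => cf (y t) j * (- (INR j * sin (INR j * x)))))).
    { intros z. apply (is_derive_scal (fun x => y t x)), y_dx. }
    assert (X2 : is_derive (fun y => Derive (fun z => usol t z) y) x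
      (A * Series (fun j => cf (y t) j * (- (INR j ^ 2 * cos (INR j * x)))))).
    { apply is_derive_ext with (fun x => A * Series (fun j => cf (y t) j * (- (INR j * sin (INR j * x))))).
      - intros z. symmetry. apply is_derive_unique, X1.
      - apply (is_derive_scal (fun x => Series (fun j => cf (y t) j * (- (INR j * sin (INR j * x)))))), y_dxx. }
    repeat split.
    + eexists; apply D1.
    + eexists; apply D2.
    + eexists; apply X1.
    + eexists; apply X2.
    + replace (Derive (fun tau => Derive (fun sig => usol sig x) tau) t)
        with (A * Series (fun j => mode2 j t * cos (INR j * x)))
        by (symmetry; apply is_derive_unique; exact D2).
      replace (Derive (fun y => Derive (fun z => usol t z) y) x)
        with (A * Series (fun j => cf (y t) j * (- (INR j ^ 2 * cos (INR j * x)))))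
        by (symmetry; apply is_derive_unique; exact X2).
      assert (H := y_pde t x ltac:(lra)). rewrite HAeps in H.
      rewrite (Vconv_cf q (usol t) _ p x ltac:(lia) (usol_W t)), !usol_cf.
      rewrite (Vconv_cf q (y t) 2 p x ltac:(lia) (HyW t)) in H.
      unfold usol. rewrite Rpow_mult_distr.
      (* A^p = A eps, so the equation for u is A times the equation for y. *)
      replace (A ^ p) with (A * A ^ (p - 1)) by (replace p with (S (p - 1)) at 2 by lia; reflexivity).
      apply Rmult_eq_compat_l with (r := A) in H. rewrite Rmult_0_r in H. rewrite <- H. ring.
  - intros t _. split; [apply usol_fin | apply dt_usol_fin].
Qed.

(** * The size of the initial data *)

(** The E^s norm of the data before scaling: modes 2 and -2 have coefficients d/2 and weight
    2^(2s+1), so together they contribute 2^(2s) d^2. The initial velocity is zero. *)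
Definition nu (s : R) : R := sqrt (c ^ 2 + Rpower 2 (2 * s) * d ^ 2).

Lemma mode_0 (j : nat) : cf (y 0) j = Yc c d j 0.
Proof.
  rewrite Hycf, cf_Yfun. unfold Duh, DC, DS. rewrite !RInt_point. unfold zero; simpl.
  unfold Rdiv. ring.
Qed.

Lemma mode1_0 (j : nat) : mode1 j 0 = 0.
Proof.
  unfold mode1, Duh', DC, DS, Yc1. rewrite !RInt_point. unfold zero; simpl.
  rewrite !Rmult_0_r, sin_0. ring.
Qed.

Lemma Es_norm_0 (s : R) : Es_norm s usol 0 = A * nu s.
Proof.
  unfold Es_norm. destruct (dt_usol_W 0) as (q' & B & HW).
  rewrite (Hs_norm_cf q _ _ _ (usol_W 0)), (Hs_norm_cf q' _ _ _ HW).
  rewrite !dt_usol_cf, !usol_cf, !mode1_0, mode_0.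
  rewrite (Series_ext _ (fun k => (if Nat.eq_dec 1 k then Rpower 2 (2 * s) * (A * d) ^ 2 / 2 else 0) * 1)).
  - rewrite (is_series_unique _ _ (is_series_delta (Rpower 2 (2 * s) * (A * d) ^ 2 / 2) 1 (fun _ => 1))).
    rewrite (Series_ext _ (fun _ => 0)).
    + rewrite (is_series_unique _ _ is_series_zero).
      replace ((A * 0) ^ 2 + 2 * 0) with 0 by ring. rewrite sqrt_0, Rplus_0_r.
      unfold Yc. destruct (Nat.eq_dec 0 0), (Nat.eq_dec 2 0); try lia. rewrite cos_0.
      replace ((A * (c * 1 * 1 + d * cos (2 * 0) * 0)) ^ 2 + 2 * (Rpower 2 (2 * s) * (A * d) ^ 2 / 2 * 1))
        with (A ^ 2 * (c ^ 2 + Rpower 2 (2 * s) * d ^ 2)) by field.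
      assert (0 < Rpower 2 (2 * s)) by apply exp_pos. assert (0 <= c ^ 2) by apply pow2_ge_0.
      assert (0 <= Rpower 2 (2 * s) * d ^ 2) by (apply Rmult_le_pos; [lra | apply pow2_ge_0]).
      rewrite sqrt_mult, sqrt_pow2 by (try apply pow2_ge_0; lra). reflexivity.
    + intros k. rewrite dt_usol_cf, mode1_0. eq_in_R. field.
  - intros k. rewrite usol_cf, mode_0. unfold Yc. rewrite (Rmult_0_r 2), cos_0.
    destruct (Nat.eq_dec 0 (S k)); [lia|].
    destruct (Nat.eq_dec 1 k) as [<-|Hk]; [destruct (Nat.eq_dec 2 2); [|lia]
      | destruct (Nat.eq_dec 2 (S k)); [lia | eq_in_R; field]].
    replace (2 * (s + / 2)) with (2 * s + 1) by field. rewrite Rpower_plus.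
    replace (INR (S 1)) with 2 by (simpl; ring). rewrite Rpower_1 by lra. eq_in_R; field.
Qed.

(** * Resonant growth of the modes 4 n *)

Variable m : R.
Hypothesis Hp10 : (10 <= p)%nat.
Hypothesis Hev : Nat.Even p.
Hypothesis Hm : 0 < m.
Hypothesis Hmc : m <= c.
Hypothesis Hmd : m <= d.
Hypothesis Hcd : c + d = 1.
Hypothesis Hynear : forall t x, Rabs (y t x - Yfun c d t x) <= / INR p.
Hypothesis Hybd : forall t x,
  Rabs (y t x ^ p) <= 6 * (Eg (INR (p - 1) * c) t * Eg (INR (p - 1) * d) (2 * x)).

Let lam : R := INR (p - 1).

Lemma lam_ge : 9 <= lam /\ INR p / 2 <= lam.
Proof.
  unfold lam. rewrite minus_INR by lia. assert (H := Hp10). apply le_INR in H. simpl in *. lra.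
Qed.

Lemma yp_nonneg (t x : R) : 0 <= y t x ^ p.
Proof. destruct Hev as [k Hk]. rewrite Hk, pow_mult. apply pow_le, pow2_ge_0. Qed.

Lemma yp_cont (s : R) : cont (fun x => y s x ^ p).
Proof. apply (W_cont q _ _ (HypW s)). Qed.

(** The total force at time s, the reference to which the resonant forcing of every mode 4 n is
    compared. *)
Definition mass (s : R) : R := RInt (fun x => y s x ^ p) 0 (2 * PI).

Lemma mass_cont : cont mass.
Proof.
  apply (cont_ext (fun s => 2 * PI * cf (fun x => y s x ^ p) 0)).
  - intros s. unfold mass, cf. destruct (Nat.eq_dec 0 0); [|lia].
    rewrite (RI_ext (fun x => y s x ^ p * cos (INR 0 * x)) (fun x => y s x ^ p))
      by (intros; change (INR 0) with 0; rewrite Rmult_0_l, cos_0; ring).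
    field. apply PI_neq0.
  - apply cont_scal. apply (UC_cf (fun s x => y s x ^ p)); [exact HyU | apply yp_cont].
Qed.

Lemma mass_nonneg (s : R) : 0 <= mass s.
Proof.
  assert (HP := PI_RGT_0). apply RI_ge0; [lra | apply yp_cont | intros; apply yp_nonneg].
Qed.

Lemma sinE2_cont : cont (fun x => sin (2 * x) ^ 2 * Eg (lam * d) (2 * x)).
Proof. apply cont_mult; [apply cont_pow, cont_sinI | apply Eg2_cont]. Qed.

(** Nonnegativity of y^p (p is even) allows multiplying the lower bound for the product of cosines
    by it. The deficit is paid with the upper bound 6 E1 E2, whence 48 = 6 times 8 and 12 = 6 times
    2. *)
Lemma resonance_pt (n : nat) (s : R) : (1 <= n)%nat ->
  / PI * (mass s - 48 * INR n ^ 2 * RInt (fun x => Eg (lam * d) (2 * x)) 0 (2 * PI) * (sin s ^ 2 * Eg (lam * c) s)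
          - 12 * INR n ^ 2 * RInt (fun x => sin (2 * x) ^ 2 * Eg (lam * d) (2 * x)) 0 (2 * PI) * Eg (lam * c) s)
  <= cos (INR (4 * n) * s) * cf (fun x => y s x ^ p) (4 * n).
Proof.
  intros Hn. unfold cf. destruct (Nat.eq_dec (4 * n) 0); [lia|]. assert (HP := PI_RGT_0).
  match goal with |- _ <= ?u * (?v * ?w) => replace (u * (v * w)) with (v * (u * w)) by ring end.
  apply Rmult_le_compat_l; [apply Rlt_le, Rinv_0_lt_compat, HP|].
  rewrite <- (RI_scal (cos (INR (4 * n) * s)) (fun x => y s x ^ p * cos (INR (4 * n) * x)))
    by (apply cont_mcos, yp_cont).
  set (A1 := 48 * INR n ^ 2 * (sin s ^ 2 * Eg (lam * c) s)).
  set (A2 := 12 * INR n ^ 2 * Eg (lam * c) s).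
  apply Rle_trans with (RInt (fun x => y s x ^ p - (A1 * Eg (lam * d) (2 * x)
    + A2 * (sin (2 * x) ^ 2 * Eg (lam * d) (2 * x)))) 0 (2 * PI)).
  - rewrite RI_minus; [|apply yp_cont | apply cont_plus; apply cont_scal; [apply Eg2_cont | apply sinE2_cont]].
    rewrite RI_plus by (apply cont_scal; (apply Eg2_cont || apply sinE2_cont)).
    rewrite !RI_scal by (apply Eg2_cont || apply sinE2_cont). unfold mass, A1, A2. lra.
  - apply RI_le; [lra | | apply cont_scal, cont_mcos, yp_cont |].
    + apply cont_minus; [apply yp_cont | apply cont_plus; apply cont_scal; [apply Eg2_cont | apply sinE2_cont]].
    + intros x _. assert (H1 := cos_cos_ge n s x). assert (H2 := yp_nonneg s x).
      assert (H3 := Hybd s x). fold lam in H3. rewrite Rabs_pos_eq in H3 by exact H2.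
      set (F := y s x ^ p) in *. set (E1 := Eg (lam * c) s) in *. set (E2 := Eg (lam * d) (2 * x)) in *.
      assert (H4 := Rmult_le_compat_l F _ _ H2 H1).
      assert (H5 : 0 <= 8 * INR n ^ 2 * sin s ^ 2 + 2 * INR n ^ 2 * sin (2 * x) ^ 2).
      { assert (0 <= INR n ^ 2 * sin s ^ 2) by (apply Rmult_le_pos; apply pow2_ge_0).
        assert (0 <= INR n ^ 2 * sin (2 * x) ^ 2) by (apply Rmult_le_pos; apply pow2_ge_0). lra. }
      assert (H6 := Rmult_le_compat_r _ _ _ H5 H3).
      replace (cos (INR (4 * n) * s) * (F * cos (INR (4 * n) * x)))
        with (F * (cos (INR (4 * n) * s) * cos (INR (4 * n) * x))) by ring.
      unfold A1, A2. fold E1. lra.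
Qed.

(** Only a square of side p^(-1/2) at the peak (2 PI i, 0) is kept. On it the linear solution is at
    least 1 - 4/p and y at least 1 - 5/p, so y^p >= exp(-10) on an area 1/p. *)
Lemma mass_block (i : nat) :
  exp (-10) / INR p <= RInt mass (0 + INR i * (2 * PI)) (0 + INR (S i) * (2 * PI)).
Proof.
  assert (Hp' : 10 <= INR p) by (assert (H := Hp10); apply le_INR in H; simpl in H; lra).
  assert (HP := PI2_1). assert (HI := invp_pos p Hp).
  set (k := sqrt (/ INR p)). assert (Hk2 : k * k = / INR p) by (apply sqrt_sqrt; lra).
  assert (Hk : 0 < k < 1).
  { split; [apply sqrt_lt_R0; lra|]. rewrite <- sqrt_1. apply sqrt_lt_1; lra. }
  set (z := 0 + INR i * (2 * PI)).
  replace (0 + INR (S i) * (2 * PI)) with (z + 2 * PI) by (unfold z; rewrite S_INR; ring).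
  rewrite <- (RI_Chasles mass z (z + k)) by apply mass_cont.
  assert (H1 : 0 <= RInt mass (z + k) (z + 2 * PI))
    by (apply RI_ge0; [lra | apply mass_cont | intros; apply mass_nonneg]).
  assert (H2 : RInt (fun _ => k * exp (-10)) z (z + k) <= RInt mass z (z + k)).
  { apply RI_le; [lra | apply cont_const | apply mass_cont |]. intros s Hs.
    unfold mass. rewrite <- (RI_Chasles (fun x => y s x ^ p) 0 k) by apply yp_cont.
    assert (H3 : 0 <= RInt (fun x => y s x ^ p) k (2 * PI))
      by (apply RI_ge0; [lra | apply yp_cont | intros; apply yp_nonneg]).
    assert (H4 : RInt (fun _ => exp (-10)) 0 k <= RInt (fun x => y s x ^ p) 0 k).
    { apply RI_le; [lra | apply cont_const | apply yp_cont |]. intros x Hx.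
      eapply Rle_trans; [apply (one_minus_pow p Hp10)|].
      assert (H5 : 0 <= 1 - 5 / INR p) by (unfold Rdiv;
        assert (/ INR p <= / 10) by (apply Rinv_le_contravar; lra); lra).
      apply pow_incr. split; [exact H5|].
      assert (H6 := Hynear s x). apply Rabs_le_between in H6.
      set (t := s - z). assert (Ht : 0 <= t <= k) by (unfold t; lra).
      assert (C1 : cos s = cos t).
      { unfold t, z. rewrite Rplus_0_l. rewrite <- (cos_period (s - INR i * (2 * PI)) i). f_equal; ring. }
      assert (C2 : cos (2 * s) = cos (2 * t)).
      { rewrite !cos_2a_cos, C1. reflexivity. }
      assert (K1 := cos_ge_quadratic t ltac:(lra)). assert (K2 := cos_ge_quadratic (2 * t) ltac:(lra)).
      assert (K3 := cos_ge_quadratic (2 * x) ltac:(lra)).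
      assert (T1 : t ^ 2 <= / INR p) by (rewrite <- Hk2; simpl; nra).
      assert (T2 : x ^ 2 <= / INR p) by (rewrite <- Hk2; simpl; nra).
      unfold Yfun in H6. rewrite C1, C2 in H6. replace (INR 2) with 2 in H6 by (simpl; ring).
      assert (P1 : 1 - 2 * / INR p <= cos (2 * t)) by (simpl in *; lra).
      assert (P2 : 1 - 2 * / INR p <= cos (2 * x)) by (simpl in *; lra).
      assert (P3 : 1 - 4 * / INR p <= cos (2 * t) * cos (2 * x)).
      { apply Rle_trans with ((1 - 2 * / INR p) * (1 - 2 * / INR p)); [nra|].
        apply Rmult_le_compat; lra. }
      assert (P4 : c * (1 - 4 * / INR p) <= c * cos t) by (apply Rmult_le_compat_l; [lra | simpl in *; lra]).
      assert (P5 : d * (1 - 4 * / INR p) <= d * (cos (2 * t) * cos (2 * x))) by (apply Rmult_le_compat_l; lra).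
      assert (P6 : c * (1 - 4 * / INR p) + d * (1 - 4 * / INR p) = 1 - 4 * / INR p)
        by (rewrite <- Rmult_plus_distr_r, Hcd; ring).
      unfold Rdiv. lra. }
    rewrite RI_const in H4. lra. }
  rewrite RI_const in H2. replace ((z + k - z) * (k * exp (-10))) with (k * k * exp (-10)) in H2 by ring.
  rewrite Hk2 in H2. unfold Rdiv. lra.
Qed.

Lemma Eg_RInt_T (l : R) : 0 < l -> RInt (Eg l) 0 T <= INR K * Gb l.
Proof.
  intros Hl. unfold T. rewrite <- (Rplus_0_l (INR K * (2 * PI))). apply RI_blocks_le; [apply Eg_cont|].
  intros i. replace (0 + INR i * (2 * PI)) with (- (2 * PI) + INR (S i) * (2 * PI)) by (rewrite S_INR; ring).
  replace (0 + INR (S i) * (2 * PI)) with (- (2 * PI) + INR (S (S i)) * (2 * PI)) by (rewrite (S_INR (S i)); ring).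
  rewrite RI_period by (apply Eg_cont || apply Eg_period). now apply Eg_RInt.
Qed.

Lemma Gb_le (l : R) : lam * m / 2 <= l -> Gb l <= Gb (lam * m / 2).
Proof.
  intros Hl. destruct lam_ge as [L1 L2].
  assert (H0 : 0 < lam * m) by (apply Rmult_lt_0_compat; lra).
  apply Gb_mono; lra.
Qed.

(** The main term is K exp(-10)/p; each correction has two peak widths and one moment gain, hence
    order K n^2 / (p m)^2. The hypothesis on n makes the corrections at most half of the main term:
    216000 = (48 + 12) times 4 times 900, and lam >= p/2 together with the half gives a further
    factor 8. *)
Lemma resonance (n : nat) : (1 <= n)%nat -> (4 * n < p)%nat ->
  1728000 * PI ^ 2 * INR n ^ 2 <= exp (-10) * INR p * m ^ 2 ->
  INR K * (exp (-10) / (2 * PI * INR p)) <= DC (om p (4 * n)) (h (4 * n)) T.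
Proof.
  intros Hn Hnp Hc3. destruct lam_ge as [L1 L2]. assert (HP := PI_RGT_0).
  assert (Hp' := INRp_ge p Hp).
  assert (Hlm : 0 < lam * m) by (apply Rmult_lt_0_compat; lra).
  assert (Hlc : lam * m <= lam * c) by (apply Rmult_le_compat_l; lra).
  assert (Hld : lam * m <= lam * d) by (apply Rmult_le_compat_l; lra).
  assert (HT : 0 <= T) by (unfold T; apply Rmult_le_pos; [apply pos_INR | lra]).
  rewrite om_eq by lia. unfold DC.
  rewrite (RInt_ext _ (fun s => cos (INR (4 * n) * s) * cf (fun x => y s x ^ p) (4 * n))).
  2: { intros s. rewrite Rmin_left, Rmax_right by exact HT. intros Hs. unfold h, hist.
       rewrite cut_1 by lra. now rewrite Rmult_1_l. }
  set (J := RInt (fun x => Eg (lam * d) (2 * x)) 0 (2 * PI)).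
  set (J2 := RInt (fun x => sin (2 * x) ^ 2 * Eg (lam * d) (2 * x)) 0 (2 * PI)).
  (* The moment bound halves the parameter of the profile; using the halved one everywhere gives one
     bound for all four integrals. *)
  set (g := Gb (lam * m / 2)).
  assert (Hg : 0 < g) by (apply Gb_pos; lra).
  assert (BJ : 0 <= J <= g).
  { split.
    - apply RI_ge0; [lra | apply Eg2_cont | intros; apply Rlt_le, Eg_pos].
    - eapply Rle_trans; [apply Eg2_RInt; lra | apply Gb_le; lra]. }
  assert (H4 : 4 / (lam * d) <= 4 / (lam * m) /\ 4 / (lam * c) <= 4 / (lam * m)).
  { unfold Rdiv. split; (apply Rmult_le_compat_l; [lra|]; apply Rinv_le_contravar; lra). }
  assert (H40 : 0 < 4 / (lam * d) /\ 0 < 4 / (lam * c)) by (split; apply Rdiv_lt_0_compat; lra).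
  assert (BJ2 : 0 <= J2 <= 4 / (lam * m) * g).
  { split.
    - apply RI_ge0; [lra | apply sinE2_cont |]. intros x _.
      apply Rmult_le_pos; [apply pow2_ge_0 | apply Rlt_le, Eg_pos].
    - apply Rle_trans with (RInt (fun x => 4 / (lam * d) * Eg (lam * d / 2) (2 * x)) 0 (2 * PI)).
      + apply RI_le; [lra | apply sinE2_cont | apply cont_scal, Eg2_cont |]. intros x _. apply Eg_moment. lra.
      + rewrite RI_scal by apply Eg2_cont. apply Rmult_le_compat; try lra.
        * apply RI_ge0; [lra | apply Eg2_cont | intros; apply Rlt_le, Eg_pos].
        * eapply Rle_trans; [apply Eg2_RInt; lra | apply Gb_le; lra]. }
  assert (CsE : cont (fun s => sin s ^ 2 * Eg (lam * c) s)).
  { apply cont_mult; [|apply Eg_cont]. apply cont_pow.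
    apply (cont_ext (fun s => sin (1 * s))); [intros; now rewrite Rmult_1_l | apply cont_sinI]. }
  assert (I1 : 0 <= RInt (Eg (lam * c)) 0 T <= INR K * g).
  { split.
    - apply RI_ge0; [exact HT | apply Eg_cont | intros; apply Rlt_le, Eg_pos].
    - eapply Rle_trans; [apply Eg_RInt_T; lra|]. apply Rmult_le_compat_l; [apply pos_INR | apply Gb_le; lra]. }
  assert (I2 : 0 <= RInt (fun s => sin s ^ 2 * Eg (lam * c) s) 0 T <= 4 / (lam * m) * (INR K * g)).
  { split.
    - apply RI_ge0; [exact HT | exact CsE |]. intros x _.
      apply Rmult_le_pos; [apply pow2_ge_0 | apply Rlt_le, Eg_pos].
    - apply Rle_trans with (RInt (fun s => 4 / (lam * c) * Eg (lam * c / 2) s) 0 T).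
      + apply RI_le; [exact HT | exact CsE | apply cont_scal, Eg_cont |]. intros x _. apply Eg_moment. lra.
      + rewrite RI_scal by apply Eg_cont. apply Rmult_le_compat; try lra.
        * apply RI_ge0; [exact HT | apply Eg_cont | intros; apply Rlt_le, Eg_pos].
        * eapply Rle_trans; [apply Eg_RInt_T; lra|].
          apply Rmult_le_compat_l; [apply pos_INR | apply Gb_le; lra]. }
  assert (I0 : INR K * (exp (-10) / INR p) <= RInt mass 0 T).
  { unfold T. rewrite <- (Rplus_0_l (INR K * (2 * PI))).
    apply RI_blocks_ge; [apply mass_cont | apply mass_block]. }
  set (B1 := 48 * INR n ^ 2 * J). set (B2 := 12 * INR n ^ 2 * J2).
  apply Rle_trans with (RInt (fun s => / PI * (mass s - (B1 * (sin s ^ 2 * Eg (lam * c) s) + B2 * Eg (lam * c) s))) 0 T).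
  2: { apply RI_le; [exact HT | | |].
       - apply cont_scal, cont_minus; [apply mass_cont|].
         apply cont_plus; apply cont_scal; [exact CsE | apply Eg_cont].
       - apply cont_mult; [apply cont_cosI|]. apply (UC_cf (fun s x => y s x ^ p)); [exact HyU | apply yp_cont].
       - intros s _. eapply Rle_trans; [|apply (resonance_pt n s Hn)].
         apply Rmult_le_compat_l; [apply Rlt_le, Rinv_0_lt_compat, HP|]. fold J J2 B1 B2. lra. }
  rewrite RI_scal
    by (apply cont_minus; [apply mass_cont | apply cont_plus; apply cont_scal; [exact CsE | apply Eg_cont]]).
  rewrite RI_minus; [|apply mass_cont | apply cont_plus; apply cont_scal; [exact CsE | apply Eg_cont]].
  rewrite RI_plus; [|apply cont_scal, CsE | apply cont_scal, Eg_cont].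
  rewrite (RI_scal B1) by exact CsE. rewrite (RI_scal B2) by apply Eg_cont.
  assert (Hn2 := pow2_ge_0 (INR n)). assert (HK := pos_INR K).
  assert (X1 : B1 * RInt (fun s => sin s ^ 2 * Eg (lam * c) s) 0 T
    <= 48 * INR n ^ 2 * g * (4 / (lam * m) * (INR K * g))).
  { apply Rmult_le_compat; try apply I2; [unfold B1; apply Rmult_le_pos; lra|].
    unfold B1. apply Rmult_le_compat_l; lra. }
  assert (X2 : B2 * RInt (Eg (lam * c)) 0 T <= 12 * INR n ^ 2 * (4 / (lam * m) * g) * (INR K * g)).
  { apply Rmult_le_compat; try apply I1; [unfold B2; apply Rmult_le_pos; lra|].
    unfold B2. apply Rmult_le_compat_l; lra. }
  assert (X3 : 48 * INR n ^ 2 * g * (4 / (lam * m) * (INR K * g))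
    + 12 * INR n ^ 2 * (4 / (lam * m) * g) * (INR K * g)
    = INR K * (216000 * PI ^ 2 * INR n ^ 2 / (lam * m) ^ 2)).
  { assert (Hgg := Gb_sq (lam * m / 2) ltac:(lra)). fold g in Hgg.
    replace (48 * INR n ^ 2 * g * (4 / (lam * m) * (INR K * g))
      + 12 * INR n ^ 2 * (4 / (lam * m) * g) * (INR K * g))
      with (240 * INR n ^ 2 * / (lam * m) * INR K * (g * g)) by (field; split; lra).
    rewrite Hgg. field. split; lra. }
  assert (X4 : 216000 * PI ^ 2 * INR n ^ 2 / (lam * m) ^ 2 <= exp (-10) / (2 * INR p)).
  { assert (Hpm : 0 < INR p * m / 2) by (apply Rdiv_lt_0_compat; [apply Rmult_lt_0_compat|]; lra).
    apply Rle_trans with (216000 * PI ^ 2 * INR n ^ 2 / (INR p * m / 2) ^ 2).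
    - unfold Rdiv at 1 2. apply Rmult_le_compat_l.
      + apply Rmult_le_pos; [|exact Hn2]. assert (0 <= PI ^ 2) by apply pow2_ge_0. lra.
      + apply Rinv_le_contravar; [apply pow_lt; exact Hpm|]. apply pow_incr. split; [lra|].
        replace (INR p * m / 2) with (INR p / 2 * m) by field. apply Rmult_le_compat_r; lra.
    - replace (216000 * PI ^ 2 * INR n ^ 2 / (INR p * m / 2) ^ 2)
        with (1728000 * PI ^ 2 * INR n ^ 2 * / (2 * (INR p * m) ^ 2)) by (field; split; lra).
      replace (exp (-10) / (2 * INR p)) with (exp (-10) * INR p * m ^ 2 * / (2 * (INR p * m) ^ 2))
        by (field; split; lra).
      apply Rmult_le_compat_r; [|exact Hc3]. apply Rlt_le, Rinv_0_lt_compat.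
      assert (0 < (INR p * m) ^ 2) by (apply pow_lt; lra). lra. }
  assert (X5 := Rmult_le_compat_l _ _ _ HK X4).
  replace (INR K * (exp (-10) / (2 * PI * INR p)))
    with (/ PI * (INR K * (exp (-10) / INR p) - INR K * (exp (-10) / (2 * INR p)))) by (field; split; lra).
  apply Rmult_le_compat_l; [apply Rlt_le, Rinv_0_lt_compat, HP|]. lra.
Qed.

Lemma rate_nonneg : 0 <= INR K * (exp (-10) / (2 * PI * INR p)).
Proof.
  assert (HP := PI_RGT_0). assert (Hp' := INRp_ge p Hp).
  assert (0 < 2 * PI * INR p) by (apply Rmult_lt_0_compat; lra).
  apply Rmult_le_pos; [apply pos_INR|]. apply Rlt_le, Rdiv_lt_0_compat; [apply exp_pos | lra].
Qed.

(** The pair (j y_j, y_j') is -eps times a rotation of the amplitudes [DC] and [DS], so its energy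
    is eps^2 (DC^2 + DS^2) whatever the phase at time T. The linear solution has no component on
    these modes. *)
Lemma mode_energy (n : nat) : (1 <= n)%nat -> (4 * n < p)%nat ->
  1728000 * PI ^ 2 * INR n ^ 2 <= exp (-10) * INR p * m ^ 2 ->
  (eps * (INR K * (exp (-10) / (2 * PI * INR p)))) ^ 2
  <= INR (4 * n) ^ 2 * cf (y T) (4 * n) ^ 2 + mode1 (4 * n) T ^ 2.
Proof.
  intros Hn Hnp Hc3. assert (HR := resonance n Hn Hnp Hc3).
  assert (H0 := rate_nonneg).
  rewrite Hycf, cf_Yfun. unfold mode1, Yc, Yc1.
  destruct (Nat.eq_dec 0 (4 * n)), (Nat.eq_dec 2 (4 * n)); try lia. unfold Duh, Duh'.
  set (C := DC (om p (4 * n)) (h (4 * n)) T) in *. set (D := DS (om p (4 * n)) (h (4 * n)) T).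
  rewrite om_eq by lia. set (j := INR (4 * n)).
  assert (Hj : j <> 0) by (apply not_0_INR; lia).
  assert (E := sin2_cos2 (j * T)). unfold Rsqr in E.
  set (sn := sin (j * T)) in *. set (cs := cos (j * T)) in *.
  match goal with |- _ <= ?u => replace u with (eps ^ 2 * ((sn * sn + cs * cs) * (C ^ 2 + D ^ 2)))
    by (field; exact Hj) end.
  rewrite E, Rpow_mult_distr. apply Rmult_le_compat_l; [apply pow2_ge_0|].
  assert (HD := pow2_ge_0 D).
  assert ((INR K * (exp (-10) / (2 * PI * INR p))) ^ 2 <= C ^ 2) by (apply pow_incr; lra). lra.
Qed.

(** The Sobolev series is indexed by k = j - 1, so mode 4 n sits at index 4 n - 1. *)
Lemma sparse_sum (t : nat -> R) (n1 i : nat) (v : R) : (forall k, 0 <= t k) ->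
  (forall n, (n1 < n <= n1 + i)%nat -> v <= t (4 * n - 1)%nat) ->
  INR i * v <= sum_f_R0 t (4 * (n1 + i)).
Proof.
  intros Ht Hv. induction i as [|i IH].
  - simpl INR. rewrite Rmult_0_l. apply cond_pos_sum, Ht.
  - replace (4 * (n1 + S i))%nat with (S (S (S (S (4 * (n1 + i)))))) by lia. rewrite !tech5.
    specialize (Hv (n1 + S i)%nat ltac:(lia)) as Hv1.
    replace (4 * (n1 + S i) - 1)%nat with (S (S (S (4 * (n1 + i))))) in Hv1 by lia.
    specialize (IH (fun n Hn => Hv n ltac:(lia))). rewrite S_INR.
    assert (A1 := Ht (S (4 * (n1 + i)))). assert (A2 := Ht (S (S (4 * (n1 + i))))).
    assert (A4 := Ht (S (S (S (S (4 * (n1 + i))))))). lra.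
Qed.

Lemma sum_le_Series (t : nat -> R) (n : nat) : ex_series t -> (forall k, 0 <= t k) ->
  sum_f_R0 t n <= Series t.
Proof.
  intros Hs Ht. assert (H := Series_tail_bound (fun _ => 0) t n Hs).
  assert (0 <= Series t - sum_f_R0 t n); [|lra].
  eapply Rle_trans; [apply Rabs_pos | apply H]. intros k. rewrite Rabs_R0. apply Ht.
Qed.

(** The two Sobolev weights combine to j^(2s-1) times the oscillator energy. The n1 modes 4 n with
    n1 < n <= 2 n1 then contribute at least n1 times n1^(2s-1), that is n1^(2s); the resonance
    conditions are imposed at the largest index 2 n1. The sum of two square roots dominates the root
    of the sum. *)
Lemma Es_growth (s : R) (n1 : nat) : 1 <= s -> (1 <= n1)%nat -> (8 * n1 < p)%nat ->
  1728000 * PI ^ 2 * INR (2 * n1) ^ 2 <= exp (-10) * INR p * m ^ 2 ->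
  A * (eps * (INR K * (exp (-10) / (2 * PI * INR p)))) * Rpower (INR n1) s <= Es_norm s usol T.
Proof.
  intros Hs Hn1 Hnp Hc3. set (al := eps * (INR K * (exp (-10) / (2 * PI * INR p)))).
  assert (HP := PI_RGT_0).
  assert (Hal : 0 <= al) by (apply Rmult_le_pos; [exact Heps | apply rate_nonneg]).
  destruct (dt_usol_W T) as (q' & B & HW). unfold Es_norm.
  rewrite (Hs_norm_cf q _ _ _ (usol_W T)), (Hs_norm_cf q' _ _ _ HW).
  set (t1 := fun k => Rpower (INR (S k)) (2 * (s + / 2)) * (cf (usol T) (S k) ^ 2 / 4)).
  set (t2 := fun k => Rpower (INR (S k)) (2 * (s - / 2)) * (cf (dt usol T) (S k) ^ 2 / 4)).
  assert (X1 : ex_series t1).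
  { apply ex_series_ext with (2 := usol_fin (s + / 2) T). intros k. unfold Hs_terms, t1.
    now rewrite (fc_sq_S q _ _ k (usol_W T)). }
  assert (X2 : ex_series t2).
  { apply ex_series_ext with (2 := dt_usol_fin (s - / 2) T). intros k. unfold Hs_terms, t2.
    now rewrite (fc_sq_S q' _ _ k HW). }
  assert (N1 : forall k, 0 <= t1 k).
  { intros k. apply Rmult_le_pos; [apply Rlt_le, exp_pos|].
    assert (H := pow2_ge_0 (cf (usol T) (S k))). lra. }
  assert (N2 : forall k, 0 <= t2 k).
  { intros k. apply Rmult_le_pos; [apply Rlt_le, exp_pos|].
    assert (H := pow2_ge_0 (cf (dt usol T) (S k))). lra. }
  set (v := Rpower (INR (4 * n1)) (2 * s - 1) * (A ^ 2 / 4 * al ^ 2)).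
  assert (Hn1p : 1 <= INR n1) by (apply (le_INR 1), Hn1).
  assert (E4 : INR (4 * n1) = 4 * INR n1) by (rewrite mult_INR; simpl; ring).
  assert (HT : INR n1 * v <= Series t1 + Series t2).
  { rewrite <- Series_plus by assumption.
    eapply Rle_trans; [apply (sparse_sum (fun k => t1 k + t2 k) n1 n1 v)|].
    - intros k. specialize (N1 k). specialize (N2 k). lra.
    - intros n Hn. unfold t1, t2. replace (S (4 * n - 1)) with (4 * n)%nat by lia.
      rewrite usol_cf, dt_usol_cf.
      assert (HE := mode_energy n ltac:(lia) ltac:(lia)).
      assert (Hle : INR n ^ 2 <= INR (2 * n1) ^ 2)
        by (apply pow_incr; split; [apply pos_INR | apply le_INR; lia]).
      assert (HPI2 : 0 < PI ^ 2) by (apply pow_lt, HP).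
      assert (Hle2 : 1728000 * PI ^ 2 * INR n ^ 2 <= 1728000 * PI ^ 2 * INR (2 * n1) ^ 2)
        by (apply Rmult_le_compat_l; lra).
      specialize (HE ltac:(lra)). fold al in HE.
      assert (Hj : 0 < INR (4 * n)) by (apply lt_0_INR; lia).
      replace (2 * (s + / 2)) with (2 * s - 1 + INR 2) by (simpl; field).
      replace (2 * (s - / 2)) with (2 * s - 1) by field.
      rewrite Rpower_plus, (Rpower_pow 2) by exact Hj.
      match goal with |- _ <= ?u => replace u with (Rpower (INR (4 * n)) (2 * s - 1) *
        (A ^ 2 / 4 * (INR (4 * n) ^ 2 * cf (y T) (4 * n) ^ 2 + mode1 (4 * n) T ^ 2))) by field end.
      unfold v. assert (HA2 : 0 <= A ^ 2 / 4) by (assert (H := pow2_ge_0 A); lra).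
      apply Rmult_le_compat.
      + apply Rlt_le, exp_pos.
      + apply Rmult_le_pos; [exact HA2 | apply pow2_ge_0].
      + apply Rle_Rpower_l; [lra|]. split; [apply lt_0_INR; lia | apply le_INR; lia].
      + now apply Rmult_le_compat_l.
    - apply sum_le_Series; [now apply (ex_series_plus t1 t2)|].
      intros k. specialize (N1 k). specialize (N2 k). lra. }
  set (X := cf (usol T) 0 ^ 2 + 2 * Series t1). set (Y := cf (dt usol T) 0 ^ 2 + 2 * Series t2).
  assert (P1 : 0 <= Series t1) by (eapply Rle_trans; [|apply (sum_le_Series t1 0 X1 N1)]; apply N1).
  assert (P2 : 0 <= Series t2) by (eapply Rle_trans; [|apply (sum_le_Series t2 0 X2 N2)]; apply N2).
  assert (Q1 := pow2_ge_0 (cf (usol T) 0)). assert (Q2 := pow2_ge_0 (cf (dt usol T) 0)).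
  assert (X0 : 0 <= X) by (unfold X; lra). assert (Y0 : 0 <= Y) by (unfold Y; lra).
  assert (HXY : (A * al * Rpower (INR n1) s) ^ 2 <= X + Y).
  { apply Rle_trans with (2 * (INR n1 * v)); [|unfold X, Y; lra].
    unfold v. rewrite E4, <- Rpower_mult_distr by lra.
    (* The factor 4^(2s-1) from the frequencies 4 n outweighs the 1/4 left by the normalisation of
       the coefficients. *)
    assert (H4 : 4 <= Rpower 4 (2 * s - 1)).
    { rewrite <- (Rpower_1 4) at 1 by lra. apply Rle_Rpower; lra. }
    assert (Es : Rpower (INR n1) s ^ 2 = INR n1 * Rpower (INR n1) (2 * s - 1)).
    { rewrite <- (Rpower_1 (INR n1)) at 2 by lra. rewrite <- Rpower_plus.
      rewrite <- Rpower_pow, Rpower_mult by apply exp_pos. f_equal. simpl. ring. }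
    rewrite !Rpow_mult_distr, Es.
    assert (Hr : 0 < Rpower (INR n1) (2 * s - 1)) by apply exp_pos.
    assert (Hz : 0 <= A ^ 2 * al ^ 2 * (INR n1 * Rpower (INR n1) (2 * s - 1))).
    { apply Rmult_le_pos; [apply Rmult_le_pos; apply pow2_ge_0 | apply Rmult_le_pos; lra]. }
    apply Rle_trans with (Rpower 4 (2 * s - 1) / 2 * (A ^ 2 * al ^ 2 * (INR n1 * Rpower (INR n1) (2 * s - 1)))).
    - nra.
    - apply Req_le. field. }
  assert (SX := sqrt_pos X). assert (SY := sqrt_pos Y).
  apply Rsqr_incr_0_var; [|lra]. unfold Rsqr. simpl pow in HXY. rewrite Rmult_1_r in HXY.
  eapply Rle_trans; [exact HXY|].
  assert (RX := sqrt_sqrt X X0). assert (RY := sqrt_sqrt Y Y0). nra.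
Qed.

End Solution.

(** * Choice of parameters *)

Lemma ln_le_minus_1 (x : R) : 0 < x -> ln x <= x - 1.
Proof. intros Hx. assert (H := exp_ineq1_le (ln x)). rewrite exp_ln in H by exact Hx. lra. Qed.

Lemma ln_INR_nonneg (n : nat) : (1 <= n)%nat -> 0 <= ln (INR n).
Proof. intros Hn. rewrite <- ln_1. apply ln_le; [lra | apply (le_INR 1), Hn]. Qed.

(** The harmonic sum telescopes against ln(k + 1) - ln k >= 1/(k + 1); the 2 accounts for modes 0
    and 1. This is the origin of the logarithm in the time of control. *)
Lemma sum_inv_om (p n : nat) : sum_f_R0 (fun j => / om p j) (S n) <= 2 + ln (INR (S n)).
Proof.
  assert (B1 : forall j, / om p j <= 1).
  { intros j. rewrite <- Rinv_1. apply Rinv_le_contravar; [lra | apply om_ge_1]. }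
  induction n as [|n IH].
  - simpl sum_f_R0. simpl INR. rewrite ln_1. assert (H0 := B1 0%nat). assert (H1 := B1 1%nat). lra.
  - rewrite tech5.
    assert (P1 : 0 < INR (S n)) by (apply lt_0_INR; lia).
    assert (P2 : 0 < INR (S (S n))) by (apply lt_0_INR; lia).
    assert (H1 : / om p (S (S n)) <= / INR (S (S n)))
      by (apply Rinv_le_contravar; [exact P2 | apply om_ge_INR]).
    assert (H2 := ln_le_minus_1 (INR (S n) * / INR (S (S n)))
      ltac:(apply Rmult_lt_0_compat; [lra | now apply Rinv_0_lt_compat])).
    rewrite ln_mult, ln_Rinv in H2 by (try lra; now apply Rinv_0_lt_compat).
    assert (E : INR (S n) * / INR (S (S n)) - 1 = - / INR (S (S n))).
    { rewrite (S_INR (S n)). field. rewrite <- (S_INR (S n)). lra. }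
    lra.
Qed.

Lemma weight_sum (p : nat) : (4 <= p)%nat ->
  sum_f_R0 (fun j => (1 + / INR p) ^ j / om p j) p <= 3 * (2 + ln (INR p)).
Proof.
  intros Hp. assert (HI := invp_pos p Hp). assert (Hp' := INRp_ge p Hp).
  apply Rle_trans with (sum_f_R0 (fun j => / om p j * 3) p).
  - apply sum_f_R0_le. intros j Hj. unfold Rdiv. rewrite Rmult_comm.
    assert (Ho := om_ge_1 p j). apply Rmult_le_compat_l; [apply Rlt_le, Rinv_0_lt_compat; lra|].
    apply Rle_trans with ((1 + / INR p) ^ p); [apply Rle_pow; [lra | exact Hj]|].
    apply Rle_trans with (exp (/ INR p) ^ p); [apply pow_incr; split; [lra | apply exp_ineq1_le]|].
    rewrite exp_INR_pow, Rinv_r by lra. apply exp_le_3.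
  - rewrite <- scal_sum. apply Rmult_le_compat_l; [lra|].
    assert (H := sum_inv_om p (p - 1)). replace (S (p - 1)) with p in H by lia. exact H.
Qed.

(** The two peak integrals multiply to at most 3 K times 900 PI^2/(p m), cancelling the factor p.
    The low modes then give 6 times 3 times 3 times 900 = 48600, the high modes 162 times 6 = 972,
    and 50000 exceeds their sum. *)
Lemma picard_smallness (p K : nat) (c d eps m : R) : (10 <= p)%nat -> (1 <= K)%nat -> 0 <= eps ->
  0 < m <= 1 -> m <= c -> m <= d ->
  eps * INR K * (2 + ln (INR p)) * (50000 * PI / m) <= / 2 ->
  eps * (6 * sum_f_R0 (fun j => (1 + / INR p) ^ j / om p j) p * INR p
    * RInt (fun x => Eg (INR (p - 1) * d) (2 * x)) 0 (2 * PI)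
    * RInt (Eg (INR (p - 1) * c)) (- (2 * PI)) (INR (S K) * (2 * PI)) / PI
    + 162 * (INR (S K) * (2 * PI) - - (2 * PI))) <= / 2.
Proof.
  intros Hp HK Heps Hm Hmc Hmd H. eapply Rle_trans; [|exact H].
  replace (eps * INR K * (2 + ln (INR p)) * (50000 * PI / m))
    with (eps * (INR K * (2 + ln (INR p)) * (50000 * PI / m))) by ring.
  apply Rmult_le_compat_l; [exact Heps|].
  assert (HP := PI_RGT_0). assert (Hp4 : (4 <= p)%nat) by lia. assert (Hp' := INRp_ge p Hp4).
  assert (HK' : 1 <= INR K) by (apply (le_INR 1), HK).
  set (lam := INR (p - 1)).
  assert (Hl : INR p / 2 <= lam) by (unfold lam; rewrite minus_INR by lia; simpl; lra).
  set (L := sum_f_R0 (fun j => (1 + / INR p) ^ j / om p j) p).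
  assert (HL := weight_sum p Hp4). fold L in HL.
  assert (HL0 : 0 <= L).
  { apply cond_pos_sum. intros j. assert (HI := invp_pos p Hp4). assert (Ho := om_ge_1 p j).
    apply Rmult_le_pos; [apply pow_le; lra | apply Rlt_le, Rinv_0_lt_compat; lra]. }
  assert (Hln := ln_INR_nonneg p ltac:(lia)). set (ll := 2 + ln (INR p)) in *.
  assert (Hlm : 0 < lam * m) by (apply Rmult_lt_0_compat; lra).
  assert (Hlc : lam * m <= lam * c) by (apply Rmult_le_compat_l; lra).
  assert (Hld : lam * m <= lam * d) by (apply Rmult_le_compat_l; lra).
  set (g := Gb (lam * m)). assert (Hg : 0 < g) by (apply Gb_pos, Hlm).
  set (J := RInt (fun x => Eg (lam * d) (2 * x)) 0 (2 * PI)).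
  set (Q := RInt (Eg (lam * c)) (- (2 * PI)) (INR (S K) * (2 * PI))).
  assert (HSK : 0 <= INR (S K) * (2 * PI)) by (apply Rmult_le_pos; [apply pos_INR | lra]).
  assert (BJ : 0 <= J <= g).
  { split; [apply RI_ge0; [lra | apply Eg2_cont | intros; apply Rlt_le, Eg_pos]|].
    eapply Rle_trans; [apply Eg2_RInt; lra | apply Gb_mono; lra]. }
  assert (BQ : 0 <= Q <= 3 * INR K * g).
  { split; [apply RI_ge0; [lra | apply Eg_cont | intros; apply Rlt_le, Eg_pos]|].
    eapply Rle_trans; [apply Eg_RInt_long; lra|].
    apply Rmult_le_compat; [apply pos_INR | apply Rlt_le, Gb_pos; lra | rewrite plus_INR; simpl; lra |].
    apply Gb_mono; lra. }
  assert (BJQ : J * Q <= 3 * INR K * (900 * PI ^ 2 / (INR p * m))).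
  { apply Rle_trans with (g * (3 * INR K * g)); [apply Rmult_le_compat; lra|].
    replace (g * (3 * INR K * g)) with (3 * INR K * (g * g)) by ring.
    apply Rmult_le_compat_l; [lra|]. unfold g. rewrite Gb_sq by exact Hlm.
    replace (900 * PI ^ 2 / (INR p * m)) with (450 * PI ^ 2 / (INR p / 2 * m)) by (field; lra).
    unfold Rdiv at 1 2. assert (0 <= PI ^ 2) by apply pow2_ge_0. apply Rmult_le_compat_l; [lra|].
    apply Rinv_le_contravar; [apply Rmult_lt_0_compat; lra | apply Rmult_le_compat_r; lra]. }
  assert (X1 : 6 * L * INR p * J * Q / PI <= 48600 * PI * INR K * ll / m).
  { replace (6 * L * INR p * J * Q / PI) with (6 * INR p / PI * (L * (J * Q))) by (field; lra).
    replace (48600 * PI * INR K * ll / m)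
      with (6 * INR p / PI * (3 * ll * (3 * INR K * (900 * PI ^ 2 / (INR p * m))))) by (field; lra).
    apply Rmult_le_compat_l; [apply Rlt_le, Rdiv_lt_0_compat; lra|].
    apply Rmult_le_compat; try lra. apply Rmult_le_pos; lra. }
  assert (Him : 1 <= / m) by (rewrite <- Rinv_1; apply Rinv_le_contravar; lra).
  assert (X2 : 162 * (INR (S K) * (2 * PI) - - (2 * PI)) <= 972 * PI * INR K * ll / m).
  { rewrite S_INR. apply Rle_trans with (972 * PI * INR K).
    - assert (PI * 1 <= PI * INR K) by (apply Rmult_le_compat_l; lra). lra.
    - replace (972 * PI * INR K * ll / m) with (972 * PI * INR K * (ll * / m)) by (unfold Rdiv; ring).
      apply Rle_trans with (972 * PI * INR K * 1); [lra|].
      apply Rmult_le_compat_l; [apply Rmult_le_pos; lra|].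
      apply Rle_trans with (ll * 1); [unfold ll; lra | apply Rmult_le_compat_l; unfold ll; lra]. }
  apply Rle_trans with (48600 * PI * INR K * ll / m + 972 * PI * INR K * ll / m); [lra|].
  assert (0 <= PI * INR K * ll / m).
  { unfold Rdiv. apply Rmult_le_pos; [|lra].
    apply Rmult_le_pos; [apply Rmult_le_pos; lra | unfold ll; lra]. }
  unfold Rdiv in *. lra.
Qed.

Lemma Rpower2_le_quarter (s : R) : 2 < s -> Rpower 2 (- s) <= / 4.
Proof.
  intros Hs. apply Rle_trans with (Rpower 2 (- INR 2)).
  - apply Rle_Rpower; simpl; lra.
  - rewrite Rpower_Ropp, Rpower_pow by lra. simpl. lra.
Qed.

Lemma pow_lt_mono (x y : R) (n : nat) : 0 <= y < x -> y ^ S n < x ^ S n.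
Proof.
  intros H. induction n as [|n IH]; [simpl; lra|].
  change (y * y ^ S n < x * x ^ S n). apply Rmult_le_0_lt_compat; try lra. apply pow_le; lra.
Qed.

(* Moving mass between the modes [0] and [2] tunes the norm of the data at fixed sup-norm [c + d]. *)
Lemma amplitude_exists (s X : R) (k : nat) : 2 < s -> (1 <= k)%nat ->
  (3 / 2) ^ k <= X -> X <= 2 ^ k ->
  exists d, Rpower 2 (- s) <= d <= 3 / 4 /\ nu (1 - d) d s ^ k = X /\ 1 <= nu (1 - d) d s <= 2.
Proof.
  intros Hs Hk HX1 HX2. set (m := Rpower 2 (- s)). set (R2 := Rpower 2 (2 * s)).
  assert (Hm : 0 < m <= / 4) by (split; [apply exp_pos | now apply Rpower2_le_quarter]).
  assert (HRm : R2 * m ^ 2 = 1).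
  { unfold R2, m. rewrite <- Rpower_pow, Rpower_mult, <- Rpower_plus by apply exp_pos.
    replace (2 * s + - s * INR 2) with 0 by (simpl; ring). apply Rpower_O; lra. }
  assert (HR : 16 <= R2).
  { unfold R2. apply Rle_trans with (Rpower 2 (INR 4)).
    - rewrite Rpower_pow by lra. simpl. lra.
    - apply Rle_Rpower; simpl; lra. }
  assert (Hc : forall d, continuous (fun d => nu (1 - d) d s ^ k) d).
  { apply (cont_pow (fun d => nu (1 - d) d s)). intros d. unfold nu.
    apply (continuous_comp (fun d => (1 - d) ^ 2 + Rpower 2 (2 * s) * d ^ 2) sqrt); [|apply continuous_sqrt].
    revert d. apply cont_derive with (fun d => - 2 * (1 - d) + Rpower 2 (2 * s) * (2 * d)).
    intros d. auto_derive; [easy | ring]. }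
  (* At d = m = 2^(-s) mode 2 contributes exactly 1, so nu^2 = (1 - m)^2 + 1 <= 9/4. *)
  assert (Fm : nu (1 - m) m s ^ k <= X).
  { eapply Rle_trans; [|exact HX1]. apply pow_incr. split; [apply sqrt_pos|].
    unfold nu. fold R2. rewrite HRm. rewrite <- (sqrt_pow2 (3 / 2)) by lra. apply sqrt_le_1_alt. nra. }
  (* At d = 3/4, the bound 2^(2s) >= 16 gives nu >= 3, above the required 2. *)
  assert (F3 : X <= nu (1 - 3 / 4) (3 / 4) s ^ k).
  { eapply Rle_trans; [exact HX2|]. apply pow_incr. split; [lra|].
    unfold nu. fold R2. rewrite <- (sqrt_pow2 2) by lra. apply sqrt_le_1_alt. nra. }
  destruct (IVT_gen (fun d => nu (1 - d) d s ^ k) m (3 / 4) X) as (d & Hd & HdX).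
  - intros d. apply continuity_pt_filterlim, Hc.
  - split; [eapply Rle_trans; [apply Rmin_l | exact Fm] | eapply Rle_trans; [exact F3 | apply Rmax_r]].
  - rewrite Rmin_left, Rmax_right in Hd by lra. exists d. split; [exact Hd|]. split; [exact HdX|]. split.
    + unfold nu. fold R2. rewrite <- sqrt_1 at 1. apply sqrt_le_1_alt.
      assert (m ^ 2 <= d ^ 2) by (apply pow_incr; lra).
      assert (R2 * m ^ 2 <= R2 * d ^ 2) by (apply Rmult_le_compat_l; lra).
      assert (0 <= (1 - d) ^ 2) by apply pow2_ge_0. lra.
    (* The interval for d alone would allow nu > 2; the value nu^k = X <= 2^k excludes it. *)
    + apply Rnot_lt_le. intros Hn. destruct k as [|k]; [lia|].
      assert (H := pow_lt_mono (nu (1 - d) d s) 2 k ltac:(lra)). lra.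
Qed.

Lemma power_beats_log (sig M : R) : 0 < sig ->
  exists P, forall p, (P <= p)%nat -> M * (2 + ln (INR p)) <= Rpower (INR p) sig.
Proof.
  intros Hs. set (M' := Rabs M). assert (HM := Rle_abs M). fold M' in HM.
  assert (HM0 : 0 <= M') by apply Rabs_pos.
  (* For z >= z0 the 1 gives 2 + z <= 3 z, and the fraction gives 3 M' z <= (sig z / 2)^2, which is
     below exp(sig z). *)
  set (z0 := 1 + 12 * M' / sig ^ 2).
  destruct (nfloor_ex (exp z0) (Rlt_le _ _ (exp_pos z0))) as [P [_ HP]]. exists (S P). intros p Hp.
  assert (Hp1 : exp z0 <= INR p) by (apply le_INR in Hp; rewrite S_INR in Hp; lra).
  assert (He := exp_pos z0). set (z := ln (INR p)).
  assert (Hs2 : 0 < sig ^ 2) by (apply pow_lt, Hs).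
  assert (Hz0 : 0 <= 12 * M' / sig ^ 2) by (apply Rmult_le_pos; [lra | apply Rlt_le, Rinv_0_lt_compat, Hs2]).
  assert (Hz : z0 <= z) by (unfold z; rewrite <- (ln_exp z0); apply ln_le; lra).
  unfold Rpower. fold z.
  apply Rle_trans with ((sig * z / 2) ^ 2).
  - apply Rle_trans with (M' * (3 * z)).
    + apply Rle_trans with (M' * (2 + z)); [apply Rmult_le_compat_r; unfold z0 in Hz; lra|].
      apply Rmult_le_compat_l; unfold z0 in Hz; lra.
    + assert (K : 12 * M' / sig ^ 2 * sig ^ 2 <= z * sig ^ 2)
        by (apply Rmult_le_compat_r; unfold z0 in Hz; lra).
      replace (12 * M' / sig ^ 2 * sig ^ 2) with (12 * M') in K by (field; lra).
      assert (K2 : 12 * M' * z <= z * sig ^ 2 * z) by (apply Rmult_le_compat_r; unfold z0 in Hz; lra).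
      simpl in *. lra.
  - replace (sig * z) with (sig * z / 2 + sig * z / 2) at 2 by field. rewrite exp_plus.
    assert (H := exp_ineq1_le (sig * z / 2)).
    assert (0 <= sig * z) by (apply Rmult_le_pos; unfold z0 in Hz; lra).
    simpl. rewrite Rmult_1_r. apply Rmult_le_compat; lra.
Qed.

Lemma INR_le_pow2 (p : nat) : INR p <= 2 ^ p.
Proof.
  assert (H := poly p 1 ltac:(lra)). replace (1 + 1) with 2 in H by ring. lra.
Qed.

(** Quantitative form for one fixed p, with n1 still free and data of norm exactly delta. The
    asymptotics in p are left to the theorem. *)
Lemma growing_solution (s delta : R) (p n1 : nat) : 2 < s -> 0 < delta < / 2 ->
  (16 <= p)%nat -> Nat.Even p ->
  100000 * (2 + ln (INR p)) <= INR p * Rpower 2 (- s) ->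
  (1 <= n1)%nat -> (8 * n1 < p)%nat ->
  1728000 * PI ^ 2 * INR (2 * n1) ^ 2 <= exp (-10) * INR p * Rpower 2 (- s) ^ 2 ->
  exists (u : R -> R -> R) (T : R), 0 <= T /\ is_solution s p u T /\ Es_norm s u 0 = delta /\
    Rpower 2 (- s) / (50000 * (2 + ln (INR p))) / (4 * PI) * (exp (-10) / (2 * PI * INR p))
      * Rpower (INR n1) s / 2 * delta <= Es_norm s u T /\
    / 2 * (2 ^ p / (INR p * delta ^ (p - 1))) <= T /\ T <= 2 ^ p / (INR p * delta ^ (p - 1)).
Proof.
  intros Hs Hdel Hp Hev HX Hn1 Hnp Hc3.
  set (m := Rpower 2 (- s)) in *. set (ll := 2 + ln (INR p)) in *.
  assert (HP := PI_RGT_0). assert (Hp4 : (4 <= p)%nat) by lia.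
  assert (Hp' : 16 <= INR p) by (assert (H := Hp); apply le_INR in H; simpl in H; lra).
  assert (Hln := ln_INR_nonneg p ltac:(lia)). assert (Hll : 2 <= ll) by (unfold ll; lra).
  assert (Hm : 0 < m) by apply exp_pos.
  assert (Hm1 : m <= / 4) by now apply Rpower2_le_quarter.
  (* The value of eps T0 for which the smallness condition of the fixed point holds with equality
     when T0 / (2 PI) replaces K. *)
  set (th := m / (50000 * ll)). assert (Hth : 0 < th) by (apply Rdiv_lt_0_compat; lra).
  (* The value that nu^(p-1) must take so that the prescribed time T0 satisfies eps T0 = th. *)
  set (X := 2 ^ p / (INR p * th)).
  assert (H2p : 0 < 2 ^ p) by (apply pow_lt; lra).
  assert (Ep : forall x, x ^ p = x * x ^ (p - 1)).
  { intros x. replace p with (S (p - 1)) at 1 by lia. reflexivity. }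
  assert (Hpth : 0 < INR p * th) by (apply Rmult_lt_0_compat; lra).
  assert (HX2 : X <= 2 ^ (p - 1)).
  { unfold X. apply Rmult_le_reg_r with (INR p * th); [exact Hpth|].
    unfold Rdiv. rewrite Rmult_assoc, Rinv_l, Rmult_1_r, Ep by lra. rewrite (Rmult_comm 2).
    apply Rmult_le_compat_l; [apply pow_le; lra|]. unfold th.
    apply Rmult_le_reg_r with (50000 * ll); [lra|].
    replace (INR p * (m / (50000 * ll)) * (50000 * ll)) with (INR p * m) by (field; lra). lra. }
  assert (HX1 : (3 / 2) ^ (p - 1) <= X).
  { unfold X. apply Rmult_le_reg_r with (INR p * th); [exact Hpth|].
    unfold Rdiv at 2. rewrite (Rmult_assoc (2 ^ p)), Rinv_l, Rmult_1_r by lra.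
    assert (Hb := poly p (/ 3) ltac:(lra)).
    (* Splitting 2 = (3/2)(4/3) leaves (4/3)^p >= 1 + p/3 by Bernoulli, which beats p th. *)
    assert (E2 : 2 ^ p = (3 / 2) ^ p * (1 + / 3) ^ p) by (rewrite <- Rpow_mult_distr; f_equal; field).
    rewrite E2, (Ep (3 / 2)).
    assert (Hq : 0 < (3 / 2) ^ (p - 1)) by (apply pow_lt; lra).
    assert (Hth1 : th <= / 4).
    { unfold th. apply Rmult_le_reg_r with (50000 * ll); [lra|].
      replace (m / (50000 * ll) * (50000 * ll)) with m by (field; lra). nra. }
    assert (Hy : INR p * th <= 3 / 2 * (1 + / 3) ^ p).
    { apply Rle_trans with (INR p * / 4); [apply Rmult_le_compat_l; lra | lra]. }
    apply Rle_trans with ((3 / 2) ^ (p - 1) * (3 / 2 * (1 + / 3) ^ p)); [apply Rmult_le_compat_l; lra | lra]. }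
  destruct (amplitude_exists s X (p - 1) Hs ltac:(lia) HX1 HX2) as (d & Hd & HnuX & Hnu).
  fold m in Hd. set (c := 1 - d) in *. set (v := nu c d s) in *.
  set (A := delta / v). assert (HA : 0 < A) by (apply Rdiv_lt_0_compat; lra).
  set (eps := A ^ (p - 1)). assert (Heps : 0 < eps) by (apply pow_lt, HA).
  assert (Hdp : 0 < delta ^ (p - 1)) by (apply pow_lt; lra).
  set (T0 := 2 ^ p / (INR p * delta ^ (p - 1))).
  assert (HeT : eps * T0 = th).
  { unfold eps, A, T0, Rdiv. rewrite Rpow_mult_distr, pow_inv, HnuX. unfold X. field. repeat split; lra. }
  assert (HT0 : 4 * PI <= T0).
  { assert (HP4 := PI_4). apply Rle_trans with 16; [lra|]. unfold T0.
    assert (Hpp : 0 < INR p * delta ^ (p - 1)) by (apply Rmult_lt_0_compat; lra).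
    apply Rmult_le_reg_r with (INR p * delta ^ (p - 1)); [exact Hpp|].
    unfold Rdiv. rewrite (Rmult_assoc (2 ^ p)), Rinv_l, Rmult_1_r by lra.
    assert (H1 := INR_le_pow2 p).
    assert (H2 : delta ^ (p - 1) <= / 16).
    { apply Rle_trans with ((/ 2) ^ (p - 1)); [apply pow_incr; lra|].
      rewrite pow_inv. apply Rinv_le_contravar; [lra|].
      apply Rle_trans with (2 ^ 4); [simpl; lra | apply Rle_pow; [lra | lia]]. }
    nra. }
  (* T is T0 rounded down to whole periods, so the resonance is counted in full blocks; T0 >= 4 PI
     means that rounding loses at most half. *)
  destruct (nfloor_ex (T0 / (2 * PI))) as [K [HK1 HK2]].
  { apply Rlt_le, Rdiv_lt_0_compat; lra. }
  set (T := INR K * (2 * PI)).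
  assert (E0 : T0 = T0 / (2 * PI) * (2 * PI)) by (field; lra).
  assert (HT1 : T <= T0) by (rewrite E0; apply Rmult_le_compat_r; lra).
  assert (HT2 : T0 < T + 2 * PI).
  { rewrite E0. replace (T + 2 * PI) with ((INR K + 1) * (2 * PI)) by (unfold T; ring).
    apply Rmult_lt_compat_r; lra. }
  assert (HT3 : / 2 * T0 <= T) by lra.
  assert (HK : (1 <= K)%nat).
  { destruct K; [|lia]. unfold T in HT3. simpl in HT3. lra. }
  assert (Hsm : eps * INR K * ll * (50000 * PI / m) <= / 2).
  { apply Rle_trans with (eps * T0 / (2 * PI) * ll * (50000 * PI / m)).
    - apply Rmult_le_compat_r; [apply Rlt_le, Rdiv_lt_0_compat; lra|].
      apply Rmult_le_compat_r; [lra|]. unfold Rdiv. rewrite Rmult_assoc. apply Rmult_le_compat_l; lra.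
    - rewrite HeT. unfold th. apply Req_le. field. repeat split; lra. }
  assert (Hcd : c + d = 1) by (unfold c; ring).
  assert (Hcr : / 4 <= c <= 1) by (unfold c; lra). assert (Hdr : 0 <= d <= 1) by lra.
  destruct (picard_solution p (1 + / INR p) eps (- (2 * PI)) (INR (S K) * (2 * PI)) (om p) (cut T)
    (Eg (INR (p - 1) * c)) (fun x => Eg (INR (p - 1) * d) (2 * x)) (Yfun c d))
    as (y & HyU & Hynear & HyW & HypW & Hybd & Hycf).
  - exact Hp4.
  - assert (HI := invp_pos p Hp4). lra.
  - lra.
  - apply om_ge_1.
  - apply om_ge_INR.
  - apply window_0.
  - apply cut_cont.
  - apply cut_range.
  - apply cut_supp.
  - apply Eg_cont.
  - intros; apply Rlt_le, Eg_pos.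
  - apply Eg2_cont.
  - intros; apply Rlt_le, Eg_pos.
  - intros t. apply Yfun_W; lra || exact Hp4.
  - apply Yfun_UC.
  - intros t x. apply Yfun_pow; lra || exact Hp4.
  - apply (picard_smallness p K c d eps m); try lra; try lia. exact Hsm.
  - assert (Hc01 : 0 <= c <= 1) by lra. assert (Heps0 : 0 <= eps) by lra.
    assert (N0 := Es_norm_0 p K c d eps y Hp4 Hc01 Hdr Heps0 HyU HyW HypW Hycf A HA s).
    assert (ENu : A * v = delta) by (unfold A; field; lra). fold v in N0. rewrite ENu in N0.
    exists (usol y A), T. split; [|split; [|split; [|split; [|split]]]].
    + apply Rmult_le_pos; [apply pos_INR | lra].
    + apply (usol_is_solution p K c d eps y Hp4 Hc01 Hdr Heps0 HyU HyW HypW Hycf A HA eq_refl s).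
    + exact N0.
    + assert (G := Es_growth p K c d eps y Hp4 Hc01 Hdr Heps0 HyU HyW HypW Hycf A HA m ltac:(lia) Hev Hm
        ltac:(lra) ltac:(lra) Hcd Hynear Hybd s n1 ltac:(lra) Hn1 Hnp Hc3).
      eapply Rle_trans; [|exact G].
      set (rt := exp (-10) / (2 * PI * INR p)).
      assert (Hrt : 0 < rt).
      { apply Rdiv_lt_0_compat; [apply exp_pos | apply Rmult_lt_0_compat; lra]. }
      assert (Hz : 0 < Rpower (INR n1) s) by apply exp_pos.
      fold th.
      assert (HA2 : delta / 2 <= A).
      { unfold A, Rdiv. apply Rmult_le_compat_l; [lra|]. apply Rinv_le_contravar; lra. }
      assert (HeK : th / (4 * PI) <= eps * INR K).
      { rewrite <- HeT. replace (eps * T0 / (4 * PI)) with (eps * (/ 2 * T0 / (2 * PI))) by (field; lra).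
        apply Rmult_le_compat_l; [lra|]. unfold T in HT3.
        apply Rmult_le_reg_r with (2 * PI); [lra|].
        replace (/ 2 * T0 / (2 * PI) * (2 * PI)) with (/ 2 * T0) by (field; lra). exact HT3. }
      replace (th / (4 * PI) * rt * Rpower (INR n1) s / 2 * delta)
        with (delta / 2 * (th / (4 * PI)) * (rt * Rpower (INR n1) s)) by (field; lra).
      replace (A * (eps * (INR K * rt)) * Rpower (INR n1) s)
        with (A * (eps * INR K) * (rt * Rpower (INR n1) s)) by ring.
      apply Rmult_le_compat_r; [apply Rlt_le, Rmult_lt_0_compat; lra|].
      apply Rmult_le_compat; try lra. apply Rlt_le, Rdiv_lt_0_compat; lra.
    + exact HT3.
    + exact HT1.
Qed.

Theorem theorem2p1 :
  exists C1 C2 delta0 Cbig0 : R,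
    0 < C1 /\ C1 < C2 /\ 0 < delta0 /\ 0 < Cbig0 /\
    forall s : R, 2 < s ->
    forall delta : R, 0 < delta < delta0 ->
    forall Cbig : R, Cbig0 < Cbig ->
    exists p0 : nat,
      forall p : nat, (p0 <= p)%nat -> Nat.Even p ->
      exists (u : R -> R -> R) (T : R),
        0 <= T /\
        is_solution s p u T /\
        Es_norm s u 0 <= delta /\
        Es_norm s u T / Es_norm s u 0 >= Cbig /\
        C1 * (2 ^ p / (INR p * Es_norm s u 0 ^ (p - 1))) <= T /\
        T <= C2 * (2 ^ p / (INR p * Es_norm s u 0 ^ (p - 1))).
Proof.
  (* The factors 1/2 and 1 compare T with the prescribed time before rounding; delta < 1/2 makes
     that time at least 4 PI. *)
  exists (/ 2), 1, (/ 2), 1. do 4 (split; [lra|]).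
  intros s Hs delta Hdel Cbig HC.
  assert (HP := PI2_1). assert (He := exp_pos (-10)).
  set (m := Rpower 2 (- s)). assert (Hm : 0 < m) by apply exp_pos.
  assert (Hm1 : m <= / 4) by now apply Rpower2_le_quarter.
  assert (HPI2 : 4 <= PI ^ 2) by (simpl; nra).
  (* 6912000 is 4 times 1728000, the 4 coming from the square of 2 n1; with k = m sqrt w, the choice
     n1 <= k sqrt p is exactly the resonance condition. *)
  set (w := exp (-10) / (6912000 * PI ^ 2)). assert (Hw : 0 < w) by (apply Rdiv_lt_0_compat; lra).
  set (k := m * sqrt w). assert (Hsw := sqrt_lt_R0 w Hw).
  assert (Hk : 0 < k) by (apply Rmult_lt_0_compat; lra).
  assert (Hk2 : k * k = m ^ 2 * w).
  { unfold k. replace (m * sqrt w * (m * sqrt w)) with (m ^ 2 * (sqrt w * sqrt w)) by ring.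
    rewrite sqrt_sqrt by lra. reflexivity. }
  assert (Hw1 : w <= 1).
  { unfold w. apply Rmult_le_reg_r with (6912000 * PI ^ 2); [lra|].
    unfold Rdiv. rewrite Rmult_assoc, Rinv_l, Rmult_1_r, Rmult_1_l by lra.
    apply Rle_trans with 1; [|lra]. rewrite <- exp_0. apply exp_le. lra. }
  assert (Hk8 : 4 * k <= 1).
  { assert (sqrt w <= 1) by (rewrite <- sqrt_1; now apply sqrt_le_1_alt).
    unfold k. assert (m * sqrt w <= / 4 * 1) by (apply Rmult_le_compat; lra). lra. }
  set (cs := m / 50000 / (4 * PI) * (exp (-10) / (2 * PI)) * Rpower (k / 2) s / 2).
  assert (Hcs : 0 < cs).
  { unfold cs. assert (0 < Rpower (k / 2) s) by apply exp_pos.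
    assert (0 < m / 50000 / (4 * PI)) by (apply Rdiv_lt_0_compat; lra).
    assert (0 < exp (-10) / (2 * PI)) by (apply Rdiv_lt_0_compat; lra).
    apply Rdiv_lt_0_compat; [|lra]. apply Rmult_lt_0_compat; [apply Rmult_lt_0_compat|]; lra. }
  (* The three thresholds serve, in turn, to make the prescribed nu^(p-1) attainable, to get k sqrt
     p >= 2 and hence n1 >= 1, and to beat the logarithm by p^(s/2-1), a positive power because s >
     2. *)
  destruct (power_beats_log 1 (100000 / m) ltac:(lra)) as [P1 HP1].
  destruct (power_beats_log (/ 2) (/ k) ltac:(lra)) as [P2 HP2].
  destruct (power_beats_log (s / 2 - 1) (Cbig / cs) ltac:(lra)) as [P3 HP3].
  (* 65 makes sqrt p exceed 8; with 4 k <= 1 this gives 8 n1 <= 2 sqrt p < p. *)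
  exists (max 65 (max P1 (max P2 P3))). intros p Hp Hev.
  specialize (HP1 p ltac:(lia)). specialize (HP2 p ltac:(lia)). specialize (HP3 p ltac:(lia)).
  assert (Hp65 : (65 <= p)%nat) by lia.
  assert (Hp' : 65 <= INR p) by (apply le_INR in Hp65; simpl in Hp65; lra).
  assert (Hln := ln_INR_nonneg p ltac:(lia)). set (ll := 2 + ln (INR p)) in *.
  assert (Hll : 2 <= ll) by (unfold ll; lra).
  rewrite Rpower_1 in HP1 by lra. rewrite Rpower_sqrt in HP2 by lra.
  set (r := sqrt (INR p)) in *.
  assert (Hrr : r * r = INR p) by (apply sqrt_sqrt; lra).
  assert (Hr0 : 0 < r) by (apply sqrt_lt_R0; lra).
  assert (Hr : 8 < r) by nra.
  assert (Hkr : 2 <= k * r).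
  { apply Rle_trans with (k * (/ k * ll)); [|apply Rmult_le_compat_l; lra].
    rewrite <- Rmult_assoc, Rinv_r, Rmult_1_l by lra. exact Hll. }
  destruct (nfloor_ex (k * r) ltac:(lra)) as [n1 [Hn1a Hn1b]].
  assert (Hn1 : (1 <= n1)%nat).
  { destruct n1; [simpl in Hn1b; lra | lia]. }
  destruct (growing_solution s delta p n1) as (u & T & HT & Hsol & HN & HG & HT1 & HT2);
    try assumption; try lia.
  - fold m ll. apply Rmult_le_reg_r with (/ m); [now apply Rinv_0_lt_compat|].
    replace (INR p * m * / m) with (INR p) by (field; lra). unfold Rdiv in HP1. lra.
  - apply INR_lt. rewrite mult_INR. replace (INR 8) with 8 by (simpl; ring).
    assert (4 * k * r <= 1 * r) by (apply Rmult_le_compat_r; lra). nra.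
  - fold m. rewrite mult_INR. replace (INR 2) with 2 by (simpl; ring).
    assert (Hn2 : INR n1 ^ 2 <= m ^ 2 * w * INR p).
    { rewrite <- Hk2, <- Hrr. replace (k * k * (r * r)) with ((k * r) ^ 2) by ring.
      apply pow_incr. split; [apply pos_INR | exact Hn1a]. }
    replace (exp (-10) * INR p * m ^ 2) with (1728000 * PI ^ 2 * 4 * (m ^ 2 * w * INR p))
      by (unfold w; field; lra).
    replace (1728000 * PI ^ 2 * (2 * INR n1) ^ 2) with (1728000 * PI ^ 2 * 4 * INR n1 ^ 2) by ring.
    apply Rmult_le_compat_l; lra.
  - exists u, T. rewrite HN, Rmult_1_l.
    split; [exact HT|]. split; [exact Hsol|]. split; [lra|]. split; [|split; assumption].
    apply Rle_ge. apply Rmult_le_reg_r with delta; [lra|].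
    replace (Es_norm s u T / delta * delta) with (Es_norm s u T) by (field; lra).
    eapply Rle_trans; [|exact HG]. apply Rmult_le_compat_r; [lra|]. fold m ll.
    (* From k sqrt p >= 2, rounding down keeps n1 >= (k/2) sqrt p. Of the resulting p^(s/2), one
       factor p pays for the strength 1/p of the resonance. *)
    assert (Hpw : Rpower (k / 2) s * (INR p * Rpower (INR p) (s / 2 - 1)) <= Rpower (INR n1) s).
    { apply Rle_trans with (Rpower (k / 2 * r) s).
      - rewrite <- Rpower_mult_distr by lra. apply Rmult_le_compat_l; [apply Rlt_le, exp_pos|].
        rewrite <- (Rpower_1 (INR p)) at 1 by lra. rewrite <- Rpower_plus.
        unfold r. rewrite <- Rpower_sqrt, Rpower_mult by lra.
        apply Req_le. f_equal. field.
      - apply Rle_Rpower_l; [lra|]. split; [apply Rmult_lt_0_compat; lra | lra]. }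
    apply Rle_trans with (cs * (Rpower (INR p) (s / 2 - 1) / ll)).
    + apply Rmult_le_reg_r with (/ cs * ll); [apply Rmult_lt_0_compat; [now apply Rinv_0_lt_compat | lra]|].
      replace (cs * (Rpower (INR p) (s / 2 - 1) / ll) * (/ cs * ll)) with (Rpower (INR p) (s / 2 - 1))
        by (field; lra).
      unfold Rdiv in HP3. lra.
    + unfold cs.
      replace (m / 50000 / (4 * PI) * (exp (-10) / (2 * PI)) * Rpower (k / 2) s / 2 * (Rpower (INR p) (s / 2 - 1) / ll))
        with (m / (50000 * ll) / (4 * PI) * (exp (-10) / (2 * PI * INR p)) / 2
              * (Rpower (k / 2) s * (INR p * Rpower (INR p) (s / 2 - 1)))) by (field; lra).
      replace (m / (50000 * ll) / (4 * PI) * (exp (-10) / (2 * PI * INR p)) * Rpower (INR n1) s / 2)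
        with (m / (50000 * ll) / (4 * PI) * (exp (-10) / (2 * PI * INR p)) / 2 * Rpower (INR n1) s) by (field; lra).
      apply Rmult_le_compat_l; [|exact Hpw].
      assert (0 < m / (50000 * ll) / (4 * PI)) by (repeat apply Rdiv_lt_0_compat; lra).
      assert (0 < exp (-10) / (2 * PI * INR p))
        by (apply Rdiv_lt_0_compat; [lra | apply Rmult_lt_0_compat; lra]).
      apply Rlt_le, Rdiv_lt_0_compat; [apply Rmult_lt_0_compat; lra | lra].
Qed.
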